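(* Let $Q$ be a simply laced quiver with a $Q$-set $\Delta$, and let $\omega=a_2a_1\in Q_2$ be a path of length two. Set $C=A_{t(a_2)}$, $B=A_{s(a_2)}=A_{t(a_1)}$ and $A=A_{s(a_1)}$, so that $M_{a_1}$ is a $B$-$A$-bimodule and $M_{a_2}$ is a $C$-$B$-bimodule. If $\mathsf{Tor}_n^B(M_{a_2},M_{a_1})=0$ for all $n>0$, then for all $r\geq 0$ $$\mathsf{H}^{2+r}_{a_2a_1}(\Delta)=\mathsf{Ext}^r_{C-A}(M_\omega,\Delta_\omega),$$ where $M_\omega=M_{a_2}\otimes_BM_{a_1}$ and $\mathsf{Ext}_{C-A}$ denotes $\mathsf{Ext}$ of $C$-$A$-bimodules.
   Context: $k$ is a field; algebras are nonzero associative unital $k$-algebras, not necessarily finite dimensional; $\otimes=\otimes_k$. $C$-$A$-bimodules are $C\otimes A^{op}$-modules. Equalities of cohomology spaces mean canonical isomorphisms of vector spaces. **$Q$-sets.** A (finite) quiver $Q$ has a finite set $Q_0$ of vertices, a finite set $Q_1$ of arrows and source and target maps $s,t:Q_1\to Q_0$. It is simply laced if it has no loops and at most one arrow from any vertex to any other. A $Q$-set $\Delta$ consists of an algebra $A_x$ for each $x\in Q_0$; a nonzero $A_{t(a)}$-$A_{s(a)}$-bimodule $M_a={}_{t(a)}M_{s(a)}$ for each $a\in Q_1$ (put ${}_yM_x=0$ if $x\ne y$ and there is no arrow from $x$ to $y$, and ${}_xM_x=A_x$); and bimodule maps $\alpha_{z,y,x}:{}_zM_y\otimes_{A_y}{}_yM_x\to{}_zM_x$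 for $x\neq y\neq z$ satisfying the associativity constraints. $\Lambda_\Delta=(\times_xA_x)\oplus(\oplus_aM_a)$ is the algebra whose product is given by the products of the $A_x$, the bimodule structures, and the maps $\alpha$. Let $e_x$ be the unit of $A_x$. **Paths and trajectories.** A path of length $m>0$ is $\omega=a_m\cdots a_1$ with $a_i\in Q_1$, $t(a_i)=s(a_{i+1})$; $s(\omega)=s(a_1)$, $t(\omega)=t(a_m)$. $Q_m$ is the set of paths of length $m$. $\Delta_\omega=e_{t(\omega)}\Lambda_\Delta e_{s(\omega)}$: it is $A_{s(\omega)}$ if $s(\omega)=t(\omega)$, $M_a$ if $s(\omega)\ne t(\omega)$ and $a$ is an arrow from $s(\omega)$ to $t(\omega)$, and $0$ otherwise. A trajectory of duration $n$ over $\omega=a_m\cdots a_1$ is a sequence $\tau=t(a_m)^{p_{m+1}},a_m,s(a_m)^{p_m},\dots,s(a_2)^{p_2},a_1,s(a_1)^{p_1}$ with integers $p_i\ge0$ (waiting times) and $n=m+\sum_ip_i$; $x^p$ means $x$ repeated $p$ times. $T_n(\omega)$ is the set of these. Put $\tau_\Delta=A_{t(a_m)}^{\otimes p_{m+1}}\otimes M_{a_m}\otimes A_{s(a_m)}^{\otimes p_m}\otimes\cdots\otimes M_{a_1}\otimes A_{s(a_1)}^{\otimes p_1}$. $\tau_0^+$ is the set of trajectories of duration $n+1$ obtained from $\tau\in T_n(\omega)$ by increasing one waiting time by one. **Cohomology along a path.** For $\omega\in Q_m$ and $n\ge m$, $\mathsf{H}^n_\omega(\Delta)$ is the degree $n$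 cohomology of the complex $(\mathsf K^\bullet_\omega,\mathsf d)$ with $\mathsf K_\omega^n=\bigoplus_{\tau\in T_n(\omega)}\mathsf{Hom}_k(\tau_\Delta,\Delta_\omega)$ (zero for $n<m$) and $\mathsf d f_\tau=\sum_{\sigma\in\tau_0^+}(df_\tau)_\sigma$, where $(df_\tau)_\sigma$ is the restriction to $\sigma_\Delta$ of the Hochschild coboundary $x_1f_\tau(x_2\otimes\cdots\otimes x_{n+1})+\sum_{i=1}^n(-1)^if_\tau(x_1\otimes\cdots\otimes x_ix_{i+1}\otimes\cdots\otimes x_{n+1})+(-1)^{n+1}f_\tau(x_1\otimes\cdots\otimes x_n)x_{n+1}$ (products in $\Lambda_\Delta$; $f_\tau$ is extended by zero to $\tau'_\Delta$ for all trajectories $\tau'\neq\tau$). *)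

(* Defs.v *)
From HB Require Import structures.
From mathcomp Require Import all_boot all_order all_algebra.
From mathcomp Require Import boolp functions.
From mathcomp Require Import freeg.

Set Implicit Arguments.
Unset Strict Implicit.
Unset Printing Implicit Defensive.

Import GRing.Theory.
Local Open Scope ring_scope.
Local Open Scope quotient_scope.

(** * Subspaces, quotients and subquotients of vector spaces *)

Section Subspaces.
Variables (k : fieldType) (V : lmodType k).

Record submod := Submod {
  sm_pred :> V -> Prop;
  sm_0 : sm_pred 0;
  sm_lin : forall (c : k) u v, sm_pred u -> sm_pred v -> sm_pred (c *: u + v) }.

Definition in_submod (U : submod) : {pred V} := fun v => `[< U v >].

Lemma in_submodP (U : submod) v : reflect (U v) (v \in in_submod U).
Proof. exact: asboolP. Qed.

Lemma in_submod_closed (U : submod) : submod_closed (in_submod U).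
Proof.
split; first by apply/in_submodP; exact: sm_0.
by move=> c u v /in_submodP Uu /in_submodP Uv; apply/in_submodP; exact: sm_lin.
Qed.

HB.instance Definition _ (U : submod) :=
  GRing.isSubmodClosed.Build k V (in_submod U)
    (GRing.submod_closed_semi (in_submod_closed U)).

Definition spanned_pred (S : V -> Prop) (v : V) : Prop :=
  forall U : submod, (forall u, S u -> U u) -> U v.

Lemma spanned_0 S : spanned_pred S 0.
Proof. by move=> U _; exact: sm_0. Qed.

Lemma spanned_lin S (c : k) u v :
  spanned_pred S u -> spanned_pred S v -> spanned_pred S (c *: u + v).
Proof. by move=> Su Sv U SU; apply: sm_lin; [exact: Su | exact: Sv]. Qed.

Definition spanned S : submod := Submod (@spanned_0 S) (@spanned_lin S).

(* The subspace U as a vector space. *)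
Record subspace (U : submod) :=
  Subspace { subspace_val : V; _ : subspace_val \in in_submod U }.

HB.instance Definition _ U := [isSub for @subspace_val U].
HB.instance Definition _ U := [Choice of subspace U by <:].
HB.instance Definition _ U :=
  [SubChoice_isSubLmodule of subspace U by <:].

(* The quotient V / U. *)
Definition quo (U : submod) : Type := @Quotient.quot V (in_submod U).

HB.instance Definition _ U := GRing.Zmodule.on (quo U).
HB.instance Definition _ U := Quotient.on (quo U).

Definition quo_proj U (v : V) : quo U := \pi_(quo U) v.

Lemma quo_projP U u v : reflect (quo_proj U u = quo_proj U v) (u - v \in in_submod U).
Proof. by rewrite /quo_proj Quotient.idealrBE; apply: eqP. Qed.

Lemma quo_projD U u v : quo_proj U (u + v) = quo_proj U u + quo_proj U v.
Proof. exact: raddfD. Qed.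

Lemma quo_proj_surj U (q : quo U) : exists v, q = quo_proj U v.
Proof. by exists (repr q); rewrite /quo_proj reprK. Qed.

Definition quo_scale U (c : k) (q : quo U) : quo U := quo_proj U (c *: repr q).

Lemma quo_projZ U c v : quo_scale c (quo_proj U v) = quo_proj U (c *: v).
Proof.
apply/quo_projP; rewrite -scalerBr; apply: rpredZ.
by apply/quo_projP; rewrite /quo_proj reprK.
Qed.

Fact quo_scalerA U a b (q : quo U) :
  quo_scale a (quo_scale b q) = quo_scale (a * b) q.
Proof. by case: (quo_proj_surj q) => v ->; rewrite !quo_projZ scalerA. Qed.

Fact quo_scale1r U : left_id 1 (@quo_scale U).
Proof. by move=> q; case: (quo_proj_surj q) => v ->; rewrite quo_projZ scale1r. Qed.

Fact quo_scalerDr U : right_distributive (@quo_scale U) +%R.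
Proof.
move=> c q r; case: (quo_proj_surj q) => u ->; case: (quo_proj_surj r) => v ->.
by rewrite -quo_projD !quo_projZ scalerDr quo_projD.
Qed.

Fact quo_scalerDl U q : {morph (@quo_scale U)^~ q : a b / a + b}.
Proof.
move=> a b; case: (quo_proj_surj q) => u ->.
by rewrite !quo_projZ scalerDl quo_projD.
Qed.

HB.instance Definition _ U := GRing.Zmodule_isLmodule.Build k (quo U)
  (@quo_scalerA U) (@quo_scale1r U) (@quo_scalerDr U) (@quo_scalerDl U).

Fact quo_proj_is_linear U : linear (@quo_proj U).
Proof. by move=> c u v; rewrite quo_projD -quo_projZ. Qed.

HB.instance Definition _ U :=
  GRing.isLinear.Build k V (quo U) _ (@quo_proj U) (@quo_proj_is_linear U).

End Subspaces.

Section Subquotient.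
Variables (k : fieldType) (V : lmodType k) (Z B : submod V).

Fact restrict_0 : B (val (0 : subspace Z)).
Proof. exact: sm_0. Qed.

Fact restrict_lin (c : k) (u v : subspace Z) :
  B (val u) -> B (val v) -> B (val (c *: u + v)).
Proof. by move=> Bu Bv; apply: sm_lin. Qed.

(* Z / (B :&: Z): the cohomology when Z and B are the spaces of cocycles
   and coboundaries. *)
Definition subquo : lmodType k := quo (@Submod k (subspace Z) (fun z => B (val z)) restrict_0 restrict_lin).

End Subquotient.

Section LinearFacts.
Variables (k : fieldType) (V W : lmodType k) (f : V -> W).
Hypothesis flin : linear f.

Lemma lin_add u v : f (u + v) = f u + f v.
Proof. by have := flin 1 u v; rewrite !scale1r. Qed.

Lemma lin_0 : f 0 = 0.
Proof. by apply: (addIr (f 0)); rewrite -lin_add !add0r. Qed.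

Lemma lin_scale c v : f (c *: v) = c *: f v.
Proof. by rewrite -[c *: v]addr0 flin lin_0 addr0. Qed.

Lemma lin_sub u v : f (u - v) = f u - f v.
Proof. by rewrite -scaleN1r lin_add lin_scale scaleN1r. Qed.

End LinearFacts.

(** * Bimodules and their tensor product *)

Section Bimodules.
Variable k : fieldType.

(* A C-A-bimodule, on which k acts centrally: a (C (x)_k A^op)-module. *)
Record bimod (C A : algType k) := Bimod {
  bm_sort :> lmodType k;
  lact : C -> bm_sort -> bm_sort;
  ract : bm_sort -> A -> bm_sort;
  lact_linl : forall m, linear (fun c => lact c m);
  lact_linr : forall c, linear (lact c);
  ract_linl : forall a, linear (fun m => ract m a);
  ract_linr : forall m, linear (ract m);
  lact1 : forall m, lact 1 m = m;
  ract1 : forall m, ract m 1 = m;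
  lactM : forall c d m, lact (c * d) m = lact c (lact d m);
  ractM : forall m a b, ract m (a * b) = ract (ract m a) b;
  lractA : forall c m a, ract (lact c m) a = lact c (ract m a) }.

Definition is_bimod_hom C A (M N : bimod C A) (f : M -> N) : Prop :=
  [/\ linear f, forall c m, f (lact c m) = lact c (f m)
    & forall m a, f (ract m a) = ract (f m) a].

Record bimod_hom C A (M N : bimod C A) := BimodHom {
  bh_fun :> M -> N;
  bh_homP : is_bimod_hom bh_fun }.

Fact id_is_hom C A (M : bimod C A) : is_bimod_hom (@id M).
Proof. by []. Qed.
Definition bh_id C A (M : bimod C A) : bimod_hom M M := BimodHom (id_is_hom M).

Section Regular.
Variable A : algType k.
Fact reg_linl (m : A) : linear (fun c : A => c * m).
Proof. by move=> c u v; rewrite mulrDl scalerAl. Qed.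
Fact reg_linr (m : A) : linear (fun c : A => m * c).
Proof. by move=> c u v; rewrite mulrDr scalerAr. Qed.

Definition regular_bimod : bimod A A :=
  @Bimod A A A *%R *%R reg_linl reg_linr reg_linl reg_linr
    (@mul1r A) (@mulr1 A) (fun c d m => esym (mulrA c d m))
    (@mulrA A) (fun c m a => esym (mulrA c m a)).
End Regular.

Definition zero_bimod (C A : algType k) : bimod C A.
Proof.
by apply: (@Bimod C A 'rV[k]_0 (fun _ m => m) (fun m _ => m)) => //;
  move=> ? ? ? ?; rewrite !thinmx0 ?scaler0 ?addr0.
Defined.

(* The right A-module underlying a C-A-bimodule; right A-modules are
   k-A-bimodules. *)
Definition right_mod (C A : algType k) (M : bimod C A) : bimod (k^o : algType k) A.
Proof.
apply: (@Bimod k^o A M (fun c m => c *: m) (fun m a => ract m a)).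
- by move=> m c u v; rewrite scalerDl scalerA.
- by move=> c d u v; rewrite scalerDr !scalerA mulrC.
- exact: ract_linl.
- exact: ract_linr.
- by move=> m; rewrite scale1r.
- exact: ract1.
- by move=> c d m; rewrite scalerA.
- exact: ractM.
- by move=> c m a; rewrite (lin_scale (ract_linl a)).
Defined.

End Bimodules.

Section Tensor.
Variables (k : fieldType) (C B A : algType k).
Variables (M : bimod C B) (N : bimod B A).

Let F : lmodType k := {freeg (M * N)%type / k}.

Definition fpure (m : M) (n : N) : F := << (m, n) >>.

Inductive tensor_rel : F -> Prop :=
| TensorLinl c m m' n :
    tensor_rel (fpure (c *: m + m') n - (c *: fpure m n + fpure m' n))
| TensorLinr c m n n' :
    tensor_rel (fpure m (c *: n + n') - (c *: fpure m n + fpure m n'))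
| TensorBal m b n :
    tensor_rel (fpure (ract m b) n - fpure m (lact b n)).

Definition tensor_sort : lmodType k := quo (spanned tensor_rel).

Definition pure (m : M) (n : N) : tensor_sort :=
  quo_proj (spanned tensor_rel) (fpure m n).

Definition balanced (V : lmodType k) (f : M -> N -> V) : Prop :=
  [/\ forall n, linear (fun m => f m n), forall m, linear (f m)
    & forall m b n, f (ract m b) n = f m (lact b n)].

Definition tensor_lift (V : lmodType k) (f : M -> N -> V) (t : tensor_sort) : V :=
  fglift (fun mn => f mn.1 mn.2) (repr t).

Lemma freeg_lift_linear (V : lmodType k) (f : M * N -> V) :
  linear (fglift f : F -> V).
Proof.
have addf := @lift_is_additive k (M * N)%type V f.
have f0 : fglift f (0 : F) = 0 by have := addf 0 0; rewrite !subrr.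
have fN (v : F) : fglift f (- v) = - fglift f v.
  by rewrite -[- v]add0r addf f0 add0r.
have addF (u v : F) : fglift f (u + v) = fglift f u + fglift f v.
  by rewrite -[v in LHS]opprK addf fN opprK.
move=> c u v; rewrite addF; congr (_ + _).
elim/freeg_ind_dom0: u => [|a x D _ _ IH].
  by rewrite scaler0 f0 scaler0.
rewrite scalerDr !addF IH scalerDr; congr (_ + _).
have -> : c *: (<< a *g x >> : F) = << (c * a) *g x >>.
  by apply/eqP/freeg_eqP=> y; rewrite coeffZ !coeffU mulrA.
by rewrite !liftU scalerA.
Qed.

Section Lift.
Variables (V : lmodType k) (f : M -> N -> V).
Hypothesis bf : balanced f.

Lemma tensor_lift_proj (u : F) :
  tensor_lift f (quo_proj (spanned tensor_rel) u)
  = fglift (fun mn => f mn.1 mn.2) u.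
Proof.
set g := fun mn => _; have glin := freeg_lift_linear g.
pose K0 : F -> Prop := fun u => fglift g u = 0.
have K00 : K0 0 by exact: lin_0 glin.
have K0l (c : k) v w : K0 v -> K0 w -> K0 (c *: v + w).
  by rewrite /K0 => v0 w0; rewrite glin v0 w0 scaler0 addr0.
suff K0P v : spanned tensor_rel v -> K0 v.
  rewrite /tensor_lift; apply/eqP; rewrite -subr_eq0 -(lin_sub glin).
  apply/eqP/K0P/in_submodP/quo_projP; exact: reprK.
move/(_ (Submod K00 K0l)); apply => {}v.
have [fl fr fb] := bf.
have gp m n : fglift g (fpure m n) = f m n by rewrite liftU scale1r.
case=> *; rewrite /= /K0 (lin_sub glin) ?glin !gp ?fl ?fr ?fb subrr //.
Qed.

Lemma tensor_lift_pure m n : tensor_lift f (pure m n) = f m n.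
Proof. by rewrite /pure tensor_lift_proj liftU scale1r. Qed.

Lemma tensor_lift_linear : linear (tensor_lift f).
Proof.
move=> c s t; case: (quo_proj_surj s) => u ->; case: (quo_proj_surj t) => v ->.
by rewrite -linearP !tensor_lift_proj freeg_lift_linear.
Qed.

End Lift.

Lemma pure_linl n : linear (fun m => pure m n).
Proof.
move=> c m m'; rewrite /pure -linearP; apply/quo_projP/in_submodP => U; apply.
exact: TensorLinl.
Qed.

Lemma pure_linr m : linear (pure m).
Proof.
move=> c n n'; rewrite /pure -linearP; apply/quo_projP/in_submodP => U; apply.
exact: TensorLinr.
Qed.

Lemma pure_bal m b n : pure (ract m b) n = pure m (lact b n).
Proof.
rewrite /pure; apply/quo_projP/in_submodP => U; apply; exact: TensorBal.
Qed.

Lemma pure_balanced : balanced pure.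
Proof. by split; [exact: pure_linl | exact: pure_linr | exact: pure_bal]. Qed.

Lemma tensor_ind (P : tensor_sort -> Prop) :
  P 0 -> (forall (c : k) m n t, P t -> P (c *: pure m n + t)) -> forall t, P t.
Proof.
move=> P0 PS t; case: (quo_proj_surj t) => u ->.
elim/freeg_ind_dom0: u => [|a [m n] D _ _ IH]; first by rewrite linear0.
rewrite linearD.
have -> : (<< a *g (m, n) >> : F) = a *: fpure m n.
  by apply/eqP/freeg_eqP=> y; rewrite coeffZ !coeffU mul1r.
by rewrite linearZ; exact: PS.
Qed.

Lemma tensor_ext (V : lmodType k) (f g : tensor_sort -> V) :
  linear f -> linear g -> (forall m n, f (pure m n) = g (pure m n)) -> f =1 g.
Proof.
move=> fl gl fg; elim/tensor_ind => [|c m n t IH].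
  by rewrite (lin_0 fl) (lin_0 gl).
by rewrite fl gl fg IH.
Qed.

Definition tensor_lact (c : C) : tensor_sort -> tensor_sort :=
  tensor_lift (fun m n => pure (lact c m) n).
Definition tensor_ract (t : tensor_sort) (a : A) : tensor_sort :=
  tensor_lift (fun m n => pure m (ract n a)) t.

Fact lact_balanced c : balanced (fun m n => pure (lact c m) n).
Proof.
split=> [n d u v|m|m b n]; first by rewrite lact_linr pure_linl.
  exact: pure_linr.
by rewrite -lractA pure_bal.
Qed.

Fact ract_balanced a : balanced (fun m n => pure m (ract n a)).
Proof.
split=> [n|m d u v|m b n]; first exact: pure_linl.
  by rewrite ract_linl pure_linr.
by rewrite pure_bal lractA.
Qed.

Lemma tensor_lact_pure c m n : tensor_lact c (pure m n) = pure (lact c m) n.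
Proof. exact/tensor_lift_pure/lact_balanced. Qed.

Lemma tensor_ract_pure m n a : tensor_ract (pure m n) a = pure m (ract n a).
Proof. exact/(tensor_lift_pure (ract_balanced a)). Qed.

Lemma tensor_lact_linr c : linear (tensor_lact c).
Proof. exact/tensor_lift_linear/lact_balanced. Qed.

Lemma tensor_ract_linl a : linear (fun t => tensor_ract t a).
Proof. exact: (tensor_lift_linear (ract_balanced a)). Qed.

Lemma tensor_lact_linl t : linear (fun c => tensor_lact c t).
Proof.
move=> a c d; elim/tensor_ind: t => [|e m n t IH].
  by rewrite !(lin_0 (tensor_lact_linr _)) scaler0 addr0.
rewrite !tensor_lact_linr !tensor_lact_pure IH lact_linl pure_linl.
by rewrite !scalerDr !scalerA [e * a]mulrC addrACA.
Qed.

Lemma tensor_ract_linr t : linear (tensor_ract t).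
Proof.
move=> a c d; elim/tensor_ind: t => [|e m n t IH].
  by rewrite !(lin_0 (tensor_ract_linl _)) scaler0 addr0.
rewrite !tensor_ract_linl !tensor_ract_pure IH ract_linr pure_linr.
by rewrite !scalerDr !scalerA [e * a]mulrC addrACA.
Qed.

Fact tensor_lact1 t : tensor_lact 1 t = t.
Proof.
elim/tensor_ind: t => [|e m n t IH]; first exact: lin_0 (tensor_lact_linr _).
by rewrite tensor_lact_linr tensor_lact_pure lact1 IH.
Qed.

Fact tensor_ract1 t : tensor_ract t 1 = t.
Proof.
elim/tensor_ind: t => [|e m n t IH]; first exact: lin_0 (tensor_ract_linl _).
by rewrite tensor_ract_linl tensor_ract_pure ract1 IH.
Qed.

Fact tensor_lactM c d t : tensor_lact (c * d) t = tensor_lact c (tensor_lact d t).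
Proof.
elim/tensor_ind: t => [|e m n t IH]; first by rewrite !(lin_0 (tensor_lact_linr _)).
by rewrite !tensor_lact_linr !tensor_lact_pure lactM IH.
Qed.

Fact tensor_ractM t a b : tensor_ract t (a * b) = tensor_ract (tensor_ract t a) b.
Proof.
elim/tensor_ind: t => [|e m n t IH]; first by rewrite !(lin_0 (tensor_ract_linl _)).
by rewrite !tensor_ract_linl !tensor_ract_pure ractM IH.
Qed.

Fact tensor_lractA c t a :
  tensor_ract (tensor_lact c t) a = tensor_lact c (tensor_ract t a).
Proof.
elim/tensor_ind: t => [|e m n t IH].
  by rewrite !(lin_0 (tensor_lact_linr _), lin_0 (tensor_ract_linl _)).
rewrite !(tensor_lact_linr, tensor_ract_linl).
by rewrite !(tensor_lact_pure, tensor_ract_pure) IH.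
Qed.

(* M (x)_B N as a C-A-bimodule. *)
Definition tensor : bimod C A :=
  Bimod tensor_lact_linl tensor_lact_linr tensor_ract_linl tensor_ract_linr
    tensor_lact1 tensor_ract1 tensor_lactM tensor_ractM tensor_lractA.

End Tensor.

Section TensorMap.
Variables (k : fieldType) (C B A : algType k).

Definition tensor_map (M M' : bimod C B) (N : bimod B A) (f : bimod_hom M M')
    : tensor M N -> tensor M' N :=
  @tensor_lift k C B A M N (tensor M' N) (fun m n => pure (f m) n).

Fact map_balanced (M M' : bimod C B) (N : bimod B A) (f : bimod_hom M M') :
  @balanced k C B A M N (tensor M' N) (fun m n => pure (f m) n).
Proof.
have [fl _ fr] := bh_homP f.
split=> [n c u v|m|m b n]; first by rewrite fl pure_linl.
  exact: pure_linr.
by rewrite fr pure_bal.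
Qed.

Lemma tensor_map_linear M M' N (f : bimod_hom M M') :
  linear (@tensor_map M M' N f).
Proof. exact/tensor_lift_linear/map_balanced. Qed.

Lemma tensor_map_pure (M M' : bimod C B) (N : bimod B A) (f : bimod_hom M M')
  m n : tensor_map f (@pure k C B A M N m n) = pure (f m) n.
Proof. exact: (tensor_lift_pure (map_balanced N f)). Qed.

End TensorMap.

(** * Projective resolutions, Tor and Ext *)

Section Derived.
Variable k : fieldType.

Definition surjective (X Y : Type) (f : X -> Y) : Prop :=
  forall y, exists x, f x = y.

Definition projective (C A : algType k) (P : bimod C A) : Prop :=
  forall (X Y : bimod C A) (g : bimod_hom X Y) (f : bimod_hom P Y),
    surjective g -> exists h : bimod_hom P X, forall p, g (h p) = f p.

Record projres (C A : algType k) (M : bimod C A) := ProjRes {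
  pr_obj :> nat -> bimod C A;
  pr_proj : forall n, projective (pr_obj n);
  pr_d : forall n, bimod_hom (pr_obj n.+1) (pr_obj n);
  pr_aug : bimod_hom (pr_obj 0%N) M;
  pr_aug_surj : surjective pr_aug;
  pr_exact0 : forall p, pr_aug p = 0 <-> exists q, pr_d 0%N q = p;
  pr_exactS : forall n p, pr_d n p = 0 <-> exists q, pr_d n.+1 q = p }.

Section Tor.
(* Right B-modules are k-B-bimodules, see right_mod. *)
Variables (B A : algType k) (M : bimod (k^o : algType k) B) (P : projres M).
Variable N : bimod B A.

Definition tor_cycle n : tensor (P n) N -> Prop :=
  match n return tensor (P n) N -> Prop with
  | 0 => fun _ => True
  | n'.+1 => fun t => tensor_map (pr_d P n') t = 0
  end.

Definition tor_boundary n (t : tensor (P n) N) : Prop :=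
  exists u : tensor (P n.+1) N, tensor_map (pr_d P n) u = t.

Fact tor_cycle_0 n : tor_cycle (0 : tensor (P n) N).
Proof. by case: n => //= n; exact: lin_0 (tensor_map_linear _). Qed.

Fact tor_cycle_lin n (c : k) (u v : tensor (P n) N) :
  tor_cycle u -> tor_cycle v -> tor_cycle (c *: u + v).
Proof.
case: n u v => //= n u v u0 v0.
by rewrite tensor_map_linear u0 v0 scaler0 addr0.
Qed.

Fact tor_boundary_0 n : tor_boundary (0 : tensor (P n) N).
Proof. by exists 0; exact: lin_0 (tensor_map_linear _). Qed.

Fact tor_boundary_lin n (c : k) (u v : tensor (P n) N) :
  tor_boundary u -> tor_boundary v -> tor_boundary (c *: u + v).
Proof.
move=> [u' <-] [v' <-]; exists (c *: u' + v'); exact: tensor_map_linear.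
Qed.

(* Tor_n^B(M, N), computed from the projective resolution P of M. *)
Definition Tor (n : nat) : lmodType k :=
  subquo (Submod (@tor_cycle_0 n) (@tor_cycle_lin n))
         (Submod (@tor_boundary_0 n) (@tor_boundary_lin n)).

End Tor.

Section Ext.
Variables (C A : algType k) (M : bimod C A) (P : projres M) (N : bimod C A).

Definition ext_cocycle r (f : P r -> N) : Prop :=
  is_bimod_hom f /\ forall p, f (pr_d P r p) = 0.

Definition ext_coboundary r : (P r -> N) -> Prop :=
  match r return (P r -> N) -> Prop with
  | 0 => fun f => f = 0
  | r'.+1 => fun f => exists2 g : P r' -> N,
      is_bimod_hom g & f = fun p => g (pr_d P r' p)
  end.

Fact is_bimod_hom_0 (X : bimod C A) : is_bimod_hom (0 : X -> N).
Proof.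
split=> [c u v|c m|m a]; first by rewrite scaler0 addr0.
  by rewrite (lin_0 (lact_linr _)).
by rewrite (lin_0 (ract_linl _)).
Qed.

Fact is_bimod_hom_lin (X : bimod C A) (c : k) (f g : X -> N) :
  is_bimod_hom f -> is_bimod_hom g -> is_bimod_hom (c *: f + g).
Proof.
move=> [fl fL fR] [gl gL gR]; split=> [d u v|d m|m a].
- rewrite !fctE fl gl !scalerDr !scalerA [c * d]mulrC.
  by rewrite addrACA.
- by rewrite !fctE fL gL lact_linr.
- by rewrite !fctE fR gR ract_linl.
Qed.

Fact ext_cocycle_0 r : @ext_cocycle r 0.
Proof. by split; first exact: is_bimod_hom_0. Qed.

Fact ext_cocycle_lin r (c : k) (f g : P r -> N) :
  ext_cocycle f -> ext_cocycle g -> ext_cocycle (c *: f + g).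
Proof.
move=> [fh f0] [gh g0]; split; first exact: is_bimod_hom_lin.
by move=> p; rewrite !fctE f0 g0 scaler0 addr0.
Qed.

Fact ext_coboundary_0 r : @ext_coboundary r 0.
Proof. by case: r => //= r; exists 0; first exact: is_bimod_hom_0. Qed.

Fact ext_coboundary_lin r (c : k) (f g : P r -> N) :
  ext_coboundary f -> ext_coboundary g -> ext_coboundary (c *: f + g).
Proof.
case: r f g => [|r] f g /=; first by move=> -> ->; rewrite scaler0 addr0.
move=> [f' f'h ->] [g' g'h ->]; exists (c *: f' + g') => //.
exact: is_bimod_hom_lin.
Qed.

(* Ext^r_{C-A}(M, N), computed from the projective resolution P of M. *)
Definition Ext (r : nat) : lmodType k :=
  subquo (Submod (@ext_cocycle_0 r) (@ext_cocycle_lin r))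
         (Submod (@ext_coboundary_0 r) (@ext_coboundary_lin r)).

End Ext.

End Derived.

(** * Quivers and Q-sets *)

(* A finite quiver: [arr x y] is the set of arrows with source x and target y,
   so that Q_1 is the disjoint union of the sets [arr x y]. *)
Record quiver := Quiver {
  vertex :> finType;
  arr : vertex -> vertex -> finType }.

Definition simply_laced (Q : quiver) : Prop :=
  (forall (x : Q), arr x x -> False) /\
  (forall (x y : Q) (a b : arr x y), a = b).

Section QSets.
Variables (k : fieldType) (Q : quiver).

Record qdata := QData {
  alg : Q -> algType k;
  bim : forall x y : Q, arr x y -> bimod (alg y) (alg x);
  bim_neq0 : forall (x y : Q) (a : arr x y), exists m : bim a, m <> 0 }.

(* The component _yM_x = e_y Lambda e_x: it is A_x if x = y, the bimodule of
   the arrow from x to y if there is one, and 0 otherwise. *)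
Definition qcomp (D : qdata) (y x : Q) : bimod (alg D y) (alg D x) :=
  match x =P y with
  | ReflectT e =>
      match e in _ = y' return bimod (alg D y') (alg D x) with
      | erefl => regular_bimod (alg D x)
      end
  | ReflectF _ =>
      match pick (fun _ : arr x y => true) with
      | Some a => bim D a
      | None => zero_bimod (alg D y) (alg D x)
      end
  end.

Lemma qcomp_diag (D : qdata) (x : Q) : qcomp D x x = regular_bimod (alg D x).
Proof. by rewrite /qcomp; case: eqP => // e; rewrite eq_axiomK. Qed.

Lemma qcomp_arr (D : qdata) (x y : Q) (a : arr x y) :
  simply_laced Q -> qcomp D y x = bim D a.
Proof.
move=> [noloop simple]; rewrite /qcomp; case: eqP => [e|_].
  by case: (noloop x); move: a; rewrite -e.
by case: pickP => [b _|/(_ a)//]; rewrite (simple x y b a).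
Qed.

Definition of_diag (D : qdata) (x : Q) (u : qcomp D x x) : alg D x :=
  ecast M (bm_sort M) (qcomp_diag D x) u.

Section Product.
Variables (D : qdata)
  (alpha : forall z y x : Q, y <> z -> x <> y ->
     bimod_hom (tensor (qcomp D z y) (qcomp D y x)) (qcomp D z x)).

(* The product _zM_y x _yM_x -> _zM_x of Lambda: the left action of A_y if
   z = y, the right action of A_y if y = x, and alpha if x <> y <> z. *)
Definition qcomp_mul (z y x : Q) : qcomp D z y -> qcomp D y x -> qcomp D z x :=
  match y =P z with
  | ReflectT e =>
      match e in _ = z' return qcomp D z' y -> qcomp D y x -> qcomp D z' x with
      | erefl => fun u v => lact (of_diag u) v
      end
  | ReflectF nyz =>
      match x =P y with
      | ReflectT e =>
          match e in _ = y' return qcomp D z y' -> qcomp D y' x -> qcomp D z x with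
          | erefl => fun u v => ract u (of_diag v)
          end
      | ReflectF nxy => fun u v => alpha nyz nxy (pure u v)
      end
  end.

End Product.

Record qset := QSet {
  qs_data :> qdata;
  alpha : forall z y x : Q, y <> z -> x <> y ->
    bimod_hom (tensor (qcomp qs_data z y) (qcomp qs_data y x)) (qcomp qs_data z x);
  alphaA : forall (u z y x : Q)
      (h : qcomp qs_data u z) (g : qcomp qs_data z y) (f : qcomp qs_data y x),
    qcomp_mul alpha h (qcomp_mul alpha g f) = qcomp_mul alpha (qcomp_mul alpha h g) f }.

End QSets.

(** * Cohomology along a path *)

(* Paths from x to y; [pcons a_m (... (pcons a_1 (pnil x)))] is the path
   a_m ... a_1, the trivial path [pnil x] being the base case. *)
Inductive qpath (Q : quiver) : Q -> Q -> Type :=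
| pnil (x : Q) : qpath x x
| pcons (x y z : Q) (a : arr y z) (w : qpath x y) : qpath x z.

Arguments pnil {Q} x.

Section PathCohomology.
Variables (k : fieldType) (Q : quiver) (D : qdata k Q).

(* For w = a_m ... a_1, an element of [word w] is
     (s_{m+1}, m_m, (s_m, ..., (s_2, m_1, s_1)))
   where m_i is in M_{a_i} and each s_i is a list of elements of the algebra at
   a vertex of w.  The lengths p_i of the s_i are the waiting times of a
   trajectory tau over w, and the words with these lengths are exactly the
   tuples (x_1, ..., x_n) with x_1 (x) ... (x) x_n a pure tensor of tau_Delta. *)
Fixpoint word (x y : Q) (w : qpath x y) : Type :=
  match w with
  | pnil x => seq (alg D x)
  | pcons _ _ z a w' => (seq (alg D z) * bim D a * word w')%type
  end.

Fixpoint duration (x y : Q) (w : qpath x y) : word w -> nat :=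
  match w return word w -> nat with
  | pnil _ => fun s => size s
  | pcons _ _ _ a w' => fun t => (size t.1.1 + (duration t.2).+1)%N
  end.

(* Linearity in each letter: on the words of a given shape tau, these are the
   linear maps on tau_Delta. *)
Definition seq_multilinear (A V : lmodType k) (f : seq A -> V) : Prop :=
  forall s1 s2, linear (fun c => f (s1 ++ c :: s2)).

Fixpoint multilinear (V : lmodType k) (x y : Q) (w : qpath x y)
    : (word w -> V) -> Prop :=
  match w return (word w -> V) -> Prop with
  | pnil _ => fun f => seq_multilinear f
  | pcons _ _ _ a w' => fun f =>
      [/\ forall m t, seq_multilinear (fun s => f (s, m, t)),
          forall s t, linear (fun m => f (s, m, t))
        & forall s m, multilinear (fun t => f (s, m, t))]
  end.

(* The first letter x_1 of a word and the remaining word, if x_1 is in an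
   algebra; the last letter likewise. *)
Definition pop_first (x y : Q) (w : qpath x y)
    : word w -> option (alg D y * word w) :=
  match w in qpath x y return word w -> option (alg D y * word w) with
  | pnil _ => fun s => if s is c :: s' then Some (c, s') else None
  | pcons _ _ _ a w' => fun t =>
      let: (s, m, u) := t in
      if s is c :: s' then Some (c, (s', m, u)) else None
  end.

Fixpoint pop_last (x y : Q) (w : qpath x y)
    : word w -> option (word w * alg D x) :=
  match w in qpath x y return word w -> option (word w * alg D x) with
  | pnil _ => fun s =>
      if s is c :: s' then Some (belast c s', last c s') else None
  | pcons _ _ _ a w' => fun t =>
      let: (s, m, u) := t in
      omap (fun ub => ((s, m, ub.1), ub.2)) (pop_last u)
  end.

(* Replace the letters s_i, s_{i+1} (counting from 0) by their product. *)
Definition merge_at (A : algType k) (s : seq A) (i : nat) : seq A :=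
  take i s ++ (nth 0 s i * nth 0 s i.+1) :: drop i.+2 s.

(* The word x_1, ..., x_i x_{i+1}, ..., x_n (counting from 0: the letters i and
   i.+1 are multiplied).  It is None if there are no such letters, and also if
   both come from arrows: the result is then a tensor over a path other than w,
   where cochains over w are extended by zero. *)
Fixpoint contract (x y : Q) (w : qpath x y) (i : nat)
    : word w -> option (word w) :=
  match w in qpath x y return word w -> option (word w) with
  | pnil _ => fun s => if (i.+1 < size s)%N then Some (merge_at s i) else None
  | pcons _ _ _ a w' => fun t =>
      let: (s, m, u) := t in
      if (i.+1 < size s)%N then Some (merge_at s i, m, u)
      else if (i.+1 == size s)%N then Some (take i s, lact (nth 0 s i) m, u)
      else if (i == size s)%N then
        omap (fun bu => (s, ract m bu.1, bu.2)) (pop_first u)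
      else omap (fun u' => (s, m, u')) (contract (i - (size s).+1) u)
  end.

Section Complex.
Variables (x y : Q) (w : qpath x y).

(* Delta_w = e_y Lambda e_x *)
Definition coefficients : bimod (alg D y) (alg D x) := qcomp D y x.
Local Notation N := coefficients.

(* K_w^n: the direct sum over the trajectories tau of duration n of the spaces
   Hom_k(tau_Delta, Delta_w).  A family (f_tau) is encoded as one function on
   all words, which is multilinear on the words of each shape and vanishes on
   the words of duration other than n. *)
Definition cochain (n : nat) (f : word w -> N) : Prop :=
  multilinear f /\ forall t, duration t <> n -> f t = 0.

(* The Hochschild coboundary; on a word of duration n.+1,
   x_1 f(x_2, ...) + \sum_(1 <= i <= n) (-1)^i f(..., x_i x_{i+1}, ...)
     + (-1)^(n+1) f(..., x_n) x_{n+1}.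
   The first term vanishes unless x_1 is in an algebra, because otherwise
   (x_2, ...) is not a word over w, and similarly for the last term. *)
Definition coboundary (f : word w -> N) (t : word w) : N :=
  (if pop_first t is Some (c, t') then lact c (f t') else 0)
  + \sum_(i < (duration t).-1)
      (-1) ^+ i.+1 *: (if contract i t is Some t' then f t' else 0)
  + (-1) ^+ duration t *:
      (if pop_last t is Some (t', a) then ract (f t') a else 0).

Definition cocycle (n : nat) (f : word w -> N) : Prop :=
  cochain n f /\ coboundary f = 0.

Definition is_coboundary (n : nat) (f : word w -> N) : Prop :=
  match n with
  | 0 => f = 0
  | n'.+1 => exists2 g, cochain n' g & f = coboundary g
  end.

Fact multilinear_0 (V : lmodType k) (x' y' : Q) (v : qpath x' y') :
  multilinear (0 : word v -> V).
Proof.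
have lin0 (U : lmodType k) : linear (fun _ : U => 0 : V).
  by move=> c ? ? /=; rewrite scaler0 addr0.
elim: v => [z|z1 z2 z3 a v IH] /=; first by move=> s1 s2; exact: lin0.
split=> [m t s1 s2|s t|s m]; [exact: lin0 | exact: lin0 | exact: IH].
Qed.

Fact linear_lin (U V : lmodType k) (c : k) (f g : U -> V) :
  linear f -> linear g -> linear (fun u => c *: f u + g u).
Proof.
by move=> fl gl d u v; rewrite fl gl !scalerDr !scalerA [c * d]mulrC addrACA.
Qed.

Fact multilinear_lin (V : lmodType k) (x' y' : Q) (v : qpath x' y') (c : k)
    (f g : word v -> V) :
  multilinear f -> multilinear g -> multilinear (fun t => c *: f t + g t).
Proof.
elim: v f g => [z|z1 z2 z3 a v IH] f g /=.
  by move=> fl gl s1 s2; apply: linear_lin; [exact: fl | exact: gl].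
move=> [f1 f2 f3] [g1 g2 g3]; split.
- by move=> m t s1 s2; apply: linear_lin; [exact: f1 | exact: g1].
- by move=> s t; apply: linear_lin.
- by move=> s m; apply: IH.
Qed.

Fact cochain_0 n : cochain n (0 : word w -> N).
Proof. by split; first exact: multilinear_0. Qed.

Fact cochain_lin n (c : k) (f g : word w -> N) :
  cochain n f -> cochain n g -> cochain n (c *: f + g).
Proof.
move=> [fl f0] [gl g0]; split; first exact: multilinear_lin.
by move=> t nt; rewrite !fctE f0 // g0 // scaler0 addr0.
Qed.

Lemma coboundary_linear : linear coboundary.
Proof.
move=> c f g; apply/funext => t; rewrite /coboundary !fctE.
rewrite !scalerDr [in RHS]addrACA; congr (_ + _); last first.
  case: (pop_last t) => [[t' a]|]; last by rewrite !scaler0 addr0.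
  by rewrite ract_linl scalerDr !scalerA mulrC.
rewrite addrACA; congr (_ + _).
  case: (pop_first t) => [[d t']|]; last by rewrite scaler0 addr0.
  by rewrite lact_linr.
rewrite scaler_sumr -big_split; apply: eq_bigr => i _ /=.
case: (contract i t) => [t'|]; last by rewrite !scaler0 addr0.
by rewrite scalerDr !scalerA mulrC.
Qed.

Fact cocycle_0 n : cocycle n 0.
Proof.
by split; [exact: cochain_0 | exact: lin_0 coboundary_linear].
Qed.

Fact cocycle_lin n (c : k) (f g : word w -> N) :
  cocycle n f -> cocycle n g -> cocycle n (c *: f + g).
Proof.
move=> [fc f0] [gc g0]; split; first exact: cochain_lin.
by rewrite coboundary_linear f0 g0 scaler0 addr0.
Qed.

Fact is_coboundary_0 n : is_coboundary n 0.
Proof.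
case: n => //= n; exists 0; first exact: cochain_0.
by rewrite (lin_0 coboundary_linear).
Qed.

Fact is_coboundary_lin n (c : k) (f g : word w -> N) :
  is_coboundary n f -> is_coboundary n g -> is_coboundary n (c *: f + g).
Proof.
case: n => [|n] /=; first by move=> -> ->; rewrite scaler0 addr0.
move=> [f' f'c ->] [g' g'c ->]; exists (c *: f' + g'); first exact: cochain_lin.
by rewrite coboundary_linear.
Qed.

Definition path_cohomology (n : nat) : lmodType k :=
  subquo (Submod (cocycle_0 n) (@cocycle_lin n))
         (Submod (is_coboundary_0 n) (@is_coboundary_lin n)).

End Complex.

End PathCohomology.

(* Main.v *)
Require Import Defs.
From HB Require Import structures.
From mathcomp Require Import all_boot all_order all_algebra.
From mathcomp Require Import boolp classical_sets functions freeg.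

Set Implicit Arguments.
Unset Strict Implicit.
Unset Printing Implicit Defensive.

Import GRing.Theory.
Local Open Scope ring_scope.

(** Write [M2] and [M1] for the bimodules of the arrows and [N] for the
    coefficients.  A word over the path is made of a word in [C], an element of
    [M2], a word in [B], an element of [M1] and a word in [A].  Grouping the two
    outer blocks, the complex along the path, shifted by two, is the Hochschild
    complex of the pair of algebras [C], [A] with coefficients in the complex of the
    multilinear functions of [(m2, bs, m1)], that is, in the [N]-dual of the bar
    complex of terms [M2 (x) B^q (x) M1].  The bar complex computes
    [Tor^B(M2, M1)]; when this vanishes in positive degrees, it is a resolution of
    [M2 (x)_B M1], so the coefficients may be replaced by the linear maps from
    [M2 (x)_B M1] to [N] ([bar_hyper_iso]).  What remains is the two-sided Hochschild
    complex of the linear maps from a bimodule to [N], which computes [Ext] of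
    bimodules ([hochschild_ext_iso]).

    Both replacements are comparisons of an edge of a double complex with its total
    complex ([row_total_iso]): one direction is the two-sided Hochschild coboundary,
    the other a resolution in the coefficients.  In the direction of the resolution
    exactness is preserved because exact sequences of vector spaces split
    ([pseudo_inverse]).  For [hochschild_ext_iso] the resolution [P] consists of
    projective bimodules, and the other direction is exact too: the action maps
    [C (x) P -> P] and [P (x) A -> P] have equivariant sections, which contract
    the Hochschild complex ([cochains_exact]).  The other edge is then
    [Hom(P, N)], the complex defining [Ext] ([column_ext_iso]).

    That the bar complex is exact ([bar_exact]) is deduced from
    [hochschild_ext_iso] again, for the algebras [k] and [B], the right module [M2]
    and the module [Hom_k(M1, V)]: its [Ext] is the [V]-dual of [Tor]
    ([ext_hom_mod_eq0]), and the words in [k] can be removed ([left_reduce]).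

    All these complexes consist of functions on words.  Their coboundaries are
    Hochschild coboundaries in one word at a time, given by a recursion on the word
    ([inner], [hoch]); they have square zero and commute for different words, by
    induction and naturality.  The sum of signed contractions that defines the
    coboundary along a path splits into three of them ([coboundary_blocks]). *)

(** * Linear algebra over a field *)

Section SubmodClosure.
Variables (k : fieldType) (V : lmodType k) (U : submod V).

Lemma submodZ (c : k) u : U u -> U (c *: u).
Proof. by move=> Uu; rewrite -[_ *: _]addr0; apply: sm_lin => //; exact: sm_0. Qed.

Lemma submodD u v : U u -> U v -> U (u + v).
Proof. by move=> Uu Uv; rewrite -[u]scale1r; exact: sm_lin. Qed.

Lemma submodN u : U u -> U (- u).
Proof. by move=> Uu; rewrite -scaleN1r; exact: submodZ. Qed.

Lemma submodB u v : U u -> U v -> U (u - v).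
Proof. by move=> Uu Uv; apply: submodD => //; exact: submodN. Qed.

Lemma submod_sum (I : Type) (r : seq I) (P : pred I) (F : I -> V) :
  (forall i, P i -> U (F i)) -> U (\sum_(i <- r | P i) F i).
Proof.
by move=> UF; elim/big_ind: _ => //; [exact: sm_0 | exact: submodD].
Qed.

End SubmodClosure.

Lemma lin_opp (k : fieldType) (V W : lmodType k) (f : V -> W) v :
  linear f -> f (- v) = - f v.
Proof. by move=> fl; rewrite -sub0r (lin_sub fl) (lin_0 fl) sub0r. Qed.

Section PseudoInverse.
Variable k : fieldType.

Lemma submod_complement (V : lmodType k) (K : submod V) :
  exists C : submod V, (forall x, K x -> C x -> x = 0) /\
    forall x, exists a b, [/\ K a, C b & x = a + b].
Proof.
(* The union of an empty chain is empty, so 0 is only adjoined to a maximal [A]. *)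
pose P (W : set V) := (forall (c : k) u v, W u -> W v -> W (c *: u + v)) /\
  forall x, K x -> W x -> x = 0.
have [|A [[Alin AK] Amax]] := @Zorn_bigcup V P.
  move=> F FP Ftot; split.
    move=> c u v [X FX Xu] [Y FY Yv].
    have [XY|YX] := Ftot _ _ FX FY.
      by exists Y => //; apply: (FP _ FY).1 => //; exact: XY.
    by exists X => //; apply: (FP _ FX).1 => //; exact: YX.
  by move=> x Kx [X FX Xx]; exact: (FP _ FX).2.
have C0 : A 0 \/ 0 = 0 :> V by right.
have Clin (c : k) u v : A u \/ u = 0 -> A v \/ v = 0 ->
    A (c *: u + v) \/ c *: u + v = 0.
  case=> [Au|->] [Av|->].
  - by left; exact: Alin.
  - have A0 : A 0 by have := Alin (-1) u u Au Au; rewrite scaleN1r addNr.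
    by left; exact: Alin.
  - by left; rewrite scaler0 add0r.
  - by right; rewrite scaler0 add0r.
pose C := @Submod k V (fun v => A v \/ v = 0) C0 Clin.
have Cmax x : ~ A x -> exists a c b, [/\ K a, a != 0, C b & a = c *: x + b].
  move=> nAx; apply: contrapT => nex.
  pose B : set V := fun v => exists c b, C b /\ v = c *: x + b.
  have AB b : A b -> B b by exists 0, b; split; [left | rewrite scale0r add0r].
  have Bx : B x by exists 1, 0; split; [right | rewrite scale1r addr0].
  apply: (Amax B); first by split=> // BA; apply: nAx; exact: BA.
  split.
    move=> c _ _ [d [b [Cb ->]]] [d' [b' [Cb' ->]]].
    exists (c * d + d'), (c *: b + b'); split; first exact: sm_lin.
    by rewrite scalerDl scalerDr scalerA addrACA.
  move=> v Kv [c [b [Cb vE]]]; apply/eqP/negP => /negP v0.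
  by apply: nex; exists v, c, b.
exists C; split; first by move=> x Kx [Ax|//]; exact: AK.
move=> x; have [Ax|/Cmax[a [c [b [Ka a0 Cb aE]]]]] := pselect (A x).
  by exists 0, x; split; [exact: sm_0 | left | rewrite add0r].
have [c0|c0] := eqVneq c 0.
  move: aE; rewrite c0 scale0r add0r => ab; move: a0; rewrite ab.
  by case: Cb => [Ab|->]; [rewrite (AK b) ?eqxx // -ab | rewrite eqxx].
exists (c^-1 *: a), (- (c^-1 *: b)); split; first exact: submodZ.
  by apply: submodN; exact: submodZ.
by rewrite -scalerBr aE addrK scalerA mulVf // scale1r.
Qed.

(** Over a field every linear map is von Neumann regular, also relatively to a
    subspace: this single fact splits every exact sequence of the proof. *)
Lemma pseudo_inverse (V W : lmodType k) (S : submod V) (d : V -> W) :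
  linear d ->
  exists s : W -> V, [/\ linear s, forall y, S (s y)
    & forall x, S x -> d (s (d x)) = d x].
Proof.
move=> dlin.
have K0 : S 0 /\ d 0 = 0 by split; [exact: sm_0 | exact: lin_0].
have Klin (c : k) u v : S u /\ d u = 0 -> S v /\ d v = 0 ->
    S (c *: u + v) /\ d (c *: u + v) = 0.
  move=> [Su u0] [Sv v0]; split; first exact: sm_lin.
  by rewrite dlin u0 v0 scaler0 addr0.
(* [s y] is the element of [S] and of a complement [C] of the kernel whose image is
   the component of [y] in the image of [S], along a complement [Q]. *)
have [C [CK CD]] := submod_complement (@Submod k V (fun x => S x /\ d x = 0) K0 Klin).
have I0 : exists2 x, S x & d x = 0 by exists 0; [exact: sm_0 | exact: lin_0].
have Ilin (c : k) u v : (exists2 x, S x & d x = u) -> (exists2 x, S x & d x = v) ->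
    exists2 x, S x & d x = c *: u + v.
  move=> [x Sx <-] [y Sy <-]; exists (c *: x + y); first exact: sm_lin.
  exact: dlin.
have [Q [QI QD]] :=
  submod_complement (@Submod k W (fun y => exists2 x, S x & d x = y) I0 Ilin).
have uniq y x x' : S x -> C x -> Q (y - d x) -> S x' -> C x' -> Q (y - d x') ->
    x = x'.
  move=> Sx Cx Qx Sx' Cx' Qx'; apply/eqP; rewrite -subr_eq0; apply/eqP.
  have SB : S (x - x') by exact: submodB.
  apply: CK; last exact: submodB.
  split=> //; apply: QI; first by exists (x - x').
  have -> : d (x - x') = (y - d x') - (y - d x).
    by rewrite (lin_sub dlin) opprB [RHS]addrC addrA subrK.
  exact: submodB.
have ex y : exists x, [/\ S x, C x & Q (y - d x)].
  have [_ [q [[x Sx <-] Qq ->]]] := QD y.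
  have [a [b [[Sa a0] Cb xE]]] := CD x.
  have Sb : S b.
    have -> : b = x - a by rewrite xE addrAC subrr add0r.
    exact: submodB.
  exists b; split=> //.
  by rewrite xE (lin_add dlin) a0 add0r addrAC subrr add0r.
have [s sP] := choice ex.
exists s; split.
- move=> c u v; have [S1 C1 Q1] := sP u; have [S2 C2 Q2] := sP v.
  have [S3 C3 Q3] := sP (c *: u + v).
  apply: (uniq (c *: u + v)) => //; [exact: sm_lin | exact: sm_lin |].
  rewrite dlin opprD addrACA -scalerBr; exact: sm_lin.
- by move=> y; have [] := sP y.
move=> x Sx; have [S1 C1 Q1] := sP (d x).
apply/esym/eqP; rewrite -subr_eq0; apply/eqP; apply: QI => //.
exists (x - s (d x)); [exact: submodB | exact: lin_sub].
Qed.

Lemma linear_pseudo_inverse (V W : lmodType k) (d : V -> W) :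
  linear d -> exists2 s : W -> V, linear s & forall x, d (s (d x)) = d x.
Proof.
move=> dlin; have lin1 (c : k) (u v : V) : True -> True -> True by [].
have [s [sl _ sd]] := pseudo_inverse (@Submod k V (fun=> True) I lin1) dlin.
by exists s => // x; exact: sd.
Qed.

End PseudoInverse.

(** * Isomorphisms of subquotients *)

Definition linear_iso (k : fieldType) (V W : lmodType k) : Prop :=
  exists phi : {linear V -> W}, bijective phi.

Section LinearIso.
Variable k : fieldType.

Lemma inj_surj_bij (X Y : Type) (f : X -> Y) :
  injective f -> surjective f -> bijective f.
Proof.
move=> finj fsurj; have [g gP] := choice fsurj.
by exists g => // x; apply: finj; rewrite gP.
Qed.

Lemma linear_iso_intro (V W : lmodType k) (f : V -> W) :
  linear f -> injective f -> surjective f -> linear_iso V W.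
Proof.
move=> flin finj fsurj.
pose m := GRing.isLinear.Build k V W _ f flin.
pose phi : {linear V -> W} := HB.pack f m.
by exists phi; exact: inj_surj_bij.
Qed.

Lemma linear_iso_sym (V W : lmodType k) : linear_iso V W -> linear_iso W V.
Proof.
move=> [phi [psi pK sK]].
apply: (@linear_iso_intro _ _ psi); last 2 first.
- exact: can_inj sK.
- by move=> v; exists (phi v); exact: pK.
by move=> c u v; apply: (can_inj pK); rewrite linearP !sK.
Qed.

Lemma linear_iso_trans (U V W : lmodType k) :
  linear_iso U V -> linear_iso V W -> linear_iso U W.
Proof.
move=> [f fb] [g gb].
apply: (@linear_iso_intro _ _ (g \o f)).
- by move=> c u v /=; rewrite !linearP.
- exact: inj_comp (bij_inj gb) (bij_inj fb).
- case: gb => g' gK gK' w; case: fb => f' fK fK'.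
  by exists (f' (g' w)); rewrite /= fK' gK'.
Qed.

Lemma subquo_iso (V W : lmodType k) (Z B : submod V) (Z' B' : submod W)
    (F : V -> W) :
  linear F ->
  (forall z, Z z -> Z' (F z)) ->
  (forall z, Z z -> B z -> B' (F z)) ->
  (forall z, Z z -> B' (F z) -> B z) ->
  (forall z', Z' z' -> exists2 z, Z z & B' (z' - F z)) ->
  linear_iso (subquo Z B) (subquo Z' B').
Proof.
move=> Flin FZ FB FI FS.
have FZ' (z : subspace Z) : F (val z) \in in_submod Z'.
  by apply/in_submodP/FZ; case: z => z /= /in_submodP.
pose f0 z : subspace Z' := Subspace (FZ' z).
have f0lin : linear f0.
  by move=> c u v; apply: val_inj; rewrite /= Flin.
pose BZ := @Submod k (subspace Z) _ (restrict_0 Z B) (@restrict_lin _ _ Z B).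
pose BZ' := @Submod k (subspace Z') _ (restrict_0 Z' B') (@restrict_lin _ _ Z' B').
have valZ (z : subspace Z) : Z (val z) by case: z => z /= /in_submodP.
pose f (q : quo BZ) : quo BZ' := quo_proj BZ' (f0 (repr q)).
have fE z : f (quo_proj BZ z) = quo_proj BZ' (f0 z).
  rewrite /f; apply/quo_projP/in_submodP.
  have /quo_projP/in_submodP : quo_proj BZ (repr (quo_proj BZ z)) = quo_proj BZ z.
    exact: reprK.
  rewrite /= => /FB; rewrite -(lin_sub Flin); apply.
  exact: (valZ (repr (quo_proj BZ z) - z)).
have flin : linear f.
  move=> c q r; case: (quo_proj_surj q) => u ->; case: (quo_proj_surj r) => v ->.
  by rewrite -linearP !fE f0lin linearP.
apply: (@linear_iso_intro _ _ f) => //.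
  move=> q r; case: (quo_proj_surj q) => u ->; case: (quo_proj_surj r) => v ->.
  rewrite !fE => /quo_projP/in_submodP /= H; apply/quo_projP/in_submodP => /=.
  apply: FI; first exact: (valZ (u - v)).
  by rewrite (lin_sub Flin).
move=> q; case: (quo_proj_surj q) => -[z' Zz'] ->.
have [z Zz Bz] := FS _ (elimT (in_submodP _ _) Zz').
exists (quo_proj BZ (Subspace (introT (in_submodP _ _) Zz))); rewrite fE.
apply/quo_projP/in_submodP; rewrite /= -opprB; exact: submodN.
Qed.

End LinearIso.

(** * Double complexes *)

Section Cohomology.
Variables (k : fieldType) (V : lmodType k) (K : nat -> submod V) (d : V -> V).
Hypothesis dlin : linear d.

Definition cycle n (x : V) : Prop := K n x /\ d x = 0.

Definition boundary n (x : V) : Prop :=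
  match n with
  | 0 => x = 0
  | n'.+1 => exists2 y, K n' y & x = d y
  end.

Fact cycle_0 n : cycle n 0.
Proof. by split; [exact: sm_0 | exact: lin_0]. Qed.

Fact cycle_lin n (c : k) u v : cycle n u -> cycle n v -> cycle n (c *: u + v).
Proof.
move=> [Ku u0] [Kv v0]; split; first exact: sm_lin.
by rewrite dlin u0 v0 scaler0 addr0.
Qed.

Fact boundary_0 n : boundary n 0.
Proof. by case: n => //= n; exists 0; [exact: sm_0 | rewrite (lin_0 dlin)]. Qed.

Fact boundary_lin n (c : k) u v :
  boundary n u -> boundary n v -> boundary n (c *: u + v).
Proof.
case: n => [|n] /=; first by move=> -> ->; rewrite scaler0 addr0.
move=> [x Kx ->] [y Ky ->]; exists (c *: x + y); first exact: sm_lin.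
by rewrite dlin.
Qed.

Definition cohomology n : lmodType k :=
  subquo (Submod (cycle_0 n) (@cycle_lin n)) (Submod (boundary_0 n) (@boundary_lin n)).

End Cohomology.

Section DoubleComplex.
Variables (k : fieldType) (V : lmodType k).

(** A bigraded space is an internal one: the pieces [G p q] are subspaces of one
    ambient space, and only the pieces on a common antidiagonal have to be
    independent.  Exchanging the two degrees is then a mere exchange of indices. *)
Definition independent (G : nat -> nat -> submod V) : Prop :=
  forall n (xs : nat -> V), (forall i, (i <= n)%N -> G (n - i)%N i (xs i)) ->
    \sum_(i < n.+1) xs i = 0 -> forall i, (i <= n)%N -> xs i = 0.

Definition family (G : nat -> nat -> submod V) n (xs : nat -> V) : Prop :=
  (forall i, (i <= n)%N -> G (n - i)%N i (xs i)) /\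
  (forall i, (n < i)%N -> xs i = 0).

Definition total_pred G n (x : V) : Prop :=
  exists2 xs, family G n xs & x = \sum_(i < n.+1) xs i.

Fact total_0 G n : total_pred G n 0.
Proof.
exists (fun=> 0); last by rewrite big1.
by split=> // i _; exact: sm_0.
Qed.

Fact total_lin G n (c : k) u v :
  total_pred G n u -> total_pred G n v -> total_pred G n (c *: u + v).
Proof.
move=> [xs [xG x0] ->] [ys [yG y0] ->]; exists (fun i => c *: xs i + ys i).
  split=> i ni; first by apply: sm_lin; [exact: xG | exact: yG].
  by rewrite x0 // y0 // scaler0 addr0.
by rewrite big_split scaler_sumr.
Qed.

Definition total_space G n : submod V := Submod (total_0 G n) (@total_lin G n).

Lemma sum_single n i (x : V) : (i <= n)%N ->
  \sum_(j < n.+1) (if j == i :> nat then x else 0) = x.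
Proof.
move=> i_n; rewrite -big_mkcond (big_pred1 (Ordinal (i_n : (i < n.+1)%N))) //.
Qed.

Lemma total_single (G : nat -> nat -> submod V) p q n (x : V) :
  G p q x -> n = (p + q)%N -> total_space G n x.
Proof.
move=> Gx ->; exists (fun i => if i == q then x else 0); last first.
  by rewrite sum_single // leq_addl.
split=> i ni; last by case: eqP => // iq; move: ni; rewrite iq ltnNge leq_addl.
by case: eqP => [->|_]; [rewrite addnK | exact: sm_0].
Qed.

Section Rows.
Variables (G : nat -> nat -> submod V) (d1 d2 : V -> V).
Hypotheses (lin1 : linear d1) (lin2 : linear d2).
Hypotheses (G1 : forall p q x, G p q x -> G p.+1 q (d1 x))
           (G2 : forall p q x, G p q x -> G p q.+1 (d2 x)).
Hypotheses (d11 : forall p q x, G p q x -> d1 (d1 x) = 0)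
           (d22 : forall p q x, G p q x -> d2 (d2 x) = 0)
           (d12 : forall p q x, G p q x -> d1 (d2 x) + d2 (d1 x) = 0).
Hypothesis Gind : independent G.
Hypothesis rows : forall p q x, G p q.+1 x -> d2 x = 0 ->
  exists2 y, G p q y & d2 y = x.

Definition dtot (x : V) : V := d1 x + d2 x.

Lemma dtot_lin : linear dtot.
Proof.
by move=> c u v; rewrite /dtot lin1 lin2 scalerDr addrACA.
Qed.

Lemma dtot_sum (I : Type) (r : seq I) (F : I -> V) :
  dtot (\sum_(i <- r) F i) = \sum_(i <- r) dtot (F i).
Proof.
apply: (big_morph dtot); [exact: (lin_add dtot_lin) | exact: (lin_0 dtot_lin)].
Qed.

Lemma dtot_dtot_piece p q x : G p q x -> dtot (dtot x) = 0.
Proof.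
move=> Gx; rewrite /dtot (lin_add lin1) (lin_add lin2).
by rewrite (d11 Gx) (d22 Gx) add0r addr0 (d12 Gx).
Qed.

Lemma dtot_dtot n x : total_space G n x -> dtot (dtot x) = 0.
Proof.
move=> [xs [xG x0] ->]; rewrite !dtot_sum big1 // => i _.
by apply: (@dtot_dtot_piece (n - i) i); apply: xG; rewrite -ltnS.
Qed.

(** By independence an equation in the total complex can be read off componentwise,
    here in the bidegrees [(n - i, i.+1)]. *)
Lemma family_components n xs e : family G n xs -> G n.+1 0 e ->
  dtot (\sum_(i < n.+1) xs i) = e ->
  forall i, (i <= n)%N -> d1 (xs i.+1) + d2 (xs i) = 0.
Proof.
move=> [xG x0] Ge dx i i_n.
pose ys j := if j is j'.+1 then d1 (xs j) + d2 (xs j') else d1 (xs 0%N) - e.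
have -> : d1 (xs i.+1) + d2 (xs i) = ys i.+1 by [].
apply: (Gind (n := n.+1)) => // [[_|j j_n]|].
- apply: submodB; last by rewrite subn0.
  by rewrite subn0; apply: G1; have := xG 0%N (leq0n _); rewrite subn0.
- rewrite /ys subSS; apply: submodD; last exact/G2/xG.
  have [j_lt|n_j] := ltnP j n; last by rewrite x0 // (lin_0 lin1); exact: sm_0.
  by rewrite -subnSK //; apply/G1/xG.
have S1 : d1 (xs 0%N) + \sum_(j < n.+1) d1 (xs j.+1) = \sum_(j < n.+1) d1 (xs j).
  transitivity (\sum_(j < n.+2) d1 (xs j)); first by rewrite [RHS]big_ord_recl.
  by rewrite big_ord_recr /= x0 // (lin_0 lin1) addr0.
rewrite big_ord_recl /= big_split /= addrAC addrA S1 -big_split /=.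
by rewrite -dtot_sum dx subrr.
Qed.

Lemma piece_components p e x : G p 0 x -> G p.+1 0 e -> dtot x = e -> d2 x = 0.
Proof.
move=> Gx Ge dx.
pose xs i := if i == 0%N then x else 0.
have xsE : \sum_(i < p.+1) xs i = x by rewrite sum_single.
have fx : family G p xs.
  split=> i ni; last by rewrite /xs gtn_eqF // (leq_ltn_trans _ ni).
  by rewrite /xs; case: eqP => [->|_]; [rewrite subn0 | exact: sm_0].
have := family_components fx Ge; rewrite xsE => /(_ dx 0%N (leq0n _)).
by rewrite /xs /= (lin_0 lin1) add0r.
Qed.

(** The zigzag: the component of highest row degree is a [d2]-cycle, and by
    exactness of the rows it can be removed, down to row degree zero. *)
Lemma total_reduce n x : total_space G n x -> G n.+1 0 (dtot x) ->
  exists2 y, (if n is n'.+1 then total_space G n' y else y = 0) & G n 0 (x - dtot y).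
Proof.
move=> [xs0 xG0 xE] Ge; set e := dtot x in Ge.
suff H m : (m <= n)%N -> forall xs, family G n xs ->
    (forall i, (m < i)%N -> xs i = 0) -> dtot (\sum_(i < n.+1) xs i) = e ->
    exists2 y, (if n is n'.+1 then total_space G n' y else y = 0)
      & G n 0 (\sum_(i < n.+1) xs i - dtot y).
  by rewrite xE; apply: (H n) => //; [exact: xG0.2 | rewrite -xE].
elim: m => [|m IHm] m_n xs [xG x0] xm dx.
  exists 0; first by case: (n) => // n'; exact: sm_0.
  rewrite (lin_0 dtot_lin) subr0 big_ord_recl big1 => [|i _].
    by rewrite addr0; have := xG 0%N (leq0n _); rewrite subn0.
  by rewrite xm.
have xm0 : d2 (xs m.+1) = 0.
  have := family_components (conj xG x0) Ge dx m_n.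
  by rewrite (xm m.+2) // (lin_0 lin1) add0r.
have [y Gy dy] := rows (xG _ m_n) xm0.
have ny : n.-1 = (n - m.+1 + m)%N by rewrite -[n in LHS](subnK m_n) addnS.
have n0 : n = n.-1.+1 by case: (n) m_n.
have yt : total_space G n.-1 y by exact: total_single Gy ny.
pose xs' i := xs i - ((if i == m then d1 y else 0) + (if i == m.+1 then d2 y else 0)).
have xs'E : \sum_(i < n.+1) xs' i = \sum_(i < n.+1) xs i - dtot y.
  by rewrite /xs' sumrB big_split /= !sum_single // ltnW.
have xs'z i : (m < i)%N -> xs' i = 0.
  rewrite /xs' leq_eqVlt => /orP[/eqP<-|mi].
    by rewrite eqxx dy gtn_eqF // add0r subrr.
  by rewrite xm // !gtn_eqF ?(ltnW mi) // addr0 subr0.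
have fx' : family G n xs'.
  split=> i ni; last by apply: xs'z; exact: ltn_trans ni.
  have [mi|im] := ltnP m i; first by rewrite xs'z //; exact: sm_0.
  apply: submodB; first exact: xG.
  rewrite (ltn_eqF (_ : i < m.+1)%N) // addr0; case: eqP => [->|_]; last exact: sm_0.
  by have := G1 Gy; rewrite subnSK.
have [z zt Gz] : exists2 z, (if n is n'.+1 then total_space G n' z else z = 0)
    & G n 0 (\sum_(i < n.+1) xs' i - dtot z).
  apply: IHm => //; first exact: ltnW.
  by rewrite xs'E (lin_sub dtot_lin) (dtot_dtot yt) subr0.
exists (y + z); last by rewrite (lin_add dtot_lin) opprD addrA -xs'E.
by case: (n) n0 zt yt => // n' _ zt yt; apply: (submodD (U := total_space G n')).
Qed.

Definition row_pred p (x : V) : Prop := G p 0 x /\ d2 x = 0.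

Fact row_0 p : row_pred p 0.
Proof. by split; [exact: sm_0 | exact: lin_0]. Qed.

Fact row_lin p (c : k) u v : row_pred p u -> row_pred p v -> row_pred p (c *: u + v).
Proof.
move=> [Gu u0] [Gv v0]; split; first exact: sm_lin.
by rewrite lin2 u0 v0 scaler0 addr0.
Qed.

Definition row_kernel p : submod V := Submod (row_0 p) (@row_lin p).

Lemma row_total p x : row_kernel p x -> total_space G p x.
Proof. by move=> [Gx _]; apply: total_single Gx _; rewrite addn0. Qed.

Lemma row_dtot p x : row_kernel p x -> dtot x = d1 x.
Proof. by move=> [_ x0]; rewrite /dtot x0 addr0. Qed.

(** [total_reduce] applies twice: to a cocycle, moving it to the edge, and to a
    primitive of a cocycle of the edge, moving it to the edge as well. *)
Lemma row_total_iso n :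
  linear_iso (cohomology row_kernel lin1 n) (cohomology (total_space G) dtot_lin n).
Proof.
apply: (@subquo_iso _ _ _ _ _ _ _ id) => // z.
- move=> [rz z0]; split; first exact: row_total.
  by rewrite (row_dtot rz).
- move=> _; case: n => //= n [y ry ->]; exists y; first exact: row_total.
  by rewrite (row_dtot ry).
- move=> [rz _]; case: n rz => //= n rz [y ty zE].
  have [w wt Gw] : exists2 w, (if n is n'.+1 then total_space G n' w else w = 0)
      & G n 0 (y - dtot w).
    by apply: total_reduce => //; rewrite -zE; case: rz.
  have dw0 : dtot (dtot w) = 0.
    case: n {rz y ty zE Gw} wt => [->|n' wt]; last exact: dtot_dtot wt.
    by rewrite !(lin_0 dtot_lin).
  have dyw : dtot (y - dtot w) = z by rewrite (lin_sub dtot_lin) dw0 subr0.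
  have ryw : row_kernel n (y - dtot w).
    by split=> //; apply: (piece_components Gw) dyw; case: rz.
  by exists (y - dtot w) => //; rewrite -(row_dtot ryw).
- move=> [tz z0]; have [y yt Gy] : exists2 y,
      (if n is n'.+1 then total_space G n' y else y = 0) & G n 0 (z - dtot y).
    by apply: total_reduce => //; rewrite z0; exact: sm_0.
  have dy0 : dtot (dtot y) = 0.
    case: n {tz Gy} yt => [->|n' yt]; last exact: dtot_dtot yt.
    by rewrite !(lin_0 dtot_lin).
  have dzy : dtot (z - dtot y) = 0 by rewrite (lin_sub dtot_lin) dy0 z0 subr0.
  have rzy : row_kernel n (z - dtot y).
    split=> //; apply: (piece_components Gy) dzy; exact: sm_0.
  exists (z - dtot y); first by split=> //; rewrite -(row_dtot rzy).
  rewrite opprB addrC subrK.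
  by case: n {tz Gy rzy} yt => [->|n' yt]; [rewrite /= (lin_0 dtot_lin) | exists y].
Qed.

End Rows.

Definition transpose (G : nat -> nat -> submod V) p q := G q p.

Lemma total_transpose G n x : total_space G n x -> total_space (transpose G) n x.
Proof.
move=> [xs [xG x0] ->].
exists (fun i => if (i <= n)%N then xs (n - i)%N else 0).
  split=> i; last by rewrite ltnNge; case: leqP.
  by move=> i_n; rewrite i_n /transpose -{1}(subKn i_n); apply: xG; exact: leq_subr.
rewrite (reindex_inj rev_ord_inj) /=; apply: eq_bigr => i _.
by rewrite subSS -ltnS ltn_ord.
Qed.

Lemma independent_transpose G : independent G -> independent (transpose G).
Proof.
move=> Gind n xs xG x0 i i_n.
have := Gind n (fun i => xs (n - i)%N).
rewrite -(subKn i_n) => -> //; last exact: leq_subr.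
  move=> j j_n; have := xG (n - j)%N (leq_subr _ _); rewrite /transpose subKn //.
rewrite -[RHS]x0 [RHS](reindex_inj rev_ord_inj) /=.
by apply: eq_bigr => j _; rewrite subSS.
Qed.

Section Both.
Variables (G : nat -> nat -> submod V) (d1 d2 : V -> V).
Hypotheses (lin1 : linear d1) (lin2 : linear d2).
Hypotheses (G1 : forall p q x, G p q x -> G p.+1 q (d1 x))
           (G2 : forall p q x, G p q x -> G p q.+1 (d2 x)).
Hypotheses (d11 : forall p q x, G p q x -> d1 (d1 x) = 0)
           (d22 : forall p q x, G p q x -> d2 (d2 x) = 0)
           (d12 : forall p q x, G p q x -> d1 (d2 x) + d2 (d1 x) = 0).
Hypothesis Gind : independent G.
Hypothesis rows : forall p q x, G p q.+1 x -> d2 x = 0 ->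
  exists2 y, G p q y & d2 y = x.
Hypothesis cols : forall p q x, G p.+1 q x -> d1 x = 0 ->
  exists2 y, G p q y & d1 y = x.

Lemma row_column_iso n :
  linear_iso (cohomology (row_kernel G lin2) lin1 n)
             (cohomology (row_kernel (transpose G) lin1) lin2 n).
Proof.
apply: (linear_iso_trans (row_total_iso lin1 lin2 G1 G2 d11 d22 d12 Gind rows n)).
apply: linear_iso_sym.
have iso := @row_total_iso (transpose G) d2 d1 lin2 lin1 _ _ _ _ _ _ _ n.
apply: (linear_iso_trans (iso _ _ _ _ _ _ _)) => [p q x|p q x|p q x|p q x|p q x||p q x|].
- exact: G2.
- exact: G1.
- exact: d22.
- exact: d11.
- by rewrite addrC; exact: d12.
- exact: independent_transpose.
- exact: cols.
have dE x : dtot d2 d1 x = dtot d1 d2 x by rewrite /dtot addrC.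
clear iso.
apply: (@subquo_iso _ _ _ _ _ _ _ id) => // [z [tz z0]|z _|z _|z [tz z0]].
- by split; [exact: total_transpose tz | rewrite -dE].
- case: n => //= n [y ty ->]; exists y; [exact: total_transpose ty | exact: dE].
- case: n => //= n [y ty ->]; exists y; [exact: total_transpose ty | exact/esym/dE].
- exists z; first by split; [exact: total_transpose tz | rewrite dE].
  by rewrite subrr; exact: sm_0.
Qed.

End Both.

End DoubleComplex.

(** * Hochschild cochains *)

Section Inner.
Variables (k : fieldType) (A : algType k).

(** The terms of the Hochschild coboundary other than the first one.  The last
    term is a parameter [L], applied to all letters but the last and to the last
    letter: with it the recursion on the word needs no compatibility between the
    letters and the values. *)
Fixpoint inner (T : lmodType k) (H : seq A -> T) (L : seq A -> A -> T) (s : seq A) : T :=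
  match s with
  | [::] => 0
  | a :: s' =>
      match s' with
      | [::] => - L [::] a
      | a' :: s'' => - H (a * a' :: s'')
          - inner (fun s => H (a :: s)) (fun s => L (a :: s)) s'
      end
  end.

Lemma inner_cons2 (T : lmodType k) (H : seq A -> T) L a a' s :
  inner H L (a :: a' :: s) = - H (a * a' :: s)
    - inner (fun s => H (a :: s)) (fun s => L (a :: s)) (a' :: s).
Proof. by []. Qed.

Lemma inner_nat (T T' : lmodType k) (psi : T -> T') (H : seq A -> T) L s :
  linear psi ->
  inner (fun s => psi (H s)) (fun s a => psi (L s a)) s = psi (inner H L s).
Proof.
move=> psil; have psiN u := lin_opp u psil.
elim: s H L => [|a [|a' s] IH] H L; first by rewrite (lin_0 psil).
  by rewrite /= psiN.
by rewrite !inner_cons2 (IH (fun s => H (a :: s))) (lin_sub psil) psiN.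
Qed.

Lemma inner_lin (T : lmodType k) c (H H' : seq A -> T) L L' s :
  inner (fun s => c *: H s + H' s) (fun s a => c *: L s a + L' s a) s
  = c *: inner H L s + inner H' L' s.
Proof.
elim: s H H' L L' => [|a [|a' s] IH] H H' L L'; first by rewrite scaler0 addr0.
  by rewrite /= opprD scalerN.
by rewrite !inner_cons2 IH !scalerDr !scalerN !opprD addrACA.
Qed.

Lemma inner_support (T : lmodType k) (P : pred nat) (H : seq A -> T) L s :
  (forall s, ~~ P (size s) -> H s = 0) ->
  (forall s a, ~~ P (size s) -> L s a = 0) ->
  ~~ P (size s).-1 -> inner H L s = 0.
Proof.
elim: s P H L => [|a [|a' s] IH] P H L H0 L0 // nP; first by rewrite /= L0 ?oppr0.
rewrite inner_cons2 (IH (fun n => P n.+1)) ?H0 ?oppr0 ?addr0 // => [t nPt|t b nPt].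
  exact: H0.
exact: L0.
Qed.

Lemma inner_sign (T : lmodType k) m (H : seq A -> T) L s :
  inner (fun s => (-1) ^+ (m + size s) *: H s)
        (fun s a => (-1) ^+ (m + size s) *: L s a) s
  = - ((-1) ^+ (m + size s) *: inner H L s).
Proof.
elim: s m H L => [|a [|a' s] IH] m H L; first by rewrite scaler0 oppr0.
  by rewrite /= addn0 addn1 exprS !mulN1r scalerN scaleNr !opprK.
have addS t : (m + size (a :: t))%N = (m.+1 + size t)%N by rewrite /= addnS.
rewrite !inner_cons2.
have -> : (fun s => (-1) ^+ (m + size (a :: s)) *: H (a :: s)) =
    (fun s => (-1) ^+ (m.+1 + size s) *: H (a :: s)).
  by apply/funext => t; rewrite addS.
have -> : (fun s b => (-1) ^+ (m + size (a :: s)) *: L (a :: s) b) =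
    (fun s b => (-1) ^+ (m.+1 + size s) *: L (a :: s) b).
  by apply/funext => t; apply/funext => b; rewrite addS.
rewrite IH addS scalerDr !scalerN !opprD !opprK; congr (_ + _).
by rewrite [in RHS]addSn exprS mulN1r scaleNr.
Qed.

(** The same recursion from the other end of the word, where the contraction given
    by a left section acts. *)
Lemma inner_rcons (T : lmodType k) (H : seq A -> T) L s c c' :
  inner H L (rcons (rcons s c) c')
  = inner (fun s => H (rcons s c')) (fun s c => H (rcons s (c * c'))) (rcons s c)
    + (-1) ^+ size s *: L (rcons s c) c'.
Proof.
elim: s H L => [|a s IH] H L.
  by rewrite /= opprK scale1r.
have {IH} := IH (fun s => H (a :: s)) (fun s => L (a :: s)).
case: s => [|a' s] IHa.
  by rewrite /= !opprD !opprK expr1 scaleN1r addrA.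
rewrite !rcons_cons !inner_cons2 in IHa *.
by rewrite IHa opprD addrA [in RHS]exprS mulN1r scaleNr.
Qed.

Lemma inner_multilinear (T : lmodType k) (H : seq A -> T) L :
  seq_multilinear H -> (forall s, linear (L s)) ->
  (forall a, seq_multilinear (fun s => L s a)) -> seq_multilinear (inner H L).
Proof.
move=> Hm Ll Lm s1; elim: s1 H L Hm Ll Lm => [|a s1 IH] H L Hm Ll Lm s2 c u v.
  case: s2 => [|a' s2]; first by rewrite /= Ll opprD scalerN.
  rewrite /cat !inner_cons2 mulrDl -scalerAl (Hm [::]).
  have -> : (fun s => H (c *: u + v :: s)) = (fun s => c *: H (u :: s) + H (v :: s)).
    by apply/funext => s; rewrite (Hm [::]).
  have -> : (fun s => L (c *: u + v :: s)) =
      (fun s a => c *: L (u :: s) a + L (v :: s) a).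
    by apply/funext => s; apply/funext => a; rewrite (Lm a [::]).
  by rewrite inner_lin !scalerDr !scalerN !opprD addrACA.
have {}IH := IH (fun s => H (a :: s)) (fun s => L (a :: s))
  (fun s1 => Hm (a :: s1)) (fun s => Ll (a :: s)) (fun b s1 => Lm b (a :: s1)).
case: s1 IH => [|a' s1] IH; rewrite !cat_cons !inner_cons2.
  rewrite mulrDr -scalerAr (Hm [::]) (IH s2).
  by rewrite !scalerDr !scalerN !opprD addrACA.
rewrite (Hm (a * a' :: s1)) -!cat_cons (IH s2).
by rewrite !scalerDr !scalerN !opprD addrACA.
Qed.

End Inner.

(** Bimodules without unit laws, whose actions are linear in the algebra only on the
    subspaces singled out below by [admissible].  The spaces of all functions on a
    bimodule are of this kind, the linear functions being the admissible ones. *)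
Record hcoef (k : fieldType) (A : algType k) (T : lmodType k) := HCoef {
  hl : A -> T -> T;
  hr : T -> A -> T;
  hl_lin : forall a, linear (hl a);
  hr_lin : forall a, linear (fun t => hr t a);
  hlM : forall a b t, hl (a * b) t = hl a (hl b t);
  hrM : forall t a b, hr t (a * b) = hr (hr t a) b;
  hlr : forall a t b, hr (hl a t) b = hl a (hr t b) }.

Section Hochschild.
Variables (k : fieldType) (A : algType k) (T : lmodType k) (S : hcoef A T).

Definition hinner (H : seq A -> T) (s : seq A) : T :=
  inner H (fun s a => hr S (H s) a) s.

Definition hoch (H : seq A -> T) (s : seq A) : T :=
  (if s is a :: s' then hl S a (H s') else 0) + hinner H s.

Lemma hinner_lin c (H H' : seq A -> T) s :
  hinner (fun s => c *: H s + H' s) s = c *: hinner H s + hinner H' s.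
Proof.
rewrite /hinner -inner_lin; congr (inner _ _ s).
by apply/funext => t; apply/funext => a; rewrite (hr_lin S).
Qed.

Lemma hoch_lin c (H H' : seq A -> T) s :
  hoch (fun s => c *: H s + H' s) s = c *: hoch H s + hoch H' s.
Proof.
rewrite /hoch hinner_lin scalerDr addrACA; congr (_ + _).
by case: s => [|a s]; [rewrite scaler0 addr0 | rewrite (hl_lin S)].
Qed.

Lemma hinnerD (H H' : seq A -> T) s :
  hinner (fun s => H s + H' s) s = hinner H s + hinner H' s.
Proof.
rewrite -[hinner H s]scale1r -hinner_lin; congr (hinner _ s).
by apply/funext => t; rewrite scale1r.
Qed.

Lemma hinner0 s : hinner (fun=> 0) s = 0.
Proof.
have := hinnerD (fun=> 0) (fun=> 0) s.
have -> : (fun _ : seq A => 0 + 0 : T) = (fun=> 0) by apply/funext => t; rewrite addr0.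
by move/eqP; rewrite -subr_eq0 opprD addrA subrr add0r oppr_eq0 => /eqP.
Qed.

Lemma hinnerN (H : seq A -> T) s : hinner (fun s => - H s) s = - hinner H s.
Proof.
have := hinner_lin (-1) H (fun=> 0) s; rewrite hinner0 addr0 scaleN1r => <-.
by congr (hinner _ s); apply/funext => t; rewrite addr0 scaleN1r.
Qed.

Lemma hinner_cons2 (H : seq A -> T) a a' s :
  hinner H (a :: a' :: s) = - H (a * a' :: s) - hinner (fun s => H (a :: s)) (a' :: s).
Proof. by []. Qed.

(** The outer sum contracts the word behind [a1].  In the resulting twofold
    contractions of [a1 :: a2 :: s] those away from [a1] cancel in pairs, and those
    that involve [a1] leave the contractions of the word with [a1] and [a2]
    multiplied. *)
Lemma hinner_hinner (H : seq A -> T) a1 a2 s :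
  hinner (fun s => hinner H (a1 :: s)) (a2 :: s) = - hinner H (a1 * a2 :: s).
Proof.
have hrN t b : hr S (- t) b = - hr S t b := lin_opp t (hr_lin S b).
elim: s H a1 a2 => [|a3 s IH] H a1 a2.
  by rewrite /hinner /= !opprK hrN opprK hrM.
rewrite !hinner_cons2.
have -> : (fun s => hinner H (a1 :: a2 :: s)) =
    (fun s => - (H (a1 * a2 :: s)) + - hinner (fun s => H (a1 :: s)) (a2 :: s)) by [].
rewrite hinnerD !hinnerN IH opprK.
by rewrite !opprD !opprK mulrA -!addrA; congr (_ + _); rewrite addrC subrK.
Qed.

Lemma hoch_hoch (H : seq A -> T) s : hoch (hoch H) s = 0.
Proof.
case: s => [|a1 [|a2 s]]; first by rewrite /hoch add0r.
  by rewrite /hoch /hinner /= !addr0 (lin_0 (hl_lin S _)) (lin_0 (hr_lin S _)) oppr0 addr0.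
rewrite {1}/hoch hinner_cons2.
have -> : (fun s => hoch H (a1 :: s)) =
    (fun s => hl S a1 (H s) + hinner H (a1 :: s)) by [].
rewrite hinnerD hinner_hinner /hoch (lin_add (hl_lin S a1)) -hlM.
have -> : hinner (fun s => hl S a1 (H s)) (a2 :: s) = hl S a1 (hinner H (a2 :: s)).
  rewrite /hinner -(inner_nat _ _ _ (hl_lin S a1)); congr (inner _ _ _).
  by apply/funext => t; apply/funext => a; rewrite hlr.
set x := hl S _ _; set y := hl S _ _; set z := hinner _ _.
by rewrite !opprD opprK addrACA [x + _]addrA [y + _]addrA !subrr !add0r addNr.
Qed.

Lemma hoch_nil (H : seq A -> T) : hoch H [::] = 0.
Proof. by rewrite /hoch add0r. Qed.

Lemma hoch_support (P : pred nat) (H : seq A -> T) s :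
  (forall s, ~~ P (size s) -> H s = 0) -> ~~ P (size s).-1 -> hoch H s = 0.
Proof.
move=> H0 nP; rewrite /hoch /hinner (inner_support (P := P)) ?addr0 //; last first.
  by move=> t a nPt; rewrite H0 // (lin_0 (hr_lin S a)).
by case: s nP => // a s nP; rewrite H0 ?(lin_0 (hl_lin S a)).
Qed.

Lemma hoch_sign (H : seq A -> T) s :
  hoch (fun s => (-1) ^+ size s *: H s) s = - ((-1) ^+ size s *: hoch H s).
Proof.
rewrite /hoch scalerDr opprD; congr (_ + _).
  case: s => [|a s]; first by rewrite scaler0 oppr0.
  by rewrite (lin_scale (hl_lin S a)) /= exprS mulN1r scaleNr opprK.
rewrite -(inner_sign 0); congr (inner _ _ s).
by apply/funext => t; apply/funext => a; rewrite add0n (lin_scale (hr_lin S a)).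
Qed.

Definition admissible (Th : submod T) : Prop :=
  forall t, Th t ->
    [/\ forall a, Th (hl S a t), forall a, Th (hr S t a),
        linear (fun a => hl S a t) & linear (hr S t)].

Variables (Th : submod T) (adm : admissible Th).

Lemma hoch_in (H : seq A -> T) s : (forall s, Th (H s)) -> Th (hoch H s).
Proof.
move=> HT; apply: submodD.
  case: s => [|a s]; first exact: sm_0.
  by have [+ _ _ _] := adm (HT s); apply.
rewrite /hinner.
elim: s H HT => [|a [|a' s] IH] H HT; first exact: sm_0.
  by apply: submodN; have [_ + _ _] := adm (HT [::]); apply.
rewrite inner_cons2; apply: submodB; first exact: submodN.
exact: (IH (fun s => H (a :: s))).
Qed.

Lemma hoch_multilinear (H : seq A -> T) :
  seq_multilinear H -> (forall s, Th (H s)) -> seq_multilinear (hoch H).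
Proof.
move=> Hm HT s1 s2 c u v; rewrite /hoch scalerDr addrACA; congr (_ + _).
  case: s1 => [|a s1]; first by have [_ _ hT _] := adm (HT s2); exact: hT.
  by rewrite /= Hm (hl_lin S a).
apply: inner_multilinear => // [s|a t1 t2 d x y]; first by have [] := adm (HT s).
by rewrite Hm (hr_lin S a).
Qed.

Definition admissible_map (Phi : A -> T) : Prop :=
  linear Phi /\ forall a, Th (Phi a).

(** An operator [e] as below comes from an equivariant section of the right
    action map [X (x) A -> X], for [T] the functions on a right module [X]:
    then [e Phi x] is the sum of [Phi a' x'] over the terms of the image
    of [x]. *)
Record right_section (e : (A -> T) -> T) : Prop := RightSection {
  rs_lin : linear e;
  rs_in : forall Phi, admissible_map Phi -> Th (e Phi);
  rs_id : forall t, Th t -> e (fun a => hl S a t) = t;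
  rs_hl : forall Phi b, admissible_map Phi -> hl S b (e Phi) = e (fun a => Phi (a * b));
  rs_hr : forall Phi b, hr S (e Phi) b = e (fun a => hr S (Phi a) b) }.

Record left_section (e : (A -> T) -> T) : Prop := LeftSection {
  ls_lin : linear e;
  ls_in : forall Phi, admissible_map Phi -> Th (e Phi);
  ls_id : forall t, Th t -> e (fun a => hr S t a) = t;
  ls_hr : forall Phi b, admissible_map Phi -> hr S (e Phi) b = e (fun a => Phi (b * a));
  ls_hl : forall Phi b, hl S b (e Phi) = e (fun a => hl S b (Phi a)) }.

Section Contract.
Variable H : seq A -> T.
Hypotheses (Hm : seq_multilinear H) (HT : forall s, Th (H s)).
Hypotheses (H0 : H [::] = 0) (Hd : forall s, hoch H s = 0).

(** The contraction of the bar resolution: the letter produced by the section is put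
    in front, and of the contractions of the longer word only that of the new letter
    with the argument survives. *)
Lemma right_contract e : right_section e ->
  forall s, hoch (fun s => e (fun a => H (a :: s))) s = H s.
Proof.
move=> eP [|a s]; first by rewrite H0 /hoch add0r.
have adm_s t : admissible_map (fun a => H (a :: t)) by split=> //; exact: (Hm [::]).
rewrite {1}/hoch (rs_hl eP) //.
have -> : hinner (fun s => e (fun a => H (a :: s))) (a :: s) =
    e (fun b => hinner (fun s => H (b :: s)) (a :: s)).
  rewrite /hinner.
  have -> : (fun b => inner (fun s => H (b :: s)) (fun s a => hr S (H (b :: s)) a) (a :: s))
      = inner (fun s b => H (b :: s)) (fun s a b => hr S (H (b :: s)) a) (a :: s).
    apply/funext => b.
    by rewrite -(@inner_nat _ _ _ _ (fun f : A -> T => f b)).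
  rewrite -(@inner_nat _ _ _ _ e (fun s b => H (b :: s))
    (fun s a b => hr S (H (b :: s)) a) _ (rs_lin eP)); congr (inner _ _ _).
  by apply/funext => t; apply/funext => b; rewrite (rs_hr eP).
rewrite -(lin_add (rs_lin eP)) -[RHS](rs_id eP) //; congr e; apply/funext => b.
have := Hd [:: b, a & s]; rewrite /hoch hinner_cons2 => /eqP.
by rewrite -opprD subr_eq0 => /eqP ->.
Qed.

(** Here the new letter comes last; the sign is that of its position. *)
Lemma left_contract e : left_section e ->
  forall s, hoch (fun s => (-1) ^+ (size s).+1 *: e (fun a => H (rcons s a))) s = H s.
Proof.
move=> eP s.
have -> : (fun s => (-1) ^+ (size s).+1 *: e (fun a => H (rcons s a))) =
    (fun s => (-1) ^+ size s *: ((-1) *: e (fun a => H (rcons s a)))).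
  by apply/funext => t; rewrite scalerA exprS mulrC.
rewrite hoch_sign; case/lastP: s => [|s a].
  by rewrite H0 /hoch add0r scaler0 oppr0.
have -> : hoch (fun s => -1 *: e (fun a => H (rcons s a))) (rcons s a) =
    - hoch (fun s => e (fun a => H (rcons s a))) (rcons s a).
  have := hoch_lin (-1) (fun s => e (fun a => H (rcons s a))) (fun=> 0) (rcons s a).
  have -> : hoch (fun=> 0) (rcons s a) = 0.
    rewrite /hoch hinner0 addr0; case: (rcons s a) => // b t.
    exact: lin_0 (hl_lin S b).
  rewrite addr0 scaleN1r => <-; congr (hoch _ _); apply/funext => t.
  by rewrite addr0.
rewrite scalerN opprK.
have adm_s t : admissible_map (fun a => H (rcons t a)).
  split=> // c u v; have := Hm t [::] c u v; by rewrite !cats1.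
have E : e (fun b => hoch H (rcons (rcons s a) b)) =
    hoch (fun s => e (fun a => H (rcons s a))) (rcons s a) + (-1) ^+ size s *: H (rcons s a).
  rewrite -[in RHS](ls_id eP (HT (rcons s a))) -(lin_scale (ls_lin eP)).
  rewrite /hoch /hinner.
  have -> : (fun s a0 => hr S (e (fun a => H (rcons s a))) a0) =
      (fun s a0 => e (fun a => H (rcons s (a0 * a)))).
    by apply/funext => t; apply/funext => b; rewrite (ls_hr eP).
  rewrite (@inner_nat _ _ _ _ e (fun s a => H (rcons s a))
    (fun s a0 a => H (rcons s (a0 * a))) _ (ls_lin eP)).
  have -> : (if rcons s a is a0 :: s' then hl S a0 (e (fun a => H (rcons s' a))) else 0)
     = e (fun b => if rcons (rcons s a) b is a0 :: s' then hl S a0 (H s') else 0).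
    by case: s => [|b s] /=; rewrite (ls_hl eP).
  rewrite -!(lin_add (ls_lin eP)); congr e; apply/funext => b.
  rewrite !fctE -addrA inner_rcons; congr (_ + (_ + _)).
  by rewrite -(@inner_nat _ _ _ _ (fun f : A -> T => f b)).
have e0 : e (fun b => hoch H (rcons (rcons s a) b)) = 0.
  rewrite -(lin_0 (ls_lin eP)); congr e; apply/funext => b; exact: Hd.
move: E; rewrite e0 => /esym/eqP; rewrite addrC addr_eq0 => /eqP E.
by rewrite size_rcons exprS mulN1r scaleNr -scalerN -E
  scalerA -expr2 sqrr_sign scale1r.
Qed.

End Contract.

End Hochschild.

Section Naturality.
Variables (k : fieldType) (A : algType k).

Lemma hoch_nat (T T' : lmodType k) (S : hcoef A T) (S' : hcoef A T') (psi : T -> T')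
    (H : seq A -> T) s :
  linear psi -> (forall a t, psi (hl S a t) = hl S' a (psi t)) ->
  (forall a t, psi (hr S t a) = hr S' (psi t) a) ->
  hoch S' (fun s => psi (H s)) s = psi (hoch S H s).
Proof.
move=> psil psiL psiR; rewrite /hoch (lin_add psil); congr (_ + _).
  by case: s => [|a s]; rewrite ?psiL ?(lin_0 psil).
rewrite /hinner -(inner_nat _ _ _ psil); congr (inner _ _ s).
by apply/funext => t; apply/funext => a; rewrite psiR.
Qed.

Lemma hochZ (T : lmodType k) (S : hcoef A T) c (H : seq A -> T) s :
  hoch S (fun s => c *: H s) s = c *: hoch S H s.
Proof.
apply: (hoch_nat (psi := fun t => c *: t)) => [d u v|a t|a t].
- by rewrite scalerDr !scalerA mulrC.
- by rewrite (lin_scale (hl_lin S a)).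
- by rewrite (lin_scale (hr_lin S a)).
Qed.

Lemma hoch_sign_pow (T : lmodType k) (S : hcoef A T) q (H : seq A -> T) s :
  hoch S (fun s => (-1) ^+ (q * size s) *: H s) s
  = (-1) ^+ q *: ((-1) ^+ (q * size s) *: hoch S H s).
Proof.
elim: q H => [|q IH] H.
  rewrite mul0n expr0 !scale1r; congr (hoch _ _ _); apply/funext => t.
  by rewrite scale1r.
have -> : (fun s => (-1) ^+ (q.+1 * size s) *: H s) =
    (fun s => (-1) ^+ size s *: ((-1) ^+ (q * size s) *: H s)).
  by apply/funext => t; rewrite mulSn exprD scalerA.
rewrite hoch_sign IH mulSn exprD [in RHS]exprS mulN1r scaleNr !scalerA.
by rewrite mulrCA !mulrA.
Qed.

Lemma hoch_eval (I : Type) (T : lmodType k) (S : hcoef A (I -> T)) (H : seq A -> I -> T) s i :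
  hoch S H s i = (if s is a :: s' then hl S a (H s') i else 0)
    + inner (fun s => H s i) (fun s a => hr S (H s) a i) s.
Proof.
rewrite /hoch fctE; congr (_ + _); first by case: s.
by rewrite /hinner -(inner_nat (psi := fun t : I -> T => t i)).
Qed.

Variables (T : lmodType k) (S : hcoef A T) (I : Type).

Definition hcoef_fun : hcoef A (I -> T).
Proof.
apply: (@HCoef k A (I -> T) (fun a g i => hl S a (g i)) (fun g a i => hr S (g i) a)).
- by move=> a c f g; apply/funext => i; rewrite !fctE (hl_lin S).
- by move=> a c f g; apply/funext => i; rewrite !fctE (hr_lin S).
- by move=> a b g; apply/funext => i; rewrite hlM.
- by move=> g a b; apply/funext => i; rewrite hrM.
- by move=> a g b; apply/funext => i; rewrite hlr.
Defined.

Lemma hoch_fun (H : seq A -> I -> T) s i :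
  hoch hcoef_fun H s i = hoch S (fun s => H s i) s.
Proof. by rewrite (@hoch_nat _ _ hcoef_fun S (fun g => g i)). Qed.

End Naturality.

Record commuting (k : fieldType) (C A : algType k) (T : lmodType k)
    (SC : hcoef C T) (SA : hcoef A T) : Prop := Commuting {
  cm_ll : forall c a t, hl SC c (hl SA a t) = hl SA a (hl SC c t);
  cm_lr : forall c a t, hl SC c (hr SA t a) = hr SA (hl SC c t) a;
  cm_rl : forall c a t, hr SC (hl SA a t) c = hl SA a (hr SC t c);
  cm_rr : forall c a t, hr SC (hr SA t a) c = hr SA (hr SC t c) a }.

(** The coboundary in one word is a linear equivariant operation on the functions of
    that word, so that this is a case of naturality. *)
Lemma hoch_comm (k : fieldType) (C A : algType k) (T : lmodType k)
    (SC : hcoef C T) (SA : hcoef A T) (f : seq C -> seq A -> T) cs as_ :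
  commuting SC SA ->
  hoch SA (fun s => hoch SC (fun t => f t s) cs) as_
  = hoch SC (fun t => hoch SA (f t) as_) cs.
Proof.
move=> cm.
rewrite (@hoch_nat _ _ _ _ (hcoef_fun SA (seq C)) SA
  (fun g => hoch SC g cs) (fun s t => f t s) as_).
- by congr (hoch _ _ _); apply/funext => t; rewrite hoch_fun.
- by move=> c u v; rewrite -hoch_lin.
- move=> a g; rewrite -(@hoch_nat _ _ _ _ SC SC (hl SA a)) //.
  + exact: hl_lin.
  + by move=> c t; rewrite (cm_ll cm).
  + by move=> c t; rewrite (cm_rl cm).
- move=> a g; rewrite -(@hoch_nat _ _ _ _ SC SC (fun t => hr SA t a)) //.
  + exact: hr_lin.
  + by move=> c t; rewrite (cm_lr cm).
  + by move=> c t; rewrite (cm_rr cm).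
Qed.

(** * Families of functions on pairs of words *)

Section Grading.
Variables (k : fieldType) (X Y : Type) (T : lmodType k) (deg : X -> Y -> nat).
Let V : lmodType k := X -> Y -> T.

Lemma fct2_sum (J : Type) (r : seq J) (P : pred J) (F : J -> V) x y :
  (\sum_(j <- r | P j) F j) x y = \sum_(j <- r | P j) F j x y.
Proof. by apply: (big_morph (fun f : V => f x y)). Qed.

Lemma independent_support (G : nat -> nat -> submod V) :
  (forall p q f, G p q f -> forall x y, deg x y <> p -> f x y = 0) ->
  independent G.
Proof.
move=> Gs n xs xG sum0 i i_n; apply/funext => x; apply/funext => y.
have [dxy|/eqP dxy] := eqVneq (deg x y) (n - i)%N; last exact: Gs (xG _ i_n) _ _ dxy.
have := congr1 (fun f : V => f x y) sum0; rewrite fct2_sum.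
rewrite (bigD1 (Ordinal (i_n : (i < n.+1)%N))) //= big1 => [|j ji]; first by rewrite addr0.
apply: (Gs _ _ _ (xG j (ltn_ord j))) => dj; move/negP: ji; apply.
apply/eqP/val_inj; rewrite /= -(subKn (ltn_ord j : j <= n)%N) -dj dxy subKn //.
Qed.

Definition restrict_deg (f : V) p : V := fun x y => if deg x y == p then f x y else 0.

Lemma total_restrict (G : nat -> nat -> submod V) n f :
  (forall i, (i <= n)%N -> G (n - i)%N i (restrict_deg f (n - i)%N)) ->
  (forall x y, (n < deg x y)%N -> f x y = 0) -> total_space G n f.
Proof.
move=> Gf f0; exists (fun i => if (i <= n)%N then restrict_deg f (n - i)%N else 0).
  by split=> i; [move=> i_n; rewrite i_n; exact: Gf | rewrite ltnNge; case: leqP].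
apply/funext => x; apply/funext => y; rewrite fct2_sum.
have [dn|nd] := leqP (deg x y) n; last first.
  rewrite f0 // big1 // => i _; rewrite -ltnS ltn_ord /restrict_deg.
  by case: eqP => // _; exact: f0.
have d_n : (n - deg x y < n.+1)%N by rewrite ltnS leq_subr.
rewrite (bigD1 (Ordinal d_n)) //= leq_subr /restrict_deg subKn // eqxx.
rewrite big1 ?addr0 // => j jd; rewrite -ltnS ltn_ord; case: eqP => // dj.
by move/negP: jd; case; apply/eqP/val_inj; rewrite /= dj subKn // -ltnS.
Qed.

End Grading.

(** * The two-sided Hochschild complex *)

Section TwoSided.
Variables (k : fieldType) (C A : algType k) (T : lmodType k).
Variables (SC : hcoef C T) (SA : hcoef A T).
Hypothesis cm : commuting SC SA.

Let V : lmodType k := seq C -> seq A -> T.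
Implicit Types (f : V) (D : nat -> nat -> bool) (Th : submod T).

Definition cochains_pred D Th f : Prop :=
  [/\ forall as_, seq_multilinear (fun cs => f cs as_),
      forall cs, seq_multilinear (f cs),
      forall cs as_, ~~ D (size cs) (size as_) -> f cs as_ = 0
    & forall cs as_, Th (f cs as_)].

Fact cochains_0 D Th : cochains_pred D Th 0.
Proof.
by split=> [as_ s1 s2 c u v|cs s1 s2 c u v||cs as_]; rewrite ?scaler0 ?addr0 //; exact: sm_0.
Qed.

Fact cochains_lin D Th (c : k) f g :
  cochains_pred D Th f -> cochains_pred D Th g -> cochains_pred D Th (c *: f + g).
Proof.
move=> [f1 f2 f3 f4] [g1 g2 g3 g4]; split.
- by move=> as_ s1 s2; apply: linear_lin; [exact: f1 | exact: g1].
- by move=> cs s1 s2; apply: linear_lin; [exact: f2 | exact: g2].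
- by move=> cs as_ nD; rewrite !fctE f3 // g3 // scaler0 addr0.
- by move=> cs as_; apply: sm_lin; [exact: f4 | exact: g4].
Qed.

Definition cochains D Th : submod V := Submod (cochains_0 D Th) (@cochains_lin D Th).

Lemma cochains_weaken D D' Th f :
  (forall p q, D p q -> D' p q) -> cochains D Th f -> cochains D' Th f.
Proof.
move=> DD [f1 f2 f3 f4]; split=> // cs as_ nD'; apply: f3.
by apply: contra nD' => /DD.
Qed.

Lemma cochains_restrict D D' Th (P : nat -> nat -> bool) f :
  (forall p q, D p q -> P p q -> D' p q) -> cochains D Th f ->
  cochains D' Th (fun cs as_ => if P (size cs) (size as_) then f cs as_ else 0).
Proof.
move=> DP [f1 f2 f3 f4]; split.
- move=> as_ s1 s2 c u v; rewrite !size_cat /=; case: ifP => _; first exact: f1.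
  by rewrite scaler0 addr0.
- move=> cs s1 s2 c u v; rewrite !size_cat /=; case: ifP => _; first exact: f2.
  by rewrite scaler0 addr0.
- move=> cs as_ nD'; case: ifP => // pP; apply: f3.
  by apply: contra nD' => pD; exact: DP.
- by move=> cs as_; case: ifP => // _; exact: sm_0.
Qed.

Definition dC f : V := fun cs as_ => hoch SC (fun s => f s as_) cs.
(** The sign makes the coboundaries in the two words anticommute. *)
Definition dA f : V := fun cs as_ => (-1) ^+ size cs *: hoch SA (f cs) as_.

Lemma dC_lin : linear dC.
Proof.
move=> c f g; apply/funext => cs; apply/funext => as_.
by rewrite /dC !fctE -hoch_lin.
Qed.

Lemma dA_lin : linear dA.
Proof.
move=> c f g; apply/funext => cs; apply/funext => as_.
rewrite /dA !fctE [hoch _ _ _]hoch_lin scalerDr !scalerA; congr (_ *: _ + _).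
exact: mulrC.
Qed.

Lemma dC_dC f : dC (dC f) = 0.
Proof. by apply/funext => cs; apply/funext => as_; exact: hoch_hoch. Qed.

Lemma dA_dA f : dA (dA f) = 0.
Proof.
apply/funext => cs; apply/funext => as_; rewrite /dA.
by rewrite hochZ hoch_hoch !scaler0.
Qed.

Lemma dA_dC f : dA (dC f) + dC (dA f) = 0.
Proof.
apply/funext => cs; apply/funext => as_; rewrite !fctE /dA /dC.
rewrite (hoch_sign SC (fun t => hoch SA (f t) as_)).
by rewrite -(hoch_comm f cs as_ cm) subrr.
Qed.

Section Stable.
Variable Th : submod T.
Hypotheses (admC : admissible SC Th) (admA : admissible SA Th).

Lemma dC_cochains D D' f : cochains D Th f ->
  (forall p q, D p q -> D' p.+1 q) -> cochains D' Th (dC f).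
Proof.
move=> [f1 f2 f3 f4] DD; split.
- by move=> as_; apply: hoch_multilinear => //.
- move=> cs s1 s2 c u v; rewrite /dC.
  by rewrite -hoch_lin; congr (hoch _ _ _); apply/funext => t; exact: f2.
- case=> [|c cs] as_ nD; first exact: hoch_nil.
  apply: (@hoch_support _ _ _ _ (fun p => D p (size as_))) => [t|].
    exact: f3.
  by apply: contra nD => /DD.
- by move=> cs as_; apply: hoch_in.
Qed.

Lemma dA_cochains D D' f : cochains D Th f ->
  (forall p q, D p q -> D' p q.+1) -> cochains D' Th (dA f).
Proof.
move=> [f1 f2 f3 f4] DD; split.
- move=> as_ s1 s2 c u v; rewrite /dA !size_cat /=.
  rewrite !scalerA [c * _]mulrC -scalerA -scalerDr -hoch_lin; congr (_ *: hoch _ _ _).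
  by apply/funext => t; exact: f1.
- move=> cs s1 s2 c u v; rewrite /dA (hoch_multilinear admA (f2 cs)) //.
  by rewrite scalerDr !scalerA [c * _]mulrC.
- move=> cs [|a as_] nD; rewrite /dA; first by rewrite hoch_nil scaler0.
  rewrite (@hoch_support _ _ _ _ (fun q => D (size cs) q)) ?scaler0 // => [t|].
    exact: f3.
  by apply: contra nD => /DD.
- by move=> cs as_; apply: submodZ; apply: hoch_in.
Qed.

End Stable.
End TwoSided.

(** * Exactness of the two-sided complex *)

Definition sumdeg (n p q : nat) : bool := (p + q == n)%N.
Definition bideg (p q p' q' : nat) : bool := (p' == p) && (q' == q).

Section TwoSidedExact.
Variables (k : fieldType) (C A : algType k) (T : lmodType k).
Variables (SC : hcoef C T) (SA : hcoef A T).
Hypothesis cm : commuting SC SA.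
Variable Th : submod T.
Hypotheses (admC : admissible SC Th) (admA : admissible SA Th).

Definition dW (f : seq C -> seq A -> T) : seq C -> seq A -> T := dtot (dA SA) (dC SC) f.

(** The first degree counts the letters of [A]: the letters of [C], counted by the
    second, are those along which the total complex is to be reduced. *)
Definition bicochains p q := cochains C A (bideg q p) Th.

Lemma dA_bicochains p q f : bicochains p q f -> bicochains p.+1 q (dA SA f).
Proof.
move=> Gf; apply: (dA_cochains admA Gf) => p' q' /andP[/eqP-> /eqP->].
by rewrite /bideg !eqxx.
Qed.

Lemma dC_bicochains p q f : bicochains p q f -> bicochains p q.+1 (dC SC f).
Proof.
move=> Gf; apply: (dC_cochains admC Gf) => p' q' /andP[/eqP-> /eqP->].
by rewrite /bideg !eqxx.
Qed.

Lemma dW_cochains n f : cochains C A (sumdeg n) Th f -> cochains C A (sumdeg n.+1) Th (dW f).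
Proof.
move=> Kf; apply: submodD.
  by apply: (dA_cochains admA Kf) => p q /eqP <-; rewrite /sumdeg addnS.
by apply: (dC_cochains admC Kf) => p q /eqP <-; rewrite /sumdeg addSn.
Qed.

Lemma dW_lin : linear dW.
Proof. exact: dtot_lin (dA_lin SA) (dC_lin SC). Qed.

Lemma dW_dW f : dW (dW f) = 0.
Proof.
rewrite /dW /dtot (lin_add (dA_lin SA)) (lin_add (dC_lin SC)).
by rewrite dA_dA dC_dC add0r addr0 dA_dC.
Qed.

Lemma bicochains_independent : independent bicochains.
Proof.
apply: (independent_support (deg := fun _ as_ => size as_)) => p q f [_ _ f0 _] cs as_ sp.
by apply: f0; rewrite /bideg negb_and orbC; case: eqP sp.
Qed.

Lemma cochains_total n f : cochains C A (sumdeg n) Th f -> total_space bicochains n f.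
Proof.
move=> Kf; apply: (total_restrict (deg := fun _ as_ => size as_)) => [i i_n|cs as_ ns].
  apply: (cochains_restrict (P := fun _ q => q == (n - i)%N) _ Kf) => p q pq /eqP qE.
  rewrite /bideg qE eqxx andbT -(eqn_add2r (n - i)) subnKC //.
  by move: pq; rewrite /sumdeg qE.
have [_ _ f0 _] := Kf; apply: f0; rewrite /sumdeg gtn_eqF //.
by apply: leq_trans ns _; exact: leq_addl.
Qed.

Lemma total_cochains n f : total_space bicochains n f -> cochains C A (sumdeg n) Th f.
Proof.
move=> [xs [xG _] ->]; apply: submod_sum => i _.
have i_n : (i <= n)%N by rewrite -ltnS.
apply: cochains_weaken (xG i i_n) => p q /andP[/eqP-> /eqP->].
by rewrite /sumdeg subnKC.
Qed.

Section Left.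
Variable eC : (C -> T) -> T.
Hypothesis eCP : left_section SC Th eC.

Lemma left_rows p q f : bicochains p q.+1 f -> dC SC f = 0 ->
  exists2 g, bicochains p q g & dC SC g = f.
Proof.
move=> [f1 f2 f3 f4] df.
exists (fun cs as_ => (-1) ^+ (size cs).+1 *: eC (fun c => f (rcons cs c) as_)).
  split.
  - move=> as_ s1 s2 c u v; rewrite !size_cat /= scalerA [c * _]mulrC -scalerA -scalerDr.
    rewrite -(ls_lin eCP); congr (_ *: eC _); apply/funext => b.
    by rewrite !fctE !rcons_cat !rcons_cons f1.
  - move=> cs s1 s2 c u v; rewrite scalerA [c * _]mulrC -scalerA -scalerDr.
    rewrite -(ls_lin eCP); congr (_ *: eC _); apply/funext => b.
    by rewrite f2.
  - move=> cs as_ nD; rewrite (_ : (fun c => _) = 0); last first.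
      apply/funext => c; apply: f3; rewrite size_rcons; apply: contra nD.
      by rewrite /bideg eqSS.
    by rewrite (lin_0 (ls_lin eCP)) scaler0.
  - move=> cs as_; apply/submodZ/(ls_in eCP); split=> // c u v.
    by have := f1 as_ cs [::] c u v; rewrite !cats1.
apply/funext => cs; apply/funext => as_; rewrite /dC.
apply: (left_contract (H := fun s => f s as_) _ _ _ _ eCP) => // [|s]; first exact: f3.
by have := congr1 (fun g : seq C -> seq A -> T => g s as_) df.
Qed.

(** By the left section the columns with letters of [C] are exact, so a cochain can
    be moved to those without. *)
Lemma left_reduce n f : cochains C A (sumdeg n) Th f ->
  cochains C A (bideg 0 n.+1) Th (dW f) ->
  exists g, [/\ if n is n'.+1 then cochains C A (sumdeg n') Th g else g = 0,
    bicochains n 0 (f - dW g) & dC SC (f - dW g) = 0].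
Proof.
move=> Kf df.
have [g gt Gg] := total_reduce (dA_lin SA) (dC_lin SC) dA_bicochains dC_bicochains
  (fun _ _ f _ => dA_dA SA f) (fun _ _ f _ => dC_dC SC f)
  (fun _ _ f _ => dA_dC cm f) bicochains_independent left_rows (cochains_total Kf) df.
exists g; split=> //; first by case: (n) gt => // n' gt; exact: total_cochains.
apply: (piece_components (dA_lin SA) (dC_lin SC) dA_bicochains dC_bicochains
  bicochains_independent Gg (e := dW f)) => //.
change (dW (f - dW g) = dW f).
by rewrite (lin_sub dW_lin) dW_dW subr0.
Qed.

Section Right.
Variable eA : (A -> T) -> T.
Hypothesis eAP : right_section SA Th eA.
Hypothesis eA_hl : forall Phi c, hl SC c (eA Phi) = eA (fun a => hl SC c (Phi a)).
Hypothesis eA_hr : forall Phi c, admissible_map Th Phi ->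
  hr SC (eA Phi) c = eA (fun a => hr SC (Phi a) c).

(** The letters of [C] are removed first; the contraction given by the right
    section then acts on cochains with values in the functions that are linear
    over [C], as it commutes with the actions of [C]. *)
Lemma cochains_exact n f : cochains C A (sumdeg n.+1) Th f -> dW f = 0 ->
  exists2 g, cochains C A (sumdeg n) Th g & dW g = f.
Proof.
move=> Kf df.
have df0 : cochains C A (bideg 0 n.+2) Th (dW f) by rewrite df; exact: sm_0.
have [g [Kg Gf' dCf']] := left_reduce Kf df0.
set f' := f - dW g in Gf' dCf'.
have dAf' : dA SA f' = 0.
  have : dW f' = 0.
    by rewrite (lin_sub dW_lin) dW_dW subr0.
  by rewrite /dW /dtot dCf' addr0.
have [f1 f2 f3 f4] := Gf'.
have hoch0 s : hoch SA (f' [::]) s = 0.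
  by have := congr1 (fun g : seq C -> seq A -> T => g [::] s) dAf'; rewrite /dA scale1r.
have balanced_f' c s : hl SC c (f' [::] s) = hr SC (f' [::] s) c.
  have := congr1 (fun g : seq C -> seq A -> T => g [:: c] s) dCf'.
  by rewrite /dC /hoch /hinner /= => /eqP; rewrite subr_eq0 => /eqP.
have adm_s s : admissible_map Th (fun a => f' [::] (a :: s)).
  by split=> //; exact: (f2 [::] [::]).
pose h (cs : seq C) (as_ : seq A) :=
  if cs is [::] then eA (fun a => f' [::] (a :: as_)) else 0.
have Gh : bicochains n 0 h.
  split.
  - by move=> as_ [|c s1] s2 d u v; rewrite /= ?scaler0 ?addr0 //.
  - move=> [|c cs] s1 s2 d u v; rewrite /= ?scaler0 ?addr0 //.
    by rewrite -(rs_lin eAP); congr eA; apply/funext => a; rewrite -cat_cons f2.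
  - move=> [|c cs] as_ // nD; rewrite /h (_ : (fun a => _) = 0) ?(lin_0 (rs_lin eAP)) //.
    by apply/funext => a; apply: f3; apply: contra nD; rewrite /bideg /= eqSS.
  - by case=> [|c cs] as_; [exact: (rs_in eAP) | exact: sm_0].
have dAh : dA SA h = f'.
  apply/funext => -[|c cs]; apply/funext => as_; rewrite /dA /=.
    rewrite scale1r; apply: (right_contract (H := f' [::]) _ _ _ _ eAP) => //.
    exact: f3.
  rewrite f3 //; have -> : hoch SA (fun=> 0) as_ = 0.
    exact: (@hoch_support _ _ _ SA pred0).
  by rewrite scaler0.
have dCh : dC SC h = 0.
  apply/funext => -[|c [|c' cs]]; apply/funext => as_; rewrite /dC.
  - exact: hoch_nil.
  - rewrite /hoch /hinner /= eA_hl eA_hr // -(lin_sub (rs_lin eAP)).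
    rewrite -[RHS](lin_0 (rs_lin eAP)); congr eA; apply/funext => a.
    by rewrite !fctE balanced_f' subrr.
  - by apply: (@hoch_support _ _ _ _ (eq_op^~ 0%N)) => // -[].
exists (g + h).
  apply: submodD => //; apply: cochains_weaken Gh => p q /andP[/eqP-> /eqP->].
  by rewrite /sumdeg add0n.
rewrite (lin_add dW_lin) [dW h]/dtot dAh dCh.
by rewrite addr0 addrC subrK.
Qed.

End Right.
End Left.
End TwoSidedExact.

(** * Hypercohomology: a complex of coefficients *)

Section PostCompose.
Variables (k : fieldType) (C A : algType k) (T T' : lmodType k).
Variables (SC : hcoef C T) (SA : hcoef A T) (SC' : hcoef C T') (SA' : hcoef A T').

Record equivariant (psi : T -> T') : Prop := Equivariant {
  eq_lin : linear psi;
  eq_hlC : forall c t, psi (hl SC c t) = hl SC' c (psi t);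
  eq_hrC : forall c t, psi (hr SC t c) = hr SC' (psi t) c;
  eq_hlA : forall a t, psi (hl SA a t) = hl SA' a (psi t);
  eq_hrA : forall a t, psi (hr SA t a) = hr SA' (psi t) a }.

Definition postcomp (psi : T -> T') (f : seq C -> seq A -> T) : seq C -> seq A -> T' :=
  fun cs as_ => psi (f cs as_).

Variable psi : T -> T'.

Lemma postcomp_lin : linear psi -> linear (postcomp psi).
Proof.
by move=> pl c f g; apply/funext => cs; apply/funext => as_; rewrite /postcomp pl.
Qed.

Lemma postcomp_cochains D (Th : submod T) (Th' : submod T') f :
  linear psi -> (forall t, Th t -> Th' (psi t)) ->
  cochains C A D Th f -> cochains C A D Th' (postcomp psi f).
Proof.
move=> pl pT [f1 f2 f3 f4]; split.
- by move=> as_ s1 s2 c u v; rewrite /postcomp f1 pl.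
- by move=> cs s1 s2 c u v; rewrite /postcomp f2 pl.
- by move=> cs as_ nD; rewrite /postcomp f3 // (lin_0 pl).
- by move=> cs as_; exact: pT.
Qed.

Hypothesis pe : equivariant psi.

Lemma dC_postcomp f : dC SC' (postcomp psi f) = postcomp psi (dC SC f).
Proof.
apply/funext => cs; apply/funext => as_.
by apply: hoch_nat; [exact: eq_lin pe | exact: eq_hlC pe | move=> a t; exact: eq_hrC pe _ _].
Qed.

Lemma dA_postcomp f : dA SA' (postcomp psi f) = postcomp psi (dA SA f).
Proof.
apply/funext => cs; apply/funext => as_; rewrite /dA /postcomp (lin_scale (eq_lin pe)).
congr (_ *: _).
by apply: hoch_nat; [exact: eq_lin pe | exact: eq_hlA pe | move=> a t; exact: eq_hrA pe _ _].
Qed.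

Lemma dW_postcomp f : dW SC' SA' (postcomp psi f) = postcomp psi (dW SC SA f).
Proof.
rewrite /dW /dtot dA_postcomp dC_postcomp.
by apply/funext => cs; apply/funext => as_; rewrite /postcomp (lin_add (eq_lin pe)).
Qed.

End PostCompose.

Section Hyper.
Variables (k : fieldType) (C A : algType k) (T : lmodType k).
Variables (SC : hcoef C T) (SA : hcoef A T).
Hypothesis cm : commuting SC SA.
Variable Th : nat -> submod T.
Hypotheses (admC : forall i, admissible SC (Th i)) (admA : forall i, admissible SA (Th i)).
Variable delta : T -> T.
Hypothesis dl : equivariant SC SA SC SA delta.
Hypotheses (deltaT : forall i t, Th i t -> Th i.+1 (delta t))
           (delta2 : forall i t, Th i t -> delta (delta t) = 0).

Let V : lmodType k := seq C -> seq A -> T.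

Definition sgn (f : V) : V := fun cs as_ => (-1) ^+ (size cs + size as_) *: f cs as_.

Lemma sgn_sgn f : sgn (sgn f) = f.
Proof.
apply/funext => cs; apply/funext => as_; rewrite /sgn scalerA -expr2 sqrr_sign.
exact: scale1r.
Qed.

Lemma sgn_lin : linear sgn.
Proof.
move=> c f g; apply/funext => cs; apply/funext => as_.
by rewrite /sgn !fctE scalerDr !scalerA [c * _]mulrC.
Qed.

Lemma sgn_cochains D S f : cochains C A D S f -> cochains C A D S (sgn f).
Proof.
move=> [f1 f2 f3 f4]; split.
- move=> as_ s1 s2 c u v; rewrite /sgn f1 !size_cat /= scalerDr !scalerA.
  by rewrite [c * _]mulrC.
- move=> cs s1 s2 c u v; rewrite /sgn f2 !size_cat /= scalerDr !scalerA.
  by rewrite [c * _]mulrC.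
- by move=> cs as_ nD; rewrite /sgn f3 // scaler0.
- by move=> cs as_; exact: submodZ.
Qed.

Lemma dW_sgn f : dW SC SA (sgn f) = - sgn (dW SC SA f).
Proof.
apply/funext => cs; apply/funext => as_; rewrite /dW /dtot !fctE /sgn.
rewrite scalerDr opprD; congr (_ + _).
  rewrite /dA scalerA.
  have -> : (fun as_ => (-1) ^+ (size cs + size as_) *: f cs as_) =
      (fun as_ => (-1) ^+ size cs *: ((-1) ^+ size as_ *: f cs as_)).
    by apply/funext => s; rewrite exprD scalerA.
  by rewrite hochZ hoch_sign !scalerN !scalerA exprD [in RHS]mulrAC.
rewrite /dC.
have -> : (fun cs => (-1) ^+ (size cs + size as_) *: f cs as_) =
    (fun cs => (-1) ^+ size as_ *: ((-1) ^+ size cs *: f cs as_)).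
  by apply/funext => s; rewrite exprD scalerA mulrC.
by rewrite hochZ (hoch_sign SC (fun s => f s as_)) scalerN scalerA exprD mulrC.
Qed.

(** The sign makes [ddelta] anticommute with the Hochschild coboundary. *)
Definition ddelta (f : V) : V := sgn (postcomp delta f).

Lemma ddelta_lin : linear ddelta.
Proof.
by move=> c f g; rewrite /ddelta (postcomp_lin (eq_lin dl)) sgn_lin.
Qed.

Definition hyper p i := cochains C A (sumdeg p) (Th i).

Lemma dW_hyper p i f : hyper p i f -> hyper p.+1 i (dW SC SA f).
Proof. exact: dW_cochains. Qed.

Lemma ddelta_hyper p i f : hyper p i f -> hyper p i.+1 (ddelta f).
Proof.
move=> Kf; apply: sgn_cochains.
exact: (postcomp_cochains (eq_lin dl) (@deltaT i) Kf).
Qed.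

Lemma ddelta_ddelta p i f : hyper p i f -> ddelta (ddelta f) = 0.
Proof.
move=> [_ _ _ f4]; apply/funext => cs; apply/funext => as_.
by rewrite /ddelta /sgn /postcomp (lin_scale (eq_lin dl)) (delta2 (f4 cs as_)) !scaler0.
Qed.

Lemma dW_ddelta p i f : hyper p i f ->
  dW SC SA (ddelta f) + ddelta (dW SC SA f) = 0.
Proof. by rewrite /ddelta dW_sgn (dW_postcomp dl) addNr. Qed.

Lemma hyper_independent : independent hyper.
Proof.
apply: (independent_support (deg := fun cs as_ => size cs + size as_)%N).
by move=> p q f [_ _ f0 _] cs as_ /eqP sp; exact: f0.
Qed.

Lemma cochains_hyper_total n f :
  (forall as_, seq_multilinear (fun cs => f cs as_)) ->
  (forall cs, seq_multilinear (f cs)) ->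
  (forall cs as_, (n < size cs + size as_)%N -> f cs as_ = 0) ->
  (forall cs as_, (size cs + size as_ <= n)%N ->
     Th (n - (size cs + size as_))%N (f cs as_)) ->
  total_space hyper n f.
Proof.
move=> f1 f2 f3 f4.
apply: (total_restrict (deg := fun cs as_ => size cs + size as_)%N) => // i i_n.
rewrite /restrict_deg; split.
- move=> as_ s1 s2 c u v; rewrite !size_cat /=; case: ifP => _; first exact: f1.
  by rewrite scaler0 addr0.
- move=> cs s1 s2 c u v; rewrite !size_cat /=; case: ifP => _; first exact: f2.
  by rewrite scaler0 addr0.
- by move=> cs as_ /negPf; rewrite /sumdeg => ->.
- move=> cs as_; case: eqP => [E|_]; last exact: sm_0.
  by have := f4 cs as_; rewrite E subKn //; apply; exact: leq_subr.
Qed.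

Section Rows.
Hypothesis delta_exact : forall i t, Th i.+1 t -> delta t = 0 ->
  exists2 u, Th i u & delta u = t.

(** A preimage under [delta] has to be chosen linearly in the letters of the
    words, so it is chosen by a pseudo-inverse of [delta]. *)
Lemma hyper_rows p i f : hyper p i.+1 f -> ddelta f = 0 ->
  exists2 g, hyper p i g & ddelta g = f.
Proof.
move=> Kf df.
have [s [sl sT sd]] := pseudo_inverse (Th i) (eq_lin dl).
exists (postcomp s (sgn f)).
  exact: (postcomp_cochains sl (fun t _ => sT t) (sgn_cochains Kf)).
have [_ _ _ f4] := Kf.
rewrite -[RHS]sgn_sgn /ddelta; congr sgn; apply/funext => cs; apply/funext => as_.
rewrite /postcomp /sgn (lin_scale sl) (lin_scale (eq_lin dl)); congr (_ *: _).
have d0 : delta (f cs as_) = 0.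
  have := congr1 sgn df; rewrite sgn_sgn (lin_0 sgn_lin).
  by move/(congr1 (fun g : V => g cs as_)).
by have [u Tu <-] := delta_exact (f4 cs as_) d0; exact: sd.
Qed.

Lemma hyper_row_iso n :
  linear_iso (cohomology (row_kernel hyper ddelta_lin) (dW_lin SC SA) n)
    (cohomology (total_space hyper) (dtot_lin (dW_lin SC SA) ddelta_lin) n).
Proof.
apply: row_total_iso; [exact: dW_hyper | exact: ddelta_hyper | | exact: ddelta_ddelta
  | exact: dW_ddelta | exact: hyper_independent | exact: hyper_rows].
by move=> p q f _; exact: dW_dW.
Qed.

Section Columns.
Hypothesis columns : forall p i f, hyper p.+1 i f -> dW SC SA f = 0 ->
  exists2 g, hyper p i g & dW SC SA g = f.

Lemma hyper_row_column_iso n :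
  linear_iso (cohomology (row_kernel hyper ddelta_lin) (dW_lin SC SA) n)
    (cohomology (row_kernel (transpose hyper) (dW_lin SC SA)) ddelta_lin n).
Proof.
apply: row_column_iso; [exact: dW_hyper | exact: ddelta_hyper | | exact: ddelta_ddelta
  | exact: dW_ddelta | exact: hyper_independent | exact: hyper_rows | exact: columns].
by move=> p q f _; exact: dW_dW.
Qed.

End Columns.
End Rows.

Section Augmentation.
Variables (T0 : lmodType k) (SC0 : hcoef C T0) (SA0 : hcoef A T0) (Th0 : submod T0).
Variable iota : T0 -> T.
Hypothesis il : equivariant SC0 SA0 SC SA iota.
Hypotheses (iotaT : forall t, Th0 t -> Th 0 (iota t) /\ delta (iota t) = 0)
  (iota_inj : forall t, Th0 t -> iota t = 0 -> t = 0)
  (iota_exact : forall t, Th 0 t -> delta t = 0 -> exists2 u, Th0 u & iota u = t).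

Lemma iota_eq t u : Th0 t -> Th0 u -> iota t = iota u -> t = u.
Proof.
move=> Tt Tu E; apply/eqP; rewrite -subr_eq0; apply/eqP; apply: iota_inj.
  exact: submodB.
by rewrite (lin_sub (eq_lin il)) E subrr.
Qed.

Lemma postcomp_iota_inj D f g : cochains C A D Th0 f -> cochains C A D Th0 g ->
  postcomp iota f = postcomp iota g -> f = g.
Proof.
move=> [_ _ _ f4] [_ _ _ g4] E; apply/funext => cs; apply/funext => as_.
by apply: iota_eq => //; have := congr1 (fun h : V => h cs as_) E.
Qed.

Lemma ddelta_postcomp_iota D f : cochains C A D Th0 f -> ddelta (postcomp iota f) = 0.
Proof.
move=> [_ _ _ f4]; apply/funext => cs; apply/funext => as_.
by rewrite /ddelta /sgn /postcomp (iotaT (f4 cs as_)).2 scaler0.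
Qed.

Lemma row_postcomp_iota p f : cochains C A (sumdeg p) Th0 f ->
  row_kernel hyper ddelta_lin p (postcomp iota f).
Proof.
move=> Kf; split; last exact: ddelta_postcomp_iota Kf.
by apply: postcomp_cochains Kf; [exact: eq_lin il | move=> t /iotaT[]].
Qed.

(** The preimages under [iota] are chosen one by one; they are multilinear because
    [iota] is injective. *)
Lemma row_lift p f : row_kernel hyper ddelta_lin p f ->
  exists2 g, cochains C A (sumdeg p) Th0 g & postcomp iota g = f.
Proof.
move=> [[f1 f2 f3 f4] df].
have d0 cs as_ : delta (f cs as_) = 0.
  have := congr1 sgn df; rewrite sgn_sgn (lin_0 sgn_lin).
  by move/(congr1 (fun g : V => g cs as_)).
have ex cs : exists gc : seq A -> T0, forall as_, Th0 (gc as_) /\ iota (gc as_) = f cs as_.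
  have ex as_ : exists u, Th0 u /\ iota u = f cs as_.
    by have [u Tu uE] := iota_exact (f4 cs as_) (d0 cs as_); exists u.
  by have [gc gcP] := choice ex; exists gc.
have [g gP] := choice ex.
exists g; last by apply/funext => cs; apply/funext => as_; exact: (gP cs as_).2.
split.
- move=> as_ s1 s2 c u v; apply: iota_eq; first exact: (gP _ _).1.
    by apply: sm_lin; exact: (gP _ _).1.
  by rewrite (eq_lin il) !(gP _ _).2 f1.
- move=> cs s1 s2 c u v; apply: iota_eq; first exact: (gP _ _).1.
    by apply: sm_lin; exact: (gP _ _).1.
  by rewrite (eq_lin il) !(gP _ _).2 f2.
- move=> cs as_ nD; apply: iota_inj; first exact: (gP _ _).1.
  by rewrite (gP _ _).2 f3.
- by move=> cs as_; exact: (gP _ _).1.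
Qed.

Hypotheses (admC0 : admissible SC0 Th0) (admA0 : admissible SA0 Th0).

Lemma augmentation_iso n :
  linear_iso (cohomology (fun p => cochains C A (sumdeg p) Th0) (dW_lin SC0 SA0) n)
    (cohomology (row_kernel hyper ddelta_lin) (dW_lin SC SA) n).
Proof.
apply: (@subquo_iso _ _ _ _ _ _ _ (postcomp iota)).
- exact: postcomp_lin (eq_lin il).
- move=> f [Kf df]; split; first exact: row_postcomp_iota.
  by rewrite (dW_postcomp il) df; exact: lin_0 (postcomp_lin (eq_lin il)).
- move=> f _; case: n => [->|n [g Kg ->]]; first exact: lin_0 (postcomp_lin (eq_lin il)).
  by exists (postcomp iota g); [exact: row_postcomp_iota | rewrite (dW_postcomp il)].
- move=> f [Kf df]; case: n Kf => [|n] Kf /=.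
    rewrite -(lin_0 (postcomp_lin (C := C) (A := A) (eq_lin il))).
    by apply: postcomp_iota_inj Kf _; exact: sm_0.
  move=> [g rg fE]; have [h Kh hE] := row_lift rg.
  exists h => //; apply: (postcomp_iota_inj Kf).
    exact: (dW_cochains admC0 admA0).
  by rewrite fE -hE (dW_postcomp il).
- move=> f [rf df]; have [g Kg gE] := row_lift rf.
  exists g; last by rewrite gE subrr; exact: sm_0.
  split=> //; apply: (@postcomp_iota_inj (sumdeg n.+1)).
  + exact: (dW_cochains admC0 admA0).
  + exact: sm_0.
  by rewrite -(dW_postcomp il) gE df; apply/esym/lin_0/postcomp_lin/(eq_lin il).
Qed.

End Augmentation.
End Hyper.

(** * Sections of the actions on a projective bimodule *)

Section TensorFacts.
Variables (k : fieldType) (C B A : algType k) (M : bimod C B) (N : bimod B A).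

Lemma fglift_nat (K : choiceType) (V W : lmodType k) (psi : V -> W) (f : K -> V)
    (u : {freeg K / k}) :
  linear psi -> fglift (fun x => psi (f x)) u = psi (fglift f u).
Proof.
move=> pl.
have addl (U : lmodType k) (g : K -> U) : {morph (fglift g) : v w / v - w}.
  exact: lift_is_additive.
have zl (U : lmodType k) (g : K -> U) : fglift g 0 = 0.
  by have := addl U g 0 0; rewrite !subrr.
elim/freeg_ind_dom0: u => [|a x D _ _ IH]; first by rewrite !zl (lin_0 pl).
have addl' (U : lmodType k) (g : K -> U) v w : fglift g (v + w) = fglift g v + fglift g w.
  by rewrite -[w in LHS]opprK addl -[- w]sub0r addl zl sub0r opprK.
by rewrite !addl' !liftU IH pl.
Qed.

Lemma tensor_lift_nat (V W : lmodType k) (psi : V -> W) (f : M -> N -> V)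
    (t : tensor M N) :
  linear psi -> tensor_lift (fun m n => psi (f m n)) t = psi (tensor_lift f t).
Proof. by move=> pl; rewrite /tensor_lift -fglift_nat. Qed.

Lemma tensor_lift_lin (V : lmodType k) (c : k) (f g : M -> N -> V) (t : tensor M N) :
  tensor_lift (fun m n => c *: f m n + g m n) t
  = c *: tensor_lift f t + tensor_lift g t.
Proof.
have fstl : linear (fun p : V * V => p.1) by [].
have sndl : linear (fun p : V * V => p.2) by [].
have cl : linear (fun p : V * V => c *: p.1 + p.2).
  by move=> d p q /=; rewrite !scalerDr !scalerA [c * d]mulrC addrACA.
pose fg m n := (f m n, g m n).
have <- : (tensor_lift fg t).1 = tensor_lift f t by rewrite -(tensor_lift_nat _ _ fstl).
have <- : (tensor_lift fg t).2 = tensor_lift g t by rewrite -(tensor_lift_nat _ _ sndl).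
by rewrite -(tensor_lift_nat _ _ cl).
Qed.

End TensorFacts.

(** Left [C]-modules are encoded as bimodules over [C] and [k], so that the tensor
    products over [k] below are tensor products of bimodules. *)
Definition left_mod (k : fieldType) (C A : algType k) (M : bimod C A) :
  bimod C (k^o : algType k).
Proof.
apply: (@Bimod k C k^o M (fun c m => lact c m) (fun m a => a *: m)).
- exact: lact_linl.
- exact: lact_linr.
- by move=> a c u v; rewrite scalerDr !scalerA mulrC.
- by move=> m c u v; rewrite scalerDl scalerA.
- exact: lact1.
- by move=> m; rewrite scale1r.
- exact: lactM.
- by move=> m a b; rewrite scalerA mulrC.
- by move=> c m a; rewrite (lin_scale (lact_linr c)).
Defined.

Section FreeCovers.
Variables (k : fieldType) (C A : algType k) (P : bimod C A).

Definition right_free : bimod C A := tensor (left_mod P) (right_mod (regular_bimod A)).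
Definition left_free : bimod C A := tensor (left_mod (regular_bimod C)) (right_mod P).

Definition right_pure (p : P) (a : A) : right_free :=
  @pure k C k^o A (left_mod P) (right_mod (regular_bimod A)) p a.
Definition left_pure (c : C) (p : P) : left_free :=
  @pure k C k^o A (left_mod (regular_bimod C)) (right_mod P) c p.

Lemma bilinear_balanced (M : bimod C (k^o : algType k)) (N : bimod (k^o : algType k) A)
    (V : lmodType k) (f : M -> N -> V) :
  (forall (m : M) (c : k^o), ract m c = (c : k) *: m) ->
  (forall (c : k^o) (n : N), lact c n = (c : k) *: n) ->
  (forall n, linear (fun m => f m n)) -> (forall m, linear (f m)) -> balanced f.
Proof.
move=> rE lE f1 f2; split=> // m b n.
by rewrite rE lE (lin_scale (f1 n)) (lin_scale (f2 m)).
Qed.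

Lemma right_free_balanced (V : lmodType k) (f : P -> A -> V) :
  (forall a, linear (fun m => f m a)) -> (forall m, linear (f m)) ->
  @balanced k C k^o A (left_mod P) (right_mod (regular_bimod A)) V f.
Proof. by move=> f1 f2; apply: bilinear_balanced. Qed.

Lemma left_free_balanced (V : lmodType k) (f : C -> P -> V) :
  (forall m, linear (fun c => f c m)) -> (forall c, linear (f c)) ->
  @balanced k C k^o A (left_mod (regular_bimod C)) (right_mod P) V f.
Proof. by move=> f1 f2; apply: bilinear_balanced. Qed.

Lemma right_ext (V : lmodType k) (f g : right_free -> V) :
  linear f -> linear g -> (forall p a, f (right_pure p a) = g (right_pure p a)) -> f =1 g.
Proof. exact: tensor_ext. Qed.

Lemma left_ext (V : lmodType k) (f g : left_free -> V) :
  linear f -> linear g -> (forall c p, f (left_pure c p) = g (left_pure c p)) -> f =1 g.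
Proof. exact: tensor_ext. Qed.

Section FreeLift.
Variable V : lmodType k.

Definition right_lift (f : P -> A -> V) : right_free -> V :=
  @tensor_lift k C k^o A (left_mod P) (right_mod (regular_bimod A)) V f.
Definition left_lift (f : C -> P -> V) : left_free -> V :=
  @tensor_lift k C k^o A (left_mod (regular_bimod C)) (right_mod P) V f.

Lemma right_lift_linear (f : P -> A -> V) :
  (forall a, linear (fun m => f m a)) -> (forall m, linear (f m)) -> linear (right_lift f).
Proof. by move=> f1 f2; exact/tensor_lift_linear/right_free_balanced. Qed.

Lemma left_lift_linear (f : C -> P -> V) :
  (forall m, linear (fun c => f c m)) -> (forall c, linear (f c)) -> linear (left_lift f).
Proof. by move=> f1 f2; exact/tensor_lift_linear/left_free_balanced. Qed.

Lemma right_lift_pure (f : P -> A -> V) p a :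
  (forall a, linear (fun m => f m a)) -> (forall m, linear (f m)) ->
  right_lift f (right_pure p a) = f p a.
Proof. by move=> f1 f2; exact/tensor_lift_pure/right_free_balanced. Qed.

Lemma left_lift_pure (f : C -> P -> V) c p :
  (forall m, linear (fun c => f c m)) -> (forall c, linear (f c)) ->
  left_lift f (left_pure c p) = f c p.
Proof. by move=> f1 f2; exact/tensor_lift_pure/left_free_balanced. Qed.

End FreeLift.

Definition right_act : right_free -> P := right_lift (fun m a => ract m a).
Definition left_act : left_free -> P := left_lift (fun c m => lact c m).

Lemma right_act_linear : linear right_act.
Proof. by apply: right_lift_linear => *; [exact: ract_linl | exact: ract_linr]. Qed.

Lemma left_act_linear : linear left_act.
Proof. by apply: left_lift_linear => *; [exact: lact_linl | exact: lact_linr]. Qed.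

Lemma right_act_pure p a : right_act (right_pure p a) = ract p a.
Proof. by apply: right_lift_pure => *; [exact: ract_linl | exact: ract_linr]. Qed.

Lemma left_act_pure c p : left_act (left_pure c p) = lact c p.
Proof. by apply: left_lift_pure => *; [exact: lact_linl | exact: lact_linr]. Qed.

Lemma right_act_hom : is_bimod_hom right_act.
Proof.
have rl := right_act_linear; split=> // [c t|t a].
- refine (@right_ext P (fun t : right_free => right_act (lact c t))
    (fun t : right_free => lact c (right_act t)) _ _ _ t).
  + by move=> d u v; rewrite (lact_linr c) rl.
  + by move=> d u v; rewrite rl (lact_linr c).
  + move=> m b; rewrite right_act_pure [lact c (right_pure m b)]tensor_lact_pure.
    by rewrite [LHS]right_act_pure lractA.
- refine (@right_ext P (fun t : right_free => right_act (ract t a))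
    (fun t : right_free => ract (right_act t) a) _ _ _ t).
  + by move=> d u v; rewrite (ract_linl a) rl.
  + by move=> d u v; rewrite rl (ract_linl a).
  + move=> m b; rewrite right_act_pure [ract (right_pure m b) a]tensor_ract_pure.
    by rewrite [LHS]right_act_pure ractM.
Qed.

Lemma left_act_hom : is_bimod_hom left_act.
Proof.
have ll := left_act_linear; split=> // [c t|t a].
- refine (@left_ext P (fun t : left_free => left_act (lact c t))
    (fun t : left_free => lact c (left_act t)) _ _ _ t).
  + by move=> d u v; rewrite (lact_linr c) ll.
  + by move=> d u v; rewrite ll (lact_linr c).
  + move=> b m; rewrite left_act_pure [lact c (left_pure b m)]tensor_lact_pure.
    by rewrite [LHS]left_act_pure lactM.
- refine (@left_ext P (fun t : left_free => left_act (ract t a))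
    (fun t : left_free => ract (left_act t) a) _ _ _ t).
  + by move=> d u v; rewrite (ract_linl a) ll.
  + by move=> d u v; rewrite ll (ract_linl a).
  + move=> b m; rewrite left_act_pure [ract (left_pure b m) a]tensor_ract_pure.
    by rewrite [LHS]left_act_pure lractA.
Qed.

Hypothesis Pproj : projective P.

Lemma right_free_section : exists tau : bimod_hom P right_free,
  forall p, right_act (tau p) = p.
Proof.
apply: (Pproj (g := BimodHom right_act_hom) (bh_id P)) => p.
by exists (right_pure p 1); rewrite /= right_act_pure ract1.
Qed.

Lemma left_free_section : exists tau : bimod_hom P left_free,
  forall p, left_act (tau p) = p.
Proof.
apply: (Pproj (g := BimodHom left_act_hom) (bh_id P)) => p.
by exists (left_pure 1 p); rewrite /= left_act_pure lact1.
Qed.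

End FreeCovers.

(** * Functions as coefficients *)

Section FunctionCoefficients.
Variables (k : fieldType) (C A : algType k).

(** A set with commuting actions; the functions on it are coefficients over both
    algebras.  The examples are a bimodule, a graded bimodule seen as the disjoint
    union of its pieces, and the words of the bar construction of two bimodules. *)
Record biset := BiSet {
  bs_sort :> Type;
  lz : C -> bs_sort -> bs_sort;
  rz : bs_sort -> A -> bs_sort;
  lzM : forall c d z, lz (c * d) z = lz c (lz d z);
  rzM : forall z a b, rz z (a * b) = rz (rz z a) b;
  lrz : forall c z a, rz (lz c z) a = lz c (rz z a) }.

Variables (Z : biset) (N : bimod C A).

Definition fcoefC : hcoef C (Z -> N).
Proof.
apply: (@HCoef k C (Z -> N) (fun c t z => lact c (t z)) (fun t c z => t (lz c z))).
- by move=> a c f g; apply/funext => z; rewrite !fctE (lact_linr a).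
- by [].
- by move=> a b t; apply/funext => z; rewrite lactM.
- by move=> t a b; apply/funext => z; rewrite lzM.
- by [].
Defined.

Definition fcoefA : hcoef A (Z -> N).
Proof.
apply: (@HCoef k A (Z -> N) (fun a t z => t (rz z a)) (fun t a z => ract (t z) a)).
- by [].
- by move=> a c f g; apply/funext => z; rewrite !fctE (ract_linl a).
- by move=> a b t; apply/funext => z; rewrite rzM.
- by move=> t a b; apply/funext => z; rewrite ractM.
- by [].
Defined.

Lemma fcoef_commuting : commuting fcoefC fcoefA.
Proof.
by split=> c a t; apply/funext => z //=; rewrite ?lractA ?lrz.
Qed.

End FunctionCoefficients.

Section LinearMaps.
Variables (k : fieldType) (U V : lmodType k).

Fact klinear_0 : linear (0 : U -> V).
Proof. by move=> c u v; rewrite scaler0 addr0. Qed.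

Fact klinear_lin (c : k) (f g : U -> V) : linear f -> linear g -> linear (c *: f + g).
Proof. exact: linear_lin. Qed.

Definition klinear : submod (U -> V) := Submod klinear_0 klinear_lin.

End LinearMaps.

Section BimodCoefficients.
Variables (k : fieldType) (C A : algType k) (N : bimod C A).

Definition bimod_biset (M : bimod C A) : biset C A :=
  @BiSet k C A M (fun c m => lact c m) (fun m a => ract m a)
    (fun c d m => lactM c d m) (fun m a b => ractM m a b) (fun c m a => lractA c m a).

Section Linear.
Variable M : bimod C A.

Definition linear_functions : submod (bimod_biset M -> N) := klinear M N.

Lemma linear_admissibleC : admissible (fcoefC (bimod_biset M) N) linear_functions.
Proof.
move=> t tl; split=> [a c u v|a c u v|c a b|c a b] /=.
- by rewrite tl (lact_linr a).
- by rewrite (lact_linr a) tl.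
- by apply/funext => z; rewrite !fctE (lact_linl (t z)).
- by apply/funext => z; rewrite !fctE (lact_linl z) tl.
Qed.

Lemma linear_admissibleA : admissible (fcoefA (bimod_biset M) N) linear_functions.
Proof.
move=> t tl; split=> [a c u v|a c u v|c a b|c a b] /=.
- by rewrite (ract_linl a) tl.
- by rewrite tl (ract_linl a).
- by apply/funext => z; rewrite !fctE (ract_linr z) tl.
- by apply/funext => z; rewrite !fctE (ract_linr (t z)).
Qed.

End Linear.

Section Graded.
Variable P : nat -> bimod C A.

(** The disjoint union of the terms: a family of functions on them is a single
    function, and families in different degrees lie in the same space. *)
Definition graded_sort : Type := {i : nat & P i}.
Definition graded_lact (c : C) (z : graded_sort) : graded_sort :=
  existT (fun i => P i) (projT1 z) (lact c (projT2 z)).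
Definition graded_ract (z : graded_sort) (a : A) : graded_sort :=
  existT (fun i => P i) (projT1 z) (ract (projT2 z) a).

Definition graded_biset : biset C A.
Proof.
apply: (@BiSet k C A graded_sort graded_lact graded_ract).
- by move=> c d z; rewrite /graded_lact lactM.
- by move=> z a b; rewrite /graded_ract ractM.
- by move=> c z a; rewrite /graded_lact /graded_ract lractA.
Defined.

Definition in_deg i (u : P i) : graded_biset := existT (fun i => P i) i u.

Definition graded_linear_pred (i : nat) (t : graded_biset -> N) : Prop :=
  (forall j, linear (fun u : P j => t (in_deg u))) /\
  (forall j (u : P j), j != i -> t (in_deg u) = 0).

Fact graded_linear_0 i : graded_linear_pred i 0.
Proof. by split=> // j c u v; rewrite scaler0 addr0. Qed.

Fact graded_linear_lin i (c : k) f g :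
  graded_linear_pred i f -> graded_linear_pred i g -> graded_linear_pred i (c *: f + g).
Proof.
move=> [fl f0] [gl g0]; split=> [j|j u ji].
  by apply: linear_lin; [exact: fl | exact: gl].
by rewrite !fctE f0 // g0 // scaler0 addr0.
Qed.

Definition graded_linear i : submod (graded_biset -> N) :=
  Submod (graded_linear_0 i) (@graded_linear_lin i).

Local Notation SC := (fcoefC graded_biset N).
Local Notation SA := (fcoefA graded_biset N).

Lemma graded_admissibleC i : admissible SC (graded_linear i).
Proof.
move=> t [tl t0]; split=> [a|a|c a b|c a b].
- split=> [j c u v|j u ji] /=; first by rewrite tl (lact_linr a).
  by rewrite t0 // (lin_0 (lact_linr a)).
- split=> [j c u v|j u ji] /=; last exact: t0.
  have := tl j c (lact a u) (lact a v); rewrite -(lact_linr a); exact.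
- by apply/funext => z; rewrite !fctE /= (lact_linl (t z)).
- apply/funext => -[j u]; rewrite !fctE /= -[RHS](tl j).
  by rewrite /graded_lact /= (lact_linl u).
Qed.

Lemma graded_admissibleA i : admissible SA (graded_linear i).
Proof.
move=> t [tl t0]; split=> [a|a|c a b|c a b].
- split=> [j c u v|j u ji] /=; last exact: t0.
  have := tl j c (ract u a) (ract v a); rewrite -(ract_linl a); exact.
- split=> [j c u v|j u ji] /=; first by rewrite tl (ract_linl a).
  by rewrite t0 // (lin_0 (ract_linl a)).
- apply/funext => -[j u]; rewrite !fctE /= -[RHS](tl j).
  by rewrite /graded_ract /= (ract_linr u).
- by apply/funext => z; rewrite !fctE /= (ract_linr (t z)).
Qed.

Section Projective.
Hypothesis Pproj : forall i, projective (P i).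

Lemma graded_right_section i : exists eA : (A -> graded_biset -> N) -> graded_biset -> N,
  [/\ right_section SA (graded_linear i) eA,
      forall Phi c, hl SC c (eA Phi) = eA (fun a => hl SC c (Phi a))
    & forall Phi c, admissible_map (graded_linear i) Phi ->
        hr SC (eA Phi) c = eA (fun a => hr SC (Phi a) c)].
Proof.
have [tau tauP] : exists tau : forall j, bimod_hom (P j) (right_free (P j)),
    forall j p, right_act (tau j p) = p.
  have ex j := right_free_section (@Pproj j).
  by exists (fun j => projT1 (cid (ex j))) => j; exact: projT2 (cid (ex j)).
pose eA (Phi : A -> graded_biset -> N) (z : graded_biset) : N :=
  right_lift (fun u a => Phi a (in_deg u)) (tau (projT1 z) (projT2 z)).
have bil (Phi : A -> graded_biset -> N) j : admissible_map (graded_linear i) Phi ->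
    (forall a, linear (fun u : P j => Phi a (in_deg u))) /\
    (forall u : P j, linear (fun a => Phi a (in_deg u))).
  move=> [Pl PT]; split=> [a|u c a b]; first by have [+ _] := PT a; apply.
  by rewrite Pl.
exists eA; split.
- split.
  + move=> c Phi Psi; apply/funext => z; exact: tensor_lift_lin.
  + move=> Phi Pa; split=> [j c u v|j u ji].
      have [tl _ _] := bh_homP (tau j); have [b1 b2] := bil Phi j Pa.
      by rewrite /eA /= tl (right_lift_linear b1 b2).
    have [b1 b2] := bil Phi j Pa; have [_ PT] := Pa.
    apply: (right_ext (f := right_lift _) (g := fun=> 0)) => [||p a].
    * exact: right_lift_linear.
    * by move=> c x y; rewrite scaler0 addr0.
    * by rewrite right_lift_pure //; have [_ ->] := PT a.
  + move=> t [tl t0]; apply/funext => -[j u]; rewrite /eA /=.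
    have b1 a : linear (fun u : P j => t (in_deg (ract u a))).
      by move=> c x y; rewrite (ract_linl a) tl.
    have b2 (x : P j) : linear (fun a => t (in_deg (ract x a))).
      by move=> c a b; rewrite (ract_linr x) tl.
    rewrite -[in RHS](tauP j u).
    apply: (right_ext (f := right_lift _) (g := fun x => t (in_deg (right_act x)))).
    * exact: right_lift_linear.
    * by move=> c x y; rewrite right_act_linear tl.
    * move=> p a; rewrite right_lift_pure //; congr (t (in_deg _)).
      exact/esym/right_act_pure.
  + move=> Phi b Pa; apply/funext => -[j u]; rewrite /eA /=.
    have [_ _ tr] := bh_homP (tau j); have [b1 b2] := bil Phi j Pa.
    rewrite tr.
    apply: (right_ext (f := fun x => right_lift _ (ract x b)) (g := right_lift _)).
    * by move=> c x y; rewrite (ract_linl b) right_lift_linear.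
    * apply: right_lift_linear => // x c a a'; rewrite mulrDl -scalerAl; exact: b2.
    * move=> p a; rewrite [ract _ _]tensor_ract_pure.
      rewrite [RHS]right_lift_pure //; first exact: (right_lift_pure p (a * b)).
      by move=> x c a' a''; rewrite mulrDl -scalerAl; exact: b2.
  + move=> Phi b; apply/funext => z.
    by rewrite /= /eA -(tensor_lift_nat _ _ (ract_linl b)).
- move=> Phi c; apply/funext => z.
  by rewrite /= /eA -(tensor_lift_nat _ _ (lact_linr c)).
- move=> Phi c Pa; apply/funext => -[j u]; rewrite /eA /=.
  have [_ tL _] := bh_homP (tau j); have [b1 b2] := bil Phi j Pa.
  rewrite tL.
  have b1' a : linear (fun x : P j => Phi a (in_deg (lact c x))).
    by move=> d x y; rewrite (lact_linr c) b1.
  apply: (right_ext (f := fun x => right_lift _ (lact c x)) (g := right_lift _)).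
  + by move=> d x y; rewrite (lact_linr c) right_lift_linear.
  + by apply: right_lift_linear => // x; exact: b2.
  + move=> p a; rewrite [lact _ _]tensor_lact_pure.
    rewrite [RHS]right_lift_pure //; first exact: (right_lift_pure (lact c p) a).
    by move=> x; exact: b2.
Qed.

Lemma graded_left_section i : exists eC : (C -> graded_biset -> N) -> graded_biset -> N,
  left_section SC (graded_linear i) eC.
Proof.
have [tau tauP] : exists tau : forall j, bimod_hom (P j) (left_free (P j)),
    forall j p, left_act (tau j p) = p.
  have ex j := left_free_section (@Pproj j).
  by exists (fun j => projT1 (cid (ex j))) => j; exact: projT2 (cid (ex j)).
pose eC (Phi : C -> graded_biset -> N) (z : graded_biset) : N :=
  left_lift (fun c u => Phi c (in_deg u)) (tau (projT1 z) (projT2 z)).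
have bil (Phi : C -> graded_biset -> N) j : admissible_map (graded_linear i) Phi ->
    (forall u : P j, linear (fun a => Phi a (in_deg u))) /\
    (forall a, linear (fun u : P j => Phi a (in_deg u))).
  move=> [Pl PT]; split=> [u c a b|a]; last by have [+ _] := PT a; apply.
  by rewrite Pl.
exists eC; split.
- move=> c Phi Psi; apply/funext => z; exact: tensor_lift_lin.
- move=> Phi Pa; split=> [j c u v|j u ji].
    have [tl _ _] := bh_homP (tau j); have [b1 b2] := bil Phi j Pa.
    by rewrite /eC /= tl (left_lift_linear b1 b2).
  have [b1 b2] := bil Phi j Pa; have [_ PT] := Pa.
  apply: (left_ext (f := left_lift _) (g := fun=> 0)) => [||a p].
  + exact: left_lift_linear.
  + by move=> c x y; rewrite scaler0 addr0.
  + by rewrite left_lift_pure //; have [_ ->] := PT a.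
- move=> t [tl t0]; apply/funext => -[j u]; rewrite /eC /=.
  have b1 a : linear (fun u : P j => t (in_deg (lact a u))).
    by move=> c x y; rewrite (lact_linr a) tl.
  have b2 (x : P j) : linear (fun a => t (in_deg (lact a x))).
    by move=> c a b; rewrite (lact_linl x) tl.
  rewrite -[in RHS](tauP j u).
  apply: (left_ext (f := left_lift _) (g := fun x => t (in_deg (left_act x)))).
  + exact: left_lift_linear.
  + by move=> c x y; rewrite left_act_linear tl.
  + move=> a p; rewrite left_lift_pure //; congr (t (in_deg _)).
    exact/esym/left_act_pure.
- move=> Phi b Pa; apply/funext => -[j u]; rewrite /eC /=.
  have [_ tL _] := bh_homP (tau j); have [b1 b2] := bil Phi j Pa.
  have b1' (x : P j) : linear (fun a => Phi (b * a) (in_deg x)).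
    by move=> c a a'; rewrite mulrDr -scalerAr; exact: b1.
  rewrite tL.
  apply: (left_ext (f := fun x => left_lift _ (lact b x)) (g := left_lift _)).
  + by move=> c x y; rewrite (lact_linr b) left_lift_linear.
  + by apply: left_lift_linear.
  + move=> a p; rewrite [lact _ _]tensor_lact_pure.
    rewrite [RHS]left_lift_pure //; exact: (left_lift_pure (b * a) p).
- move=> Phi b; apply/funext => z.
  by rewrite /= /eC -(tensor_lift_nat _ _ (lact_linr b)).
Qed.

Lemma graded_columns p i f : hyper C A graded_linear p.+1 i f -> dW SC SA f = 0 ->
  exists2 g, hyper C A graded_linear p i g & dW SC SA g = f.
Proof.
have [eC eCP] := graded_left_section i.
have [eA [eAP eAl eAr]] := graded_right_section i.
exact: (cochains_exact (fcoef_commuting _ _) (graded_admissibleC (i := i))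
  (graded_admissibleA (i := i)) eCP eAP eAl eAr).
Qed.

End Projective.
End Graded.
End BimodCoefficients.

(** * Comparison with Ext *)

Section DegreeZero.
Variables (k : fieldType) (C A : algType k) (T : lmodType k).
Variables (SC : hcoef C T) (SA : hcoef A T) (Th : submod T).
Hypotheses (admC : admissible SC Th) (admA : admissible SA Th).

(** The coboundary of a cochain without letters lives on the words of a single
    letter, which is in [C] or in [A]. *)
Lemma dW_degree0 f : cochains C A (sumdeg 0) Th f ->
  dW SC SA f = 0 <->
  (forall c, hl SC c (f [::] [::]) = hr SC (f [::] [::]) c) /\
  (forall a, hl SA a (f [::] [::]) = hr SA (f [::] [::]) a).
Proof.
move=> Kf; have [_ _ f0 _] := Kf.
have E10 c : dW SC SA f [:: c] [::] = hl SC c (f [::] [::]) - hr SC (f [::] [::]) c.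
  by rewrite /dW /dtot !fctE /dA /dC hoch_nil scaler0 add0r.
have E01 a : dW SC SA f [::] [:: a] = hl SA a (f [::] [::]) - hr SA (f [::] [::]) a.
  by rewrite /dW /dtot !fctE /dA /dC hoch_nil addr0 scale1r.
split=> [df|[fC fA]].
  split=> [c|a]; apply/eqP; rewrite -subr_eq0.
    by rewrite -E10 df.
  by rewrite -E01 df.
have [_ _ d0 _] : cochains C A (sumdeg 1) Th (dW SC SA f) by exact: dW_cochains.
apply/funext => -[|c [|c' cs]]; apply/funext => -[|a [|a' as_]];
  try (by apply: d0); last 1 first.
- by rewrite E10 fC subrr.
- by rewrite E01 fA subrr.
Qed.

End DegreeZero.

Section ExtComparison.
Variables (k : fieldType) (C A : algType k) (M : bimod C A) (P : projres M) (N : bimod C A).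

Local Notation SC := (fcoefC (graded_biset P) N).
Local Notation SA := (fcoefA (graded_biset P) N).
Local Notation SC0 := (fcoefC (bimod_biset M) N).
Local Notation SA0 := (fcoefA (bimod_biset M) N).
Local Notation Th := (graded_linear N P).
Local Notation T := (graded_biset P -> N).

Lemma pr_d_lin n : linear (pr_d P n).
Proof. by have [] := bh_homP (pr_d P n). Qed.

Lemma pr_aug_lin : linear (pr_aug P).
Proof. by have [] := bh_homP (pr_aug P). Qed.

Definition res_delta (t : T) : T := fun z =>
  let: existT i u := z in
  match i return P i -> N with
  | 0 => fun=> 0
  | i'.+1 => fun u => t (in_deg (pr_d P i' u))
  end u.

Definition res_iota (t : bimod_biset M -> N) : T := fun z =>
  let: existT i u := z in
  match i return P i -> N with
  | 0 => fun u => t (pr_aug P u)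
  | _.+1 => fun=> 0
  end u.

Lemma res_delta_equivariant : equivariant SC SA SC SA res_delta.
Proof.
split=> [c f g|c t|c t|a t|a t]; apply/funext => -[[|i] u] //=; rewrite ?fctE /=.
- by rewrite scaler0 addr0.
- by rewrite (lin_0 (lact_linr c)).
- by have [_ dL _] := bh_homP (pr_d P i); rewrite dL.
- by have [_ _ dR] := bh_homP (pr_d P i); rewrite dR.
- by rewrite (lin_0 (ract_linl a)).
Qed.

Lemma res_iota_equivariant : equivariant SC0 SA0 SC SA res_iota.
Proof.
split=> [c f g|c t|c t|a t|a t]; apply/funext => -[[|i] u] //=; rewrite ?fctE /=.
- by rewrite scaler0 addr0.
- by rewrite (lin_0 (lact_linr c)).
- by have [_ dL _] := bh_homP (pr_aug P); rewrite dL.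
- by have [_ _ dR] := bh_homP (pr_aug P); rewrite dR.
- by rewrite (lin_0 (ract_linl a)).
Qed.

Lemma pr_d_d n u : pr_d P n (pr_d P n.+1 u) = 0.
Proof. by apply/pr_exactS; exists u. Qed.

Lemma pr_aug_d u : pr_aug P (pr_d P 0 u) = 0.
Proof. by apply/pr_exact0; exists u. Qed.

Lemma res_delta_graded i t : Th i t -> Th i.+1 (res_delta t).
Proof.
move=> [tl t0]; split=> [[|j] c u v|[|j] u ji] //=.
- by rewrite scaler0 addr0.
- by rewrite pr_d_lin tl.
- exact: t0.
Qed.

Lemma res_delta_delta i t : Th i t -> res_delta (res_delta t) = 0.
Proof.
move=> [tl t0]; apply/funext => -[[|[|j]] u] //=.
by rewrite pr_d_d (lin_0 (tl j)).
Qed.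

Lemma res_delta_exact i t : Th i.+1 t -> res_delta t = 0 ->
  exists2 u, Th i u & res_delta u = t.
Proof.
move=> [tl t0] dt.
have ex j : exists s : P j -> P j.+1, linear s /\
    forall x, pr_d P j (s (pr_d P j x)) = pr_d P j x.
  by have [s sl sd] := linear_pseudo_inverse (pr_d_lin (n := j)); exists s.
have [s sP] : exists s : forall j, P j -> P j.+1, forall j, linear (s j) /\
    forall x, pr_d P j (s j (pr_d P j x)) = pr_d P j x.
  by exists (fun j => projT1 (cid (ex j))) => j; exact: projT2 (cid (ex j)).
exists (fun z => t (in_deg (s (projT1 z) (projT2 z)))).
  split=> [j c u v|j u ji] /=; first by rewrite (sP j).1 tl.
  by apply: t0; rewrite eqSS.
apply/funext => -[[|j] u] /=; first by apply/esym/t0.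
have [ji|ji] := eqVneq j i; last by rewrite !t0 ?eqSS.
apply/eqP; rewrite -subr_eq0 -(lin_sub (tl _)).
have /pr_exactS[w <-] : pr_d P j (s j (pr_d P j u) - u) = 0.
  by rewrite (lin_sub (@pr_d_lin j)) (sP j).2 subrr.
by have := congr1 (fun f : T => f (in_deg w)) dt => /= ->.
Qed.

Lemma res_iotaT t : linear_functions N M t -> Th 0 (res_iota t) /\ res_delta (res_iota t) = 0.
Proof.
move=> tl; split.
  split=> [[|j] c u v|[|j] u ji] //=; last by rewrite scaler0 addr0.
  by rewrite pr_aug_lin tl.
by apply/funext => -[[|[|j]] u] //=; rewrite pr_aug_d (lin_0 tl).
Qed.

Lemma res_iota_inj t : linear_functions N M t -> res_iota t = 0 -> t = 0.
Proof.
move=> _ it; apply/funext => m; have [u <-] := pr_aug_surj P m.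
by have := congr1 (fun f : T => f (in_deg u)) it.
Qed.

Lemma res_iota_exact t : Th 0 t -> res_delta t = 0 ->
  exists2 u, linear_functions N M u & res_iota u = t.
Proof.
move=> [tl t0] dt.
have [s sl sd] := linear_pseudo_inverse pr_aug_lin.
exists (fun m => t (in_deg (s m))); first by move=> c u v; rewrite sl tl.
apply/funext => -[[|j] u] /=; last by apply/esym/t0.
apply/eqP; rewrite -subr_eq0 -(lin_sub (tl _)).
have /pr_exact0[w <-] : pr_aug P (s (pr_aug P u) - u) = 0.
  by rewrite (lin_sub pr_aug_lin) sd subrr.
by have := congr1 (fun f : T => f (in_deg w)) dt => /= ->.
Qed.

Let dl := res_delta_equivariant.
Let column n := row_kernel (transpose (hyper C A Th)) (dW_lin SC SA) n.

Definition column_value n (f : seq C -> seq A -> T) (u : P n) : N := f [::] [::] (in_deg u).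

Lemma column_value_lin n : linear (@column_value n).
Proof. by move=> c f g; apply/funext => u. Qed.

Lemma column_value_hom n f : column n f -> is_bimod_hom (@column_value n f).
Proof.
move=> [Kf df]; have [_ _ _ f4] := Kf.
have [fC fA] := (dW_degree0 (graded_admissibleC (i := n)) (graded_admissibleA (i := n)) Kf).1 df.
split=> [|c m|m a].
- by have [+ _] := f4 [::] [::]; apply.
- by have /= := congr1 (fun t : T => t (in_deg m)) (fC c).
- by have /= := congr1 (fun t : T => t (in_deg m)) (fA a).
Qed.

Lemma column_ext n f g : column n f -> column n g ->
  column_value (n := n) f = column_value g -> f = g.
Proof.
move=> [[_ _ f3 f4] _] [[_ _ g3 g4] _] E; apply/funext => cs; apply/funext => as_.
have [/eqP|nz] := eqVneq (size cs + size as_)%N 0%N; last first.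
  by rewrite f3 ?g3.
rewrite addn_eq0 => /andP[/nilP-> /nilP->]; apply/funext => -[j u].
have [ji|ji] := eqVneq j n.
  by subst j; exact: (congr1 (fun h : P n -> N => h u) E).
have [_ ->] := f4 [::] [::] => //; by have [_ ->] := g4 [::] [::].
Qed.

(** The inverse of [column_value] extends a bimodule map by zero to nonempty words
    and to the other terms of the resolution. *)
Lemma column_of_hom n (g : P n -> N) : is_bimod_hom g ->
  exists2 f, column n f & column_value (n := n) f = g.
Proof.
move=> [gl gL gR].
pose t (z : graded_biset P) : N :=
  let: existT j u := z in
  match j =P n with
  | ReflectT e => g (eq_rect j (fun j => P j) u n e)
  | ReflectF _ => 0
  end.
have tE (u : P n) : t (in_deg u) = g u by rewrite /t /=; case: eqP => // e; rewrite eq_axiomK.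
have t0 j (u : P j) : j != n -> t (in_deg u) = 0 by rewrite /t /=; case: eqP.
have Tt : Th n t.
  split=> // j c u v; have [jn|jn] := eqVneq j n; last by rewrite !t0 // scaler0 addr0.
  by subst j; rewrite !tE gl.
pose f (cs : seq C) (as_ : seq A) : T := if cs is [::] then if as_ is [::] then t else 0 else 0.
have Kf : hyper C A Th 0 n f.
  split.
  - by move=> as_ [|c s1] s2 d u v; rewrite /f /= scaler0 addr0.
  - by move=> [|c cs] [|a s1] s2 d u v; rewrite /f /= scaler0 addr0.
  - by case=> [|c cs] [].
  - by case=> [|c cs] [|a as_] //; exact: sm_0.
exists f; last by apply/funext => u; exact: tE.
split=> //; apply/(dW_degree0 (graded_admissibleC (i := n)) (graded_admissibleA (i := n)) Kf).
split=> [c|a]; apply/funext => -[j u].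
  change (lact c (t (in_deg u)) = t (in_deg (lact c u))).
  have [jn|jn] := eqVneq j n; last by rewrite !t0 // (lin_0 (lact_linr c)).
  by subst j; rewrite !tE gL.
change (t (in_deg (ract u a)) = ract (t (in_deg u)) a).
have [jn|jn] := eqVneq j n; last by rewrite !t0 // (lin_0 (ract_linl a)).
by subst j; rewrite !tE gR.
Qed.

Lemma column_value_ddelta n f (u : P n.+1) :
  column_value (ddelta res_delta f) u = column_value f (pr_d P n u).
Proof. by rewrite /column_value /ddelta /sgn /postcomp /= scale1r. Qed.

Lemma column_ddelta n f : column n f -> column n.+1 (ddelta res_delta f).
Proof.
move=> [Kf df]; split; first exact: (ddelta_hyper dl res_delta_graded Kf).
have := dW_ddelta dl Kf; rewrite df (lin_0 (ddelta_lin dl)) addr0; exact.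
Qed.

Lemma column_ext_iso n :
  linear_iso (cohomology (row_kernel (transpose (hyper C A Th)) (dW_lin SC SA))
    (ddelta_lin dl) n) (Ext P N n).
Proof.
apply: (@subquo_iso _ _ _ _ _ _ _ (@column_value n)).
- exact: column_value_lin.
- move=> f [rf df]; split; first exact: column_value_hom.
  by move=> p; rewrite -column_value_ddelta df.
- move=> f _; case: n => [->|n [g rg ->]] /=; first by [].
  exists (column_value (n := n) g); first exact: column_value_hom.
  by apply/funext => u; exact: column_value_ddelta.
- move=> f [rf df]; case: n rf => [|n] rf /= => [E|[g gh E]].
    by apply: column_ext rf _ E; exact: sm_0.
  have [h rh hE] := column_of_hom gh.
  exists h => //; apply: column_ext rf _ _; first exact: column_ddelta.
  by rewrite E; apply/funext => u; rewrite column_value_ddelta hE.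
- move=> g [gh g0]; have [f rf fE] := column_of_hom gh.
  exists f; last by rewrite fE subrr; exact: sm_0.
  split=> //; apply: (column_ext (column_ddelta rf)); first exact: sm_0.
  by apply/funext => u; rewrite column_value_ddelta fE g0.
Qed.

(** Both sides are edges of the double complex of the Hochschild cochains with values
    in the linear maps from [P] to [N]; its rows are exact because [P] is a
    resolution, its columns because the terms of [P] are projective. *)
Theorem hochschild_ext_iso n :
  linear_iso (cohomology (fun p => cochains C A (sumdeg p) (linear_functions N M))
    (dW_lin SC0 SA0) n) (Ext P N n).
Proof.
have admC i := graded_admissibleC (N := N) (P := P) (i := i).
have admA i := graded_admissibleA (N := N) (P := P) (i := i).
apply: (linear_iso_trans _ (column_ext_iso n)).
apply: (linear_iso_trans (augmentation_iso dl
  res_iota_equivariant res_iotaT res_iota_inj res_iota_exact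
  (linear_admissibleC (M := M)) (linear_admissibleA (M := M)) n)).
apply: hyper_row_column_iso => //.
- exact: fcoef_commuting.
- exact: res_delta_graded.
- exact: res_delta_delta.
- exact: res_delta_exact.
- by move=> p i f; apply: graded_columns; exact: (@pr_proj _ _ _ _ P).
Qed.

End ExtComparison.

(** * The bar construction of two bimodules *)

Section Vanishing.
Variables (k : fieldType).

Lemma subquo_eq0 (V : lmodType k) (Z B : submod V) (z : V) :
  (forall u : subquo Z B, u = 0) -> Z z -> B z.
Proof.
move=> all0 /in_submodP Zz.
have := all0 (quo_proj _ (Subspace Zz)).
rewrite -(linear0 (quo_proj _)) => /quo_projP/in_submodP /=.
by rewrite subr0.
Qed.

Lemma subquo_all0 (V : lmodType k) (Z B : submod V) :
  (forall z, Z z -> B z) -> forall u : subquo Z B, u = 0.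
Proof.
move=> ZB u; case: (quo_proj_surj u) => -[z Zz] ->.
rewrite -(linear0 (quo_proj _)); apply/quo_projP/in_submodP.
by rewrite /= subr0; apply/ZB/in_submodP.
Qed.

Lemma linear_iso_all0 (V W : lmodType k) :
  linear_iso V W -> (forall w : W, w = 0) -> forall v : V, v = 0.
Proof.
move=> [phi phib] W0 v; apply: (bij_inj phib).
by rewrite linear0; exact: W0.
Qed.

End Vanishing.

Section HomModule.
Variables (k : fieldType) (B A : algType k) (N : bimod B A) (V : lmodType k).

Lemma klinearP (f : subspace (klinear N V)) : linear (val f).
Proof. by case: f => f /= /in_submodP. Qed.

Definition mk_klinear (f : N -> V) (fl : linear f) : subspace (klinear N V) :=
  Subspace (introT (in_submodP (klinear N V) f) fl).

Fact klinear_ract_lin (f : subspace (klinear N V)) (b : B) :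
  linear (fun n => val f (lact b n)).
Proof. by move=> c u v; rewrite (lact_linr b) klinearP. Qed.

(** [Hom_k(N, V)] as a right [B]-module. *)
Definition hom_mod : bimod (k^o : algType k) B.
Proof.
apply: (@Bimod k k^o B (subspace (klinear N V)) (fun c f => c *: f)
  (fun f b => mk_klinear (klinear_ract_lin f b))).
- by move=> m c u v; rewrite scalerDl scalerA.
- by move=> c d u v; rewrite scalerDr !scalerA mulrC.
- by move=> a c f g; apply: val_inj; apply/funext.
- move=> f c a b; apply: val_inj; apply/funext => n /=.
  by rewrite (lact_linl n) klinearP.
- by move=> m; rewrite scale1r.
- by move=> f; apply: val_inj; apply/funext => n /=; rewrite lact1.
- by move=> c d m; rewrite scalerA.
- by move=> f a b; apply: val_inj; apply/funext => n /=; rewrite lactM.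
- by move=> c f a; apply: val_inj; apply/funext.
Defined.

(** The adjunction between [Hom] and the tensor product turns the vanishing of
    [Tor] into that of [Ext], as [Hom_k(-, V)] is exact. *)
Lemma ext_hom_mod_eq0 (M : bimod (k^o : algType k) B) (R : projres M) :
  (forall n, (0 < n)%N -> forall u : Tor R N n, u = 0) ->
  forall n (u : Ext R hom_mod n.+1), u = 0.
Proof.
move=> tor0 n; apply: subquo_all0 => /= f [[fl fL fR] fd].
have bf : balanced (fun (r : R n.+1) (m : N) => val (f r : subspace (klinear N V)) m).
  split=> [m c u v|r|r b m]; first by rewrite fl.
    exact: klinearP.
  by rewrite fR.
pose phi := tensor_lift (fun (r : R n.+1) (m : N) => val (f r : subspace (klinear N V)) m).
have phil : linear phi := tensor_lift_linear bf.
have phi_d t : phi (tensor_map (pr_d R n.+1) t) = 0.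
  apply: (tensor_ext (f := fun t => phi (tensor_map (pr_d R n.+1) t)) (g := fun=> 0)).
  - by move=> c u v; rewrite tensor_map_linear phil.
  - by move=> c u v; rewrite scaler0 addr0.
  - by move=> r m; rewrite tensor_map_pure /phi (tensor_lift_pure bf) fd.
have phi_ker t : tensor_map (N := N) (pr_d R n) t = 0 -> phi t = 0.
  move=> dt; have [s <-] := subquo_eq0 (z := t) (tor0 n.+1 isT) dt.
  exact: phi_d.
have [s sl sd] := linear_pseudo_inverse (@tensor_map_linear k k^o B A _ _ N (pr_d R n)).
pose g0 (r : R n) : N -> V := fun m => phi (s (pure r m)).
have g0l r : linear (g0 r) by move=> c u v; rewrite /g0 pure_linr sl phil.
pose g (r : R n) : hom_mod := mk_klinear (g0l r).
exists g.
  split=> [c u v|c r|r b]; apply: val_inj; apply/funext => m.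
  - by rewrite /= /g0 pure_linl sl phil.
  - rewrite /= /g0.
    have -> : pure (lact c r) m = c *: (pure r m : tensor _ _).
      rewrite -tensor_lact_pure -[c in LHS]mulr1.
      rewrite [LHS](lin_scale (tensor_lact_linl (pure r m)) c 1).
      by rewrite tensor_lact1.
    by rewrite (lin_scale sl) (lin_scale phil).
  - by rewrite /= /g0 pure_bal.
apply/funext => r; apply: val_inj; apply/funext => m; rewrite /= /g0.
rewrite -(tensor_map_pure (pr_d R n)) -[LHS](tensor_lift_pure bf r m) -/phi.
apply/eqP; rewrite -subr_eq0 -(lin_sub phil); apply/eqP/phi_ker.
by rewrite (lin_sub (tensor_map_linear _)) sd subrr.
Qed.

End HomModule.

Section Bar.
Variables (k : fieldType) (C B A : algType k) (M2 : bimod C B) (M1 : bimod B A).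

Definition bar_sort : Type := (M2 * seq B * M1)%type.

Definition bar_biset : biset C A.
Proof.
apply: (@BiSet k C A bar_sort (fun c z => (lact c z.1.1, z.1.2, z.2))
  (fun z a => (z.1.1, z.1.2, ract z.2 a))).
- by move=> c d z; rewrite lactM.
- by move=> z a b; rewrite ractM.
- by [].
Defined.

Section BarFunctions.
Variable V : lmodType k.

Definition bar_linear_pred q (t : bar_biset -> V) : Prop :=
  [/\ forall bs m1, linear (fun m2 => t (m2, bs, m1)),
      forall m2 m1, seq_multilinear (fun bs => t (m2, bs, m1)),
      forall m2 bs, linear (fun m1 => t (m2, bs, m1))
    & forall m2 bs m1, size bs != q -> t (m2, bs, m1) = 0].

Fact bar_linear_0 q : bar_linear_pred q 0.
Proof.
by split=> [bs m1 c u v|m2 m1 s1 s2 c u v|m2 bs c u v|] //; rewrite scaler0 addr0.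
Qed.

Fact bar_linear_lin q (c : k) f g :
  bar_linear_pred q f -> bar_linear_pred q g -> bar_linear_pred q (c *: f + g).
Proof.
move=> [f1 f2 f3 f4] [g1 g2 g3 g4]; split.
- by move=> bs m1; apply: linear_lin; [exact: f1 | exact: g1].
- by move=> m2 m1 s1 s2; apply: linear_lin; [exact: f2 | exact: g2].
- by move=> m2 bs; apply: linear_lin; [exact: f3 | exact: g3].
- by move=> m2 bs m1 sq; rewrite !fctE f4 // g4 // scaler0 addr0.
Qed.

Definition bar_linear q : submod (bar_biset -> V) :=
  Submod (bar_linear_0 q) (@bar_linear_lin q).

(** The Hochschild complex of [B] with these coefficients is the [V]-dual of the bar
    complex of [M2] and [M1]. *)
Definition bar_coef : hcoef B (M2 * M1 -> V).
Proof.
by apply: (@HCoef k B (M2 * M1 -> V) (fun b t z => t (ract z.1 b, z.2))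
  (fun t b z => t (z.1, lact b z.2))) => //;
  move=> *; apply/funext => z; rewrite ?ractM ?lactM.
Defined.

Definition bar_curry (t : bar_biset -> V) (bs : seq B) : M2 * M1 -> V :=
  fun z => t (z.1, bs, z.2).

(** The sign is that of a total complex: the words of [B] come after an arrow. *)
Definition bar_delta (t : bar_biset -> V) : bar_biset -> V :=
  fun z => - hoch bar_coef (bar_curry t) z.1.2 (z.1.1, z.2).

Definition bar_linear_pairs_pred (t : M2 * M1 -> V) : Prop :=
  (forall m1, linear (fun m2 => t (m2, m1))) /\ (forall m2, linear (fun m1 => t (m2, m1))).

Fact bar_linear_pairs_0 : bar_linear_pairs_pred 0.
Proof. by split=> ? c u v; rewrite scaler0 addr0. Qed.

Fact bar_linear_pairs_lin (c : k) f g :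
  bar_linear_pairs_pred f -> bar_linear_pairs_pred g -> bar_linear_pairs_pred (c *: f + g).
Proof.
move=> [f1 f2] [g1 g2]; split=> m.
  by apply: linear_lin; [exact: f1 | exact: g1].
by apply: linear_lin; [exact: f2 | exact: g2].
Qed.

Definition bar_linear_pairs : submod (M2 * M1 -> V) :=
  Submod bar_linear_pairs_0 bar_linear_pairs_lin.

Lemma bar_admissible : admissible bar_coef bar_linear_pairs.
Proof.
move=> t [t1 t2]; split=> [b|b|c a b|c a b].
- by split=> [m1 c u v|m2] /=; [rewrite (ract_linl b) t1 | exact: t2].
- by split=> [m1|m2 c u v] /=; [exact: t1 | rewrite (lact_linr b) t2].
- by apply/funext => z; rewrite /= (ract_linr z.1) t1.
- by apply/funext => z; rewrite /= (lact_linl z.2) t2.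
Qed.

Lemma bar_curry_in q t bs : bar_linear q t -> bar_linear_pairs (bar_curry t bs).
Proof. by move=> [t1 _ t3 _]; split=> m; [exact: t1 | exact: t3]. Qed.

Lemma bar_curry_multilinear q t : bar_linear q t -> seq_multilinear (bar_curry t).
Proof.
move=> [_ t2 _ _] s1 s2 c u v; apply/funext => z.
by rewrite /bar_curry t2.
Qed.

Lemma bar_delta_lin : linear bar_delta.
Proof.
move=> c f g; apply/funext => z; rewrite /bar_delta !fctE scalerN -opprD; congr (- _).
have -> : bar_curry (c *: f + g) = (fun s => c *: bar_curry f s + bar_curry g s) by [].
by rewrite hoch_lin.
Qed.

Lemma bar_delta_linear q t : bar_linear q t -> bar_linear q.+1 (bar_delta t).
Proof.
move=> Tt; have Tp s := hoch_in bar_admissible s (fun s => bar_curry_in s Tt).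
split.
- move=> bs m1 c u v; have [h1 _] := Tp bs.
  by rewrite /bar_delta /= h1 opprD scalerN.
- move=> m2 m1 s1 s2 c u v; rewrite /bar_delta /=.
  have := hoch_multilinear bar_admissible (bar_curry_multilinear Tt)
    (fun s => bar_curry_in s Tt) s1 s2 c u v.
  by move=> ->; rewrite !fctE opprD scalerN.
- move=> m2 bs c u v; have [_ h2] := Tp bs.
  by rewrite /bar_delta /= h2 opprD scalerN.
- move=> m2 bs m1 sq; rewrite /bar_delta /=.
  have [_ _ _ t4] := Tt.
  case: bs sq => [|b bs] sq; first by rewrite hoch_nil oppr0.
  rewrite (@hoch_support _ _ _ _ (fun n => n == q)) ?oppr0 // => s sqs.
  by apply/funext => z; exact: t4.
Qed.

Lemma bar_delta_delta t : bar_delta (bar_delta t) = 0.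
Proof.
apply/funext => z; rewrite /bar_delta.
have -> : bar_curry (bar_delta t) = (fun s => - 1 *: hoch bar_coef (bar_curry t) s).
  apply/funext => s; apply/funext => -[m2 m1].
  by rewrite /bar_curry /bar_delta scaleN1r.
by rewrite hochZ hoch_hoch scaler0 oppr0.
Qed.

(** Extended by zero to nonempty words in [k], a cocycle of the dual bar complex is a
    cocycle of the two-sided complex of [k], [B] and the right module [M2], with
    values in [hom_mod].  There it has a primitive, as the cohomology is an [Ext] that
    vanishes; [left_reduce] makes the primitive vanish on nonempty words in [k]. *)
Lemma bar_exact (R : projres (right_mod M2)) q t :
  (forall n, (0 < n)%N -> forall u : Tor R M1 n, u = 0) ->
  bar_linear q.+1 t -> bar_delta t = 0 ->
  exists2 s, bar_linear q s & bar_delta s = t.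
Proof.
move=> tor0 Tt dt; have [t1 t2 t3 t4] := Tt.
pose N' := hom_mod M1 V.
pose Z' := bimod_biset (right_mod M2).
pose SC := fcoefC Z' N'; pose SA := fcoefA Z' N'; pose Th := linear_functions N' (right_mod M2).
have cm : commuting SC SA by exact: fcoef_commuting.
have admC : admissible SC Th by exact: linear_admissibleC.
have admA : admissible SA Th by exact: linear_admissibleA.
pose ev (g : Z' -> N') : M2 * M1 -> V := fun z => val (g z.1 : subspace (klinear M1 V)) z.2.
have ev_hoch H s : hoch bar_coef (fun s => ev (H s)) s = ev (hoch SA H s).
  by apply: hoch_nat.
have ev_inj : injective ev.
  move=> g h E; apply/funext => m2; apply: val_inj; apply/funext => m1.
  exact: (congr1 (fun f : M2 * M1 -> V => f (m2, m1)) E).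
pose f (cs : seq (k^o)) (bs : seq B) : Z' -> N' :=
  if cs is [::] then fun m2 => mk_klinear (t3 m2 bs) else 0.
have evf bs : ev (f [::] bs) = bar_curry t bs by [].
have Gf : cochains k^o B (bideg 0 q.+1) Th f.
  split.
  - by move=> bs [|c cs] s2 d u v; rewrite /f /= scaler0 addr0.
  - move=> [|c cs] s1 s2 d u v; last by rewrite /f scaler0 addr0.
    apply: ev_inj; rewrite evf (bar_curry_multilinear Tt).
    by apply/funext.
  - move=> [|c cs] bs // sq; apply: ev_inj; rewrite evf; apply/funext => z.
    exact: t4.
  - move=> [|c cs] bs; last exact: sm_0.
    by move=> c u v; apply: val_inj; apply/funext => m1 /=; rewrite t1.
have df : dW SC SA f = 0.
  rewrite /dW /dtot.
  have -> : dA SA f = 0.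
    apply/funext => -[|c cs]; apply/funext => bs; rewrite /dA.
      rewrite scale1r; apply: ev_inj; rewrite -ev_hoch.
      apply/funext => -[m2 m1]; apply/eqP; rewrite -oppr_eq0.
      by rewrite -[- _]/(bar_delta t (m2, bs, m1)) dt.
    have -> : hoch SA (f (c :: cs)) bs = 0 by exact: (@hoch_support _ _ _ SA pred0).
    by rewrite scaler0.
  rewrite add0r; apply/funext => -[|c [|c' cs]]; apply/funext => bs; rewrite /dC.
  - exact: hoch_nil.
  - rewrite /hoch /hinner /=; apply/funext => m2; apply: val_inj; apply/funext => m1.
    by rewrite /= !fctE (lin_scale (t1 bs m1)) subrr.
  - by apply: (@hoch_support _ _ _ _ (eq_op^~ 0%N)) => // -[].
have [g Kg dg] : exists2 g, cochains k^o B (sumdeg q) Th g & f = dW SC SA g.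
  apply: (subquo_eq0 (linear_iso_all0 (hochschild_ext_iso R N' q.+1)
    (ext_hom_mod_eq0 tor0 (n := q)))).
  split=> //; apply: cochains_weaken Gf => i j /andP[/eqP-> /eqP->]; exact: eqxx.
(* Over the base field evaluation at 1 is a left section. *)
pose eC (Phi : k^o -> Z' -> N') := Phi 1.
have eCP : left_section SC Th eC.
  split=> //.
  - by move=> Phi [_ PT]; exact: PT.
  - by move=> s Ts; apply/funext => m; congr (s _); exact: scale1r.
  - move=> Phi b [Pl PT]; apply/funext => m; rewrite /eC mulr1.
    have -> : Phi b = (b : k) *: Phi 1.
      by rewrite -(lin_scale Pl); congr Phi; exact/esym/mulr1.
    exact: (lin_scale (PT 1) b m).
have Gdg : cochains k^o B (bideg 0 q.+1) Th (dW SC SA g) by rewrite -dg.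
have [w [_ Gh dCh]] := left_reduce cm admC admA eCP Kg Gdg.
set h := g - dW SC SA w in Gh dCh.
have dAh : dA SA h = f.
  have : dW SC SA h = f by rewrite (lin_sub (dW_lin SC SA)) dW_dW // subr0.
  by rewrite /dW /dtot dCh addr0.
have [_ h2 h3 h4] := Gh; clearbody h.
exists (fun z => - ev (h [::] z.1.2) (z.1.1, z.2)).
  split.
  - move=> bs m1 c u v; rewrite /ev /= h4.
    by rewrite /= opprD scalerN.
  - by move=> m2 m1 s1 s2 c u v; rewrite /ev /= h2 /= opprD scalerN.
  - by move=> m2 bs c u v; rewrite /ev /= klinearP opprD scalerN.
  - by move=> m2 bs m1 sq; rewrite /ev /= h3 ?oppr0 //; rewrite /bideg /= sq.
apply/funext => -[[m2 bs] m1]; rewrite /bar_delta /=.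
have -> : bar_curry (fun z => - ev (h [::] z.1.2) (z.1.1, z.2)) =
    (fun s => - 1 *: ev (h [::] s)).
  by apply/funext => s; apply/funext => -[x y]; rewrite /bar_curry /= scaleN1r.
rewrite hochZ ev_hoch scaleN1r opprK.
have := congr1 (fun F : seq (k^o) -> seq B -> Z' -> N' => ev (F [::] bs) (m2, m1)) dAh.
by rewrite /dA scale1r.
Qed.

End BarFunctions.
End Bar.

(** * Hypercohomology of the bar construction *)

Section BarHyper.
Variables (k : fieldType) (C B A : algType k) (M2 : bimod C B) (M1 : bimod B A).
Variable N : bimod C A.

Local Notation Z := (bar_biset M2 M1).
Local Notation SC := (fcoefC Z N).
Local Notation SA := (fcoefA Z N).
Local Notation SB := (bar_coef M2 M1 N).
Local Notation Th := (bar_linear M2 M1 N).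
Local Notation Mw := (tensor M2 M1).

Lemma bar_admissibleC q : admissible SC (Th q).
Proof.
move=> t [t1 t2 t3 t4]; split=> [c|c|c a b|c a b].
- split=> [bs m1 d u v|m2 m1 s1 s2 d u v|m2 bs d u v|m2 bs m1 sq] /=.
  + by rewrite t1 (lact_linr c).
  + by rewrite t2 (lact_linr c).
  + by rewrite t3 (lact_linr c).
  + by rewrite t4 // (lin_0 (lact_linr c)).
- split=> [bs m1 d u v|m2 m1|m2 bs|m2 bs m1 sq] /=.
  + by rewrite (lact_linr c) t1.
  + exact: t2.
  + exact: t3.
  + exact: t4.
- by apply/funext => z; rewrite /= (lact_linl (t z)).
- by apply/funext => z; rewrite /= (lact_linl z.1.1) t1.
Qed.

Lemma bar_admissibleA q : admissible SA (Th q).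
Proof.
move=> t [t1 t2 t3 t4]; split=> [c|c|c a b|c a b].
- split=> [bs m1|m2 m1|m2 bs d u v|m2 bs m1 sq] /=.
  + exact: t1.
  + exact: t2.
  + by rewrite (ract_linl c) t3.
  + exact: t4.
- split=> [bs m1 d u v|m2 m1 s1 s2 d u v|m2 bs d u v|m2 bs m1 sq] /=.
  + by rewrite t1 (ract_linl c).
  + by rewrite t2 (ract_linl c).
  + by rewrite t3 (ract_linl c).
  + by rewrite t4 // (lin_0 (ract_linl c)).
- by apply/funext => z; rewrite /= (ract_linr z.2) t3.
- by apply/funext => z; rewrite /= (ract_linr (t z)).
Qed.

(** The actions of [C] and [A] on functions of [(m2, bs, m1)] act on the values and on
    [m2] and [m1] only, hence come from operators on the coefficients [bar_coef]. *)
Lemma bar_delta_nat (phi : (M2 * M1 -> N) -> M2 * M1 -> N) (psi : (Z -> N) -> Z -> N) t :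
  linear phi -> (forall b t, phi (hl SB b t) = hl SB b (phi t)) ->
  (forall b t, phi (hr SB t b) = hr SB (phi t) b) ->
  (forall t bs, bar_curry (psi t) bs = phi (bar_curry t bs)) ->
  bar_delta (psi t) = psi (bar_delta t).
Proof.
move=> pl pL pR pE; apply/funext => -[[m2 bs] m1].
have -> : psi (bar_delta t) (m2, bs, m1) = bar_curry (psi (bar_delta t)) bs (m2, m1) by [].
rewrite pE.
have -> : bar_curry (bar_delta t) bs = - hoch SB (bar_curry t) bs.
  by apply/funext => -[x y].
rewrite (lin_opp _ pl) -(hoch_nat (S := SB) _ _ pl pL) // /bar_delta /=.
by congr (- hoch _ _ _ _); apply/funext => s; rewrite pE.
Qed.

Lemma bar_delta_equivariant : equivariant SC SA SC SA (@bar_delta _ _ _ _ M2 M1 N).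
Proof.
split.
- exact: bar_delta_lin.
- move=> c t; apply: (bar_delta_nat (phi := fun f z => lact c (f z))
    (psi := hl SC c)) => //.
  by move=> d f g; apply/funext => z; rewrite !fctE (lact_linr c).
- move=> c t; apply: (bar_delta_nat (phi := fun f z => f (lact c z.1, z.2))
    (psi := fun t => hr SC t c)) => //.
  by move=> b f; apply/funext => z; rewrite /= lractA.
- move=> a t; apply: (bar_delta_nat (phi := fun f z => f (z.1, ract z.2 a))
    (psi := hl SA a)) => //.
  by move=> b f; apply/funext => z; rewrite /= lractA.
- move=> a t; apply: (bar_delta_nat (phi := fun f z => ract (f z) a)
    (psi := fun t => hr SA t a)) => //.
  by move=> d f g; apply/funext => z; rewrite !fctE (ract_linl a).
Qed.

Definition bar_iota (t : bimod_biset Mw -> N) : Z -> N :=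
  fun z => if z.1.2 is [::] then t (pure z.1.1 z.2) else 0.

Lemma bar_iota_equivariant :
  equivariant (fcoefC (bimod_biset Mw) N) (fcoefA (bimod_biset Mw) N) SC SA bar_iota.
Proof.
split=> [c f g|c t|c t|a t|a t]; apply/funext => -[[m2 [|b bs]] m1] //=; rewrite /bar_iota /=.
- by rewrite !fctE /= scaler0 addr0.
- by rewrite (lin_0 (lact_linr c)).
- by rewrite tensor_lact_pure.
- by rewrite tensor_ract_pure.
- by rewrite (lin_0 (ract_linl a)).
Qed.

Lemma bar_delta_letter (t : Z -> N) (b : B) (m2 : M2) (m1 : M1) :
  bar_delta t (m2, [:: b], m1) = - (t (ract m2 b, [::], m1) - t (m2, [::], lact b m1)).
Proof. by rewrite /bar_delta /hoch /hinner. Qed.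

Lemma bar_iotaT t : linear_functions N Mw t -> Th 0 (bar_iota t) /\ bar_delta (bar_iota t) = 0.
Proof.
move=> tl.
have Ti : Th 0 (bar_iota t).
  split=> [[|b bs] m1 c u v|m2 m1 [|b s1] s2 c u v|m2 [|b bs] c u v|m2 [] //];
    rewrite /bar_iota /= ?scaler0 ?addr0 //.
    by rewrite pure_linl tl.
  by rewrite pure_linr tl.
split=> //; apply/funext => -[[m2 bs] m1].
have [/eqP|bs1] := eqVneq (size bs) 1%N; last first.
  by have [_ _ _ ->] := bar_delta_linear Ti.
case: bs => [|b []] // _; rewrite bar_delta_letter /bar_iota /=.
by rewrite pure_bal subrr oppr0.
Qed.

Lemma bar_iota_inj t : linear_functions N Mw t -> bar_iota t = 0 -> t = 0.
Proof.
move=> tl it; apply/funext; apply: (tensor_ext (g := fun=> 0)) => //.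
  by move=> c u v; rewrite scaler0 addr0.
by move=> m2 m1; have := congr1 (fun f : Z -> N => f (m2, [::], m1)) it.
Qed.

Lemma bar_iota_exact t : Th 0 t -> bar_delta t = 0 ->
  exists2 u, linear_functions N Mw u & bar_iota u = t.
Proof.
move=> [t1 t2 t3 t4] dt.
have bt : balanced (fun (m2 : M2) (m1 : M1) => t (m2, [::], m1)).
  split=> [m1|m2|m2 b m1]; [exact: t1 | exact: t3 |].
  apply/eqP; rewrite -subr_eq0 -oppr_eq0 -bar_delta_letter; apply/eqP.
  exact: (congr1 (fun f : Z -> N => f (m2, [:: b], m1)) dt).
exists (tensor_lift (fun m2 m1 => t (m2, [::], m1))); first exact: tensor_lift_linear.
apply/funext => -[[m2 [|b bs]] m1]; rewrite /bar_iota /=.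
  exact: (tensor_lift_pure bt).
by rewrite t4.
Qed.

(** The functions on the bar complex are a resolution of the linear functions on
    [M2 (x)_B M1]: in degree zero the cocycles are the balanced functions, and in
    positive degrees [bar_exact] applies. *)
Theorem bar_hyper_iso (R : projres (right_mod M2)) (P : projres Mw) n :
  (forall n, (0 < n)%N -> forall u : Tor R M1 n, u = 0) ->
  linear_iso (cohomology (total_space (hyper C A Th))
    (dtot_lin (dW_lin SC SA) (ddelta_lin bar_delta_equivariant)) n) (Ext P N n).
Proof.
move=> tor0.
apply: (linear_iso_trans _ (hochschild_ext_iso P N n)); apply: linear_iso_sym.
apply: (linear_iso_trans (augmentation_iso bar_delta_equivariant bar_iota_equivariant
  bar_iotaT bar_iota_inj bar_iota_exact
  (linear_admissibleC (M := Mw)) (linear_admissibleA (M := Mw)) n)).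
apply: hyper_row_iso.
- exact: fcoef_commuting.
- exact: bar_admissibleC.
- exact: bar_admissibleA.
- by move=> i t; exact: bar_delta_linear.
- by move=> i t _; exact: bar_delta_delta.
- by move=> i t; apply: bar_exact tor0.
Qed.

End BarHyper.

(** * Words over a path *)

Section WordSum.
Variables (k : fieldType) (Q : quiver) (D : qdata k Q) (V : lmodType k).

(** The terms of the coboundary along a path other than the first one. *)
Definition word_sum (x y : Q) (w : qpath x y) (f : word D w -> V)
    (L : word D w -> alg D x -> V) (t : word D w) : V :=
  \sum_(i < (duration t).-1)
      (-1) ^+ i.+1 *: (if contract i t is Some t' then f t' else 0)
  + (-1) ^+ duration t *: (if pop_last t is Some (t', a) then L t' a else 0).

Lemma word_sum_pnil (x : Q) (f : seq (alg D x) -> V) L (s : seq (alg D x)) :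
  word_sum (w := pnil x) f L s = inner f L s.
Proof.
elim: s f L => [|a [|a' s] IH] f L.
- by rewrite /word_sum big_ord0 add0r scaler0.
- by rewrite /word_sum big_ord0 add0r /= expr1 scaleN1r.
rewrite inner_cons2 -IH /word_sum /= big_ord_recl /= /merge_at /= ?drop0.
rewrite expr1 scaleN1r opprD -!addrA; congr (_ + (_ + _)); last first.
  by rewrite exprS mulN1r scaleNr.
rewrite -sumrN; apply: eq_bigr => i _.
by rewrite /bump /= add1n !ltnS exprS mulN1r scaleNr; case: ifP; rewrite ?scaler0.
Qed.

Lemma pop_first_duration0 (x y : Q) (w : qpath x y) (t : word D w) :
  duration t = 0%N -> pop_first t = None.
Proof.
case: w t => [z|x' y' z a w] /=; first by case.
by case=> [[s m] u] /=; rewrite addnS.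
Qed.

(** The contractions of [(s, m, u)] are those within [s] or of [s] with [m], and,
    after the sign of the position of [m], those of [m] with [u] or within [u]. *)
Lemma word_sum_pcons (x y z : Q) (a : arr y z) (w : qpath x y)
    (f : word D (pcons a w) -> V) L (s : seq (alg D z)) (m : bim D a) (u : word D w) :
  word_sum (w := pcons a w) f L (s, m, u)
  = inner (fun s => f (s, m, u)) (fun s c => f (s, lact c m, u)) s
    + (-1) ^+ (size s).+1 *:
      ((if pop_first u is Some (b, u') then f (s, ract m b, u') else 0)
       + word_sum (fun u => f (s, m, u)) (fun u => L (s, m, u)) u).
Proof.
elim: s f L => [|c s IH] f L.
  rewrite add0r expr1 scaleN1r /word_sum /= add0n.
  case du : (duration u) => [|n] /=.
    rewrite (pop_first_duration0 du) !big_ord0 !add0r expr1 expr0 scale1r scaleN1r.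
    by case: (pop_last u) => [[]|].
  rewrite big_ord_recl /= expr1 scaleN1r !opprD -!addrA; congr (_ + (_ + _)).
  - by case: (pop_first u) => [[]|].
  - rewrite -sumrN; apply: eq_bigr => i _.
    rewrite /bump /= add1n subn1 /= exprS mulN1r scaleNr.
    by case: (contract i u).
  - by rewrite exprS mulN1r scaleNr; case: (pop_last u) => [[]|].
have step : word_sum (w := pcons a w) f L (c :: s, m, u) =
    - (if s is c' :: s' then f (c * c' :: s', m, u) else f ([::], lact c m, u))
    - word_sum (w := pcons a w) (fun t => f (c :: t.1.1, t.1.2, t.2))
        (fun t => L (c :: t.1.1, t.1.2, t.2)) (s, m, u).
  rewrite /word_sum /= addSn /= !addnS /= big_ord_recl /= expr1 scaleN1r opprD -!addrA.
  congr (_ + (_ + _)).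
  - by case: s {IH} => [|c' s] //=; rewrite /merge_at /= ?drop0.
  - rewrite -sumrN; apply: eq_bigr => i _.
    rewrite /bump /= add1n !ltnS !eqSS subSS exprS mulN1r scaleNr.
    case: ifP => // _; case: ifP => // _; case: ifP => // _.
      by case: (pop_first u) => [[]|].
    by case: (contract _ u).
  - by rewrite exprS mulN1r scaleNr; case: (pop_last u) => [[]|].
rewrite step IH opprD addrA; congr (_ + _).
  by case: s {IH step} => [|c' s] //=; rewrite oppr0 addr0.
by rewrite /= [in RHS]exprS mulN1r scaleNr.
Qed.

End WordSum.

(** * Paths of length two *)

Section PathOfLengthTwo.
Variables (k : fieldType) (Q : quiver) (D : qdata k Q) (x y z : Q).
Variables (a1 : arr x y) (a2 : arr y z).

Local Notation w := (pcons a2 (pcons a1 (pnil x))).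
Local Notation C := (alg D z).
Local Notation B := (alg D y).
Local Notation A := (alg D x).
Local Notation M2 := (bim D a2).
Local Notation M1 := (bim D a1).
Local Notation N := (coefficients D x z).
Local Notation Z := (bar_biset M2 M1).
Local Notation SC := (fcoefC Z N).
Local Notation SA := (fcoefA Z N).
Local Notation SB := (bar_coef M2 M1 N).
Local Notation Th := (bar_linear M2 M1 N).
Local Notation V := (seq C -> seq A -> Z -> N).

Definition word2 (cs : seq C) (m2 : M2) (bs : seq B) (m1 : M1) (as_ : seq A) : word D w :=
  (cs, m2, (bs, m1, as_)).

(** The sign turns that of the last block, which in the coboundary along the path
    depends on the first two waiting times, into that of the total complex. *)
Definition of_words (f : word D w -> N) : V := fun cs as_ u =>
  (-1) ^+ (size u.1.2 * size as_) *: f (word2 cs u.1.1 u.1.2 u.2 as_).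

Definition to_words (g : V) : word D w -> N := fun t =>
  (-1) ^+ (size t.2.1.1 * size t.2.2) *: g t.1.1 t.2.2 (t.1.2, t.2.1.1, t.2.1.2).

Lemma of_words_lin : linear of_words.
Proof.
move=> c f g; apply/funext => cs; apply/funext => as_; apply/funext => u.
by rewrite /of_words !fctE scalerDr !scalerA [c * _]mulrC.
Qed.

Lemma to_words_lin : linear to_words.
Proof.
move=> c f g; apply/funext => t.
by rewrite /to_words !fctE scalerDr !scalerA [c * _]mulrC.
Qed.

Lemma of_wordsK : cancel of_words to_words.
Proof.
move=> f; apply/funext => -[[cs m2] [[bs m1] as_]].
by rewrite /of_words /to_words /= scalerA -expr2 sqrr_sign scale1r.
Qed.

Lemma to_wordsK : cancel to_words of_words.
Proof.
move=> f; apply/funext => cs; apply/funext => as_; apply/funext => -[[m2 bs] m1].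
by rewrite /of_words /to_words /= scalerA -expr2 sqrr_sign scale1r.
Qed.

Section Coboundary.
Variable f : word D w -> N.
Variables (cs : seq C) (m2 : M2) (bs : seq B) (m1 : M1) (as_ : seq A).

Let partC : N := (if cs is c :: cs' then lact c (f (word2 cs' m2 bs m1 as_)) else 0)
  + inner (fun s => f (word2 s m2 bs m1 as_)) (fun s c => f (word2 s (lact c m2) bs m1 as_)) cs.
Let partB : N := (if bs is b :: bs' then f (word2 cs (ract m2 b) bs' m1 as_) else 0)
  + inner (fun s => f (word2 cs m2 s m1 as_)) (fun s b => f (word2 cs m2 s (lact b m1) as_)) bs.
Let partA : N := (if as_ is a :: as' then f (word2 cs m2 bs (ract m1 a) as') else 0)
  + inner (fun s => f (word2 cs m2 bs m1 s)) (fun s a => ract (f (word2 cs m2 bs m1 s)) a) as_.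

Lemma coboundary_blocks :
  coboundary f (word2 cs m2 bs m1 as_)
  = partC - (-1) ^+ size cs *: partB + (-1) ^+ (size cs + size bs) *: partA.
Proof.
have -> : coboundary f (word2 cs m2 bs m1 as_) =
    (if cs is c :: cs' then lact c (f (word2 cs' m2 bs m1 as_)) else 0) +
    word_sum (w := w) f (fun t a => ract (f t) a) (word2 cs m2 bs m1 as_).
  by rewrite /coboundary /word_sum addrA; case: (cs).
rewrite word_sum_pcons addrA -/partC -[in RHS]addrA; congr (partC + _).
rewrite word_sum_pcons word_sum_pnil.
have -> : (if pop_first ((bs, m1, as_) : word D (pcons a1 (pnil x))) is Some (b, u')
     then f (cs, ract m2 b, u') else 0) =
    (if bs is b :: bs' then f (word2 cs (ract m2 b) bs' m1 as_) else 0).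
  by rewrite /=; case: (bs).
rewrite addrA -/partB.
have -> : (if pop_first (as_ : word D (pnil x)) is Some (b, u')
     then f (cs, m2, (bs, ract m1 b, u')) else 0) =
    (if as_ is a :: as' then f (word2 cs m2 bs (ract m1 a) as') else 0).
  by rewrite /=; case: (as_).
rewrite -/partA scalerDr scalerA -exprD; congr (_ + _ *: _).
  by rewrite exprS mulN1r scaleNr.
by rewrite addSn addnS !exprS !mulN1r opprK.
Qed.

Let u : Z := (m2, bs, m1).
Let sgn2 := (-1) ^+ (size bs * size as_) : k.

Lemma dC_blocks : dC SC (of_words f) cs as_ u = sgn2 *: partC.
Proof.
pose G s (v : Z) := f (word2 s v.1.1 v.1.2 v.2 as_).
transitivity (hoch SC (fun s => sgn2 *: G s) cs u); first by rewrite /dC !hoch_eval.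
by rewrite hochZ fctE hoch_eval.
Qed.

Lemma dA_blocks : dA SA (of_words f) cs as_ u
  = sgn2 *: ((-1) ^+ (size cs + size bs) *: partA).
Proof.
pose G s (v : Z) := f (word2 cs v.1.1 v.1.2 v.2 s).
transitivity ((-1) ^+ size cs *:
    hoch SA (fun s => (-1) ^+ (size bs * size s) *: G s) as_ u).
  by rewrite /dA fctE !hoch_eval.
rewrite hoch_sign_pow !fctE hoch_eval !scalerA exprD -/sgn2.
by rewrite mulrA [sgn2 * _]mulrC.
Qed.

Lemma ddelta_blocks : ddelta (@bar_delta _ _ _ _ M2 M1 N) (of_words f) cs as_ u
  = sgn2 *: (- ((-1) ^+ size cs *: partB)).
Proof.
pose G s (v : M2 * M1) := f (word2 cs v.1 s v.2 as_).
rewrite /ddelta /sgn /postcomp fctE /bar_delta.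
have -> : bar_curry (of_words f cs as_) = fun s => (-1) ^+ (size as_ * size s) *: G s.
  by apply/funext => s; apply/funext => v; rewrite /bar_curry /of_words mulnC.
rewrite hoch_sign_pow !fctE hoch_eval !scalerN !scalerA [(size as_ * _)%N]mulnC -/sgn2.
congr (- (_ *: _)).
by rewrite exprD -[_ * _ * (-1) ^+ size as_]mulrA -expr2 sqrr_sign mulr1 mulrC.
Qed.

Lemma of_words_coboundary_blocks :
  of_words (coboundary f) cs as_ u
  = dtot (dW SC SA) (ddelta (@bar_delta _ _ _ _ M2 M1 N)) (of_words f) cs as_ u.
Proof.
rewrite /dtot !fctE /dW /dtot !fctE dC_blocks dA_blocks ddelta_blocks.
rewrite /of_words /= coboundary_blocks -/sgn2 -!scalerDr; congr (_ *: _).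
by rewrite addrAC [X in X - _]addrC.
Qed.

End Coboundary.

Lemma of_words_coboundary f :
  of_words (coboundary f) = dtot (dW SC SA) (ddelta (@bar_delta _ _ _ _ M2 M1 N)) (of_words f).
Proof.
apply/funext => cs; apply/funext => as_; apply/funext => -[[m2 bs] m1].
exact: of_words_coboundary_blocks.
Qed.

Lemma of_words_cochain r f : cochain (2 + r) f -> total_space (hyper C A Th) r (of_words f).
Proof.
move=> [[f1 f2 f3] f0].
have bs3 cs m2 : [/\ forall m1 as_, seq_multilinear (fun bs => f (word2 cs m2 bs m1 as_)),
    forall bs as_, linear (fun m1 => f (word2 cs m2 bs m1 as_))
  & forall bs m1, seq_multilinear (fun as_ => f (word2 cs m2 bs m1 as_))].
  by have [h1 h2 h3] := f3 cs m2; split=> *; [exact: h1 | exact: h2 | exact: h3].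
have f0' cs m2 bs m1 as_ : (size cs + size as_ + size bs)%N != r ->
    f (word2 cs m2 bs m1 as_) = 0.
  move=> /eqP nr; apply: f0 => /= E; apply: nr.
  by move: E; rewrite !addnS add2n => -[<-]; rewrite addnAC addnA.
apply: cochains_hyper_total.
- move=> as_ s1 s2 c u v; apply/funext => -[[m2 bs] m1]; rewrite /of_words !fctE /=.
  by rewrite (f1 m2 (bs, m1, as_)) scalerDr !scalerA [c * _]mulrC.
- move=> cs s1 s2 c u v; apply/funext => -[[m2 bs] m1]; rewrite /of_words !fctE /=.
  have [_ _ h3] := bs3 cs m2.
  by rewrite h3 !size_cat /= scalerDr !scalerA [c * _]mulrC.
- move=> cs as_ r_lt; apply/funext => -[[m2 bs] m1]; rewrite /of_words /= f0' ?scaler0 //.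
  by rewrite gtn_eqF // (leq_trans r_lt) // leq_addr.
- move=> cs as_ le_r; split=> [bs m1 c u v|m2 m1 s1 s2 c u v|m2 bs c u v|m2 bs m1 sq];
    rewrite /of_words /=.
  + by rewrite (f2 cs (bs, m1, as_)) scalerDr !scalerA [c * _]mulrC.
  + have [h1 _ _] := bs3 cs m2.
    by rewrite h1 !size_cat /= scalerDr !scalerA [c * _]mulrC.
  + have [_ h2 _] := bs3 cs m2.
    by rewrite h2 scalerDr !scalerA [c * _]mulrC.
  + rewrite f0' ?scaler0 //; apply: contra sq => /eqP <-.
    by rewrite addKn.
Qed.

Lemma to_words_hyper p q g : hyper C A Th p q g -> cochain (2 + (p + q)) (to_words g).
Proof.
move=> [g1 g2 g3 g4]; split; last first.
  move=> [[cs m2] [[bs m1] as_]] /= nr; rewrite /to_words /=.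
  have [E|/eqP pE] := eqVneq (size cs + size as_)%N p; last first.
    by rewrite g3 ?scaler0 //; apply/eqP.
  have [_ _ _ t4] := g4 cs as_; rewrite t4 ?scaler0 //.
  apply/eqP => qE; apply: nr; rewrite -E -qE !addnS add2n; congr _.+2.
  by rewrite [LHS]addnA addnAC.
split=> [m2 [[bs m1] as_] s1 s2 c u v|cs [[bs m1] as_] c u v|cs m2]; rewrite /to_words /=.
- by rewrite g1 !fctE scalerDr !scalerA [c * _]mulrC.
- by have [t1 _ _ _] := g4 cs as_; rewrite t1 scalerDr !scalerA [c * _]mulrC.
split=> [m1 as_ s1 s2 c u v|bs as_ c u v|bs m1 s1 s2 c u v] /=.
- have [_ t2 _ _] := g4 cs as_.
  by rewrite t2 !size_cat /= scalerDr !scalerA [c * _]mulrC.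
- have [_ _ t3 _] := g4 cs as_.
  by rewrite t3 scalerDr !scalerA [c * _]mulrC.
- by rewrite g2 !fctE !size_cat /= scalerDr !scalerA [c * _]mulrC.
Qed.

Lemma to_words_cochain r g : total_space (hyper C A Th) r g -> cochain (2 + r) (to_words g).
Proof.
move=> [xs [xG _] ->].
pose K := Submod (@cochain_0 _ _ D _ _ w (2 + r)) (@cochain_lin _ _ D _ _ w (2 + r)).
change (K (to_words (\sum_(i < r.+1) xs i))).
have -> : to_words (\sum_(i < r.+1) xs i) = \sum_(i < r.+1) to_words (xs i).
  by apply: (big_morph to_words); [exact: lin_add to_words_lin | exact: lin_0 to_words_lin].
apply: submod_sum => i _; have i_r : (i <= r)%N by rewrite -ltnS.
by have := to_words_hyper (xG i i_r); rewrite subnK.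
Qed.

Lemma path_cohomology_iso r :
  linear_iso (path_cohomology D w (2 + r))
    (cohomology (total_space (hyper C A Th))
      (dtot_lin (dW_lin SC SA) (ddelta_lin (bar_delta_equivariant M2 M1 N))) r).
Proof.
have inj : injective of_words := can_inj of_wordsK.
(* Every word over a path of length two has duration at least two. *)
have cochain1 g : cochain 1 g -> g = 0 :> (word D w -> N).
  move=> [_ g0]; apply/funext => -[[cs m2] [[bs m1] as_]]; apply: g0 => /=.
  by rewrite !addnS.
apply: (@subquo_iso _ _ _ _ _ _ _ of_words); first exact: of_words_lin.
- move=> f [Kf df]; split; first exact: of_words_cochain.
  by rewrite -of_words_coboundary df (lin_0 of_words_lin).
- move=> f _ [g Kg ->]; case: r Kg => [|r] Kg.
    by rewrite (cochain1 g Kg) (lin_0 (@coboundary_linear _ _ D _ _ w)) /= (lin_0 of_words_lin).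
  exists (of_words g); first exact: of_words_cochain.
  exact: of_words_coboundary.
- move=> f _; case: r => [|r] /= => [E|[g Kg E]].
    exists 0; first exact: cochain_0.
    rewrite (lin_0 (@coboundary_linear _ _ D _ _ w)).
    by apply: inj; rewrite E (lin_0 of_words_lin).
  exists (to_words g); first exact: to_words_cochain.
  by apply: inj; rewrite of_words_coboundary to_wordsK.
- move=> g [Kg dg]; exists (to_words g); last by rewrite to_wordsK subrr; exact: sm_0.
  split; first exact: to_words_cochain.
  by apply: inj; rewrite of_words_coboundary to_wordsK (lin_0 of_words_lin).
Qed.

End PathOfLengthTwo.

Theorem theorem5p8 (k : fieldType) (Q : quiver) (hQ : simply_laced Q)
    (D : qset k Q) (x y z : Q) (a1 : arr x y) (a2 : arr y z)
    (R : projres (right_mod (bim D a2)))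
    (hTor : forall n : nat, (0 < n)%N -> forall u : Tor R (bim D a1) n, u = 0)
    (P : projres (tensor (bim D a2) (bim D a1))) (r : nat) :
  exists phi : {linear path_cohomology D (pcons a2 (pcons a1 (pnil x))) (2 + r)
                       -> Ext P (coefficients D x z) r},
    bijective phi.
Proof.
apply: (linear_iso_trans (path_cohomology_iso D a1 a2 r)).
exact: (@bar_hyper_iso k _ _ _ (bim D a2) (bim D a1) (coefficients D x z) R P r hTor).
Qed.
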